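(* Let $n\ge 1$. The short-time Fourier transform $V_gf$ on the Heisenberg group $\mathbb{H}^n$ satisfies the following. (1) (Orthogonality relation) For all $f_1,f_2,g_1,g_2\in L^2(\mathbb{H}^n)$, $$\langle V_{g_1}f_1,V_{g_2}f_2\rangle_{L^2(\mathbb{H}^n\times\mathbb{H}^n)}=\langle f_1,f_2\rangle_{L^2(\mathbb{H}^n)}\,\langle g_2,g_1\rangle_{L^2(\mathbb{H}^n)}.$$ (2) (Plancherel formula) For all $f,g\in L^2(\mathbb{H}^n)$, $$\|V_gf\|_{L^2(\mathbb{H}^n\times\mathbb{H}^n)}=\|f\|_{L^2(\mathbb{H}^n)}\|g\|_{L^2(\mathbb{H}^n)}.$$ (3) (Inversion formula) Let $g,h\in L^2(\mathbb{H}^n)$ satisfy $\langle h,g\rangle_{L^2(\mathbb{H}^n)}\neq 0$. Then for every $f\in L^2(\mathbb{H}^n)$, $$\mathcal{F}(f)=\frac{1}{\langle h,g\rangle_{L^2(\mathbb{H}^n)}}\int_{\mathbb{R}^{2n+1}}\int_{\mathbb{R}^{2n+1}}V_gf(Q,P)\,M_QT_P\mathcal{F}(h)\,dQ\,dP,$$ where the integral is understood in the weak sense, i.e. for every $\Gamma\in L^2(\mathbb{H}^n)$, $\langle \mathcal{F}(f),\Gamma\rangle=\frac{1}{\langle h,g\rangle}\int\int V_gf(Q,P)\,\langle M_QT_P\mathcal{F}(h),\Gamma\rangle\,dQ\,dP$.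
   Context: $\mathbb{H}^n=\mathbb{R}^n\times\mathbb{R}^n\times\mathbb{R}\cong\mathbb{R}^{2n+1}$ is the Heisenberg group with group law $(p,q,t)\cdot(p',q',t')=\left(p+p',q+q',t+t'+\tfrac12(pq'-qp')\right)$, where $pq$ is the Euclidean dot product on $\mathbb{R}^n$. Its Haar measure is Lebesgue measure on $\mathbb{R}^{2n+1}$, so $L^2(\mathbb{H}^n)=L^2(\mathbb{R}^{2n+1})$. Inner products of functions are linear in the first argument and conjugate-linear in the second. $\mathcal{F}$ is the Euclidean Fourier transform on $\mathbb{R}^{2n+1}$, $\mathcal{F}(h)(Q)=\int_{\mathbb{R}^{2n+1}}h(X)e^{-2\pi i\langle Q,X\rangle}\,dX$, extended to a unitary operator on $L^2(\mathbb{R}^{2n+1})$; here $\langle Q,X\rangle$ is the Euclidean inner product on $\mathbb{R}^{2n+1}$. For $P,Q,X\in\mathbb{H}^n$: $T_Ph(X)=h(X\cdot P)$ (Heisenberg product) and $M_Qh(X)=e^{2\pi i\langle Q,X\rangle}h(X)$. The short-time Fourier transform of $f\in L^2(\mathbb{H}^n)$ with window $g\in L^2(\mathbb{H}^n)$ is $$V_gf(Q,P)=\langle\mathcal{F}(f),M_QT_P\mathcal{F}(g)\rangle=\int_{\mathbb{R}^{2n+1}}\mathcal{F}(f)(X)\,\overline{\mathcal{F}(g)(X\cdot P)}\,e^{-2\pi i\langle Q,X\rangle}\,dX,\qquad Q,P\in\mathbb{H}^n.$$ *)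

(* Defs.v *)
From HB Require Import structures.
From mathcomp Require Import all_boot all_order all_algebra.
From mathcomp Require Import all_classical all_reals all_analysis.
From mathcomp Require Import complex.

Set Implicit Arguments.
Unset Strict Implicit.
Unset Printing Implicit Defensive.
Import Order.TTheory GRing.Theory Num.Theory.
Import numFieldNormedType.Exports.

Local Open Scope classical_set_scope.
Local Open Scope ring_scope.
Local Open Scope complex_scope.

(* The library's canonical sigma-finite structure on 'm1 \x m2' is shadowed by
   the one for products of subprobabilities, so it cannot be inferred. *)
Lemma sigma_finite_product d1 d2 (T1 : measurableType d1)
    (T2 : measurableType d2) (R : realType) (m1 : {measure set T1 -> \bar R})
    (m2 : {sigma_finite_measure set T2 -> \bar R}) :
  sigma_finite setT m1 -> sigma_finite setT (m1 \x m2)%E.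
Proof.
move=> /sigma_finiteP[F [TF ndF Foo]].
have /sigma_finiteP[G [TG ndG Goo]] := sigma_finiteT m2.
exists (fun n => F n `*` G n).
  rewrite -setXTT TF TG predeqE => -[x y]; split.
    move=> [/= [n _ Fnx] [k _ Gky]]; exists (maxn n k) => //; split.
    - by move: x Fnx; exact/subsetPset/ndF/leq_maxl.
    - by move: y Gky; exact/subsetPset/ndG/leq_maxr.
  by move=> [n _ []/= ? ?]; split; exists n.
move=> k; have [? ?] := Foo k; have [? ?] := Goo k.
split; first exact: measurableX.
by rewrite product_measure1E// lte_mul_pinfty// ge0_fin_numE.
Qed.

Section lebesgue_tuple.
Context {R : realType}.
Local Notation RR := (measurableTypeR R).

Definition tcons {n} (x : RR * n.-tuple RR) : n.+1.-tuple RR :=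
  [tuple of x.1 :: x.2].

Definition tuncons {n} (x : n.+1.-tuple RR) : RR * n.-tuple RR :=
  (tnth x ord0, [tuple of behead x]).

Lemma tconsK n : cancel (@tcons n) tuncons.
Proof.
move=> [x t]; rewrite /tuncons /tcons /= tnth0; congr pair.
by apply/val_inj.
Qed.

Lemma measurable_tcons n : measurable_fun [set: RR * n.-tuple RR] (@tcons n).
Proof. exact: measurable_cons. Qed.

Lemma measurable_tuncons n : measurable_fun [set: n.+1.-tuple RR] (@tuncons n).
Proof.
by apply/measurable_fun_pair; [exact: measurable_tnth|exact: measurable_behead].
Qed.

Section step.
Variables (n : nat) (m : {sigma_finite_measure set (n.-tuple RR) -> \bar R}).
Local Open Scope ereal_scope.

Definition tcons_measure : set (n.+1.-tuple RR) -> \bar R :=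
  pushforward (@lebesgue_measure R \x m) (@tcons n).

Let tcons_measure0 : tcons_measure set0 = 0.
Proof. by rewrite /tcons_measure /pushforward preimage_set0 measure0. Qed.

Let tcons_measure_ge0 A : 0 <= tcons_measure A.
Proof. by rewrite /tcons_measure /pushforward; exact: measure_ge0. Qed.

Let tcons_measure_sigma_additive : semi_sigma_additive tcons_measure.
Proof.
move=> F mF tF mUF; rewrite /tcons_measure /pushforward preimage_bigcup.
apply: measure_semi_sigma_additive.
- by move=> k; rewrite -[X in measurable X]setTI; exact: measurable_tcons.
- apply/trivIsetP => i j _ _ ij; rewrite -preimage_setI.
  by move/trivIsetP : tF => ->//; rewrite preimage_set0.
- by rewrite -preimage_bigcup -[X in measurable X]setTI; exact: measurable_tcons.
Qed.

HB.instance Definition _ := isMeasure.Build _ _ _ tcons_measure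
  tcons_measure0 tcons_measure_ge0 tcons_measure_sigma_additive.

Let tcons_measure_sigma_finite : sigma_finite [set: n.+1.-tuple RR] tcons_measure.
Proof.
have [F UF Foo] := @sigma_finite_product _ _ _ _ R (@lebesgue_measure R) m
  (sigma_finiteT (@lebesgue_measure R)).
exists (fun k => @tuncons n @^-1` F k).
  by rewrite -preimage_bigcup -UF preimage_setT.
move=> k; have [mF Fk] := Foo k; split.
  by rewrite -[X in measurable X]setTI; exact: measurable_tuncons.
rewrite /tcons_measure /pushforward (_ : _ @^-1` _ = F k)//.
by apply/seteqP; split => x /=; rewrite tconsK.
Qed.

HB.instance Definition _ := Measure_isSigmaFinite.Build _ _ _ tcons_measure
  tcons_measure_sigma_finite.

End step.

(* Lebesgue measure on R^n. *)
Fixpoint lebesgue_tuple n : {sigma_finite_measure set (n.-tuple RR) -> \bar R} :=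
  match n with
  | 0%N => \d_([tuple])
  | m.+1 => tcons_measure (lebesgue_tuple m)
  end.

End lebesgue_tuple.

Section L2.
Context d (T : measurableType d) (R : realType).
Local Notation Re := (@complex.Re R).
Local Notation Im := (@complex.Im R).
Implicit Types (mu : {measure set T -> \bar R}) (f g : T -> R[i]).

Definition cmeasurable f : Prop :=
  measurable_fun [set: T] (Re \o f) /\ measurable_fun [set: T] (Im \o f).

Definition cintegrable mu f : Prop :=
  mu.-integrable [set: T] (EFin \o (Re \o f)) /\
  mu.-integrable [set: T] (EFin \o (Im \o f)).

Definition cintegral mu f : R[i] :=
  (\int[mu]_x Re (f x))%R +i* (\int[mu]_x Im (f x))%R.

Definition L2norm mu f : \bar R := Lnorm mu 2%:E (fun x => (Re `|f x|)%:E).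

Definition L2 mu f : Prop := cmeasurable f /\ (L2norm mu f < +oo)%E.

Definition inner mu f g : R[i] := cintegral mu (fun x => f x * (g x)^*%C).

End L2.


(* 'measurableTypeR R' is the carrier R with its Borel sigma-algebra, which is
   the type on which the library puts Lebesgue measure. *)
Definition heis (R : realType) (n : nat) : Type :=
  (n.-tuple (measurableTypeR R) * n.-tuple (measurableTypeR R)
   * measurableTypeR R)%type.
HB.instance Definition _ R n := Measurable.on (heis R n).

Section heisenberg.
Context {R : realType} {n : nat}.
Local Notation H := (heis R n).
Implicit Types (X Y P Q : H) (f g h u : H -> R[i]).

Definition lebesgue_heis : set H -> \bar R :=
  (lebesgue_tuple n \x lebesgue_tuple n \x @lebesgue_measure R)%E.
HB.instance Definition _ := Measure.on lebesgue_heis.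

Let lebesgue_heis_sigma_finite : sigma_finite [set: H] lebesgue_heis.
Proof.
apply: sigma_finite_product; apply: sigma_finite_product.
exact: sigma_finiteT.
Qed.

HB.instance Definition _ := Measure_isSigmaFinite.Build _ _ _ lebesgue_heis
  lebesgue_heis_sigma_finite.

Definition dot (x y : n.-tuple (measurableTypeR R)) : R :=
  \sum_(i < n) (tnth x i : R) * (tnth y i : R).

Definition addt (x y : n.-tuple (measurableTypeR R)) :
    n.-tuple (measurableTypeR R) :=
  [tuple (tnth x i : R) + (tnth y i : R) | i < n].

Definition hmul X Y : H :=
  let: (p, q, t) := X in let: (p', q', t') := Y in
  (addt p p', addt q q', (t : R) + (t' : R) + 2^-1 * (dot p q' - dot q p')).

Definition hdot X Y : R :=
  let: (p, q, t) := X in let: (p', q', t') := Y in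
  dot p p' + dot q q' + (t : R) * (t' : R).

Definition cis (x : R) : R[i] := cos x +i* sin x.

Definition translation P h : H -> R[i] := fun X => h (hmul X P).

Definition modulation Q h : H -> R[i] :=
  fun X => cis (2 * pi * hdot Q X) * h X.

Definition fourier_integral h : H -> R[i] :=
  fun Q => cintegral lebesgue_heis (fun X => h X * cis (- (2 * pi * hdot Q X))).

(* Extension by density: u is the L^2-limit of the Fourier integrals of some
   L^1 /\ L^2 approximation of h.  Only the class of u modulo null sets is
   determined. *)
Definition is_fourier h u : Prop :=
  L2 lebesgue_heis u /\
  exists hk : nat -> H -> R[i],
    [/\ forall k, cintegrable lebesgue_heis (hk k) /\ L2 lebesgue_heis (hk k),
        L2norm lebesgue_heis (hk k \- h) @[k --> \oo] --> 0%E &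
        L2norm lebesgue_heis (fourier_integral (hk k) \- u) @[k --> \oo]
          --> 0%E].

(* A representative of the Fourier-Plancherel transform of h (the default value
   0 is only used where no transform exists). *)
Definition fourier h : H -> R[i] := xget (fun=> 0) [set u | is_fourier h u].

Definition stft g f : H * H -> R[i] := fun QP =>
  inner lebesgue_heis (fourier f)
    (modulation QP.1 (translation QP.2 (fourier g))).

End heisenberg.

(* Main.v *)
(* On the line, write [I a] for the integral of [exp (- a |q|) |F f q|^2] with
   [f] real.  The Fourier transform of [exp (- a |q|)] is a Poisson kernel of
   unit mass, so by Fubini [2 * I a] plus the integral of
   [(f x - f y)^2 * poisson a (x - y)] equals [2 * |f|^2].  The second term, the
   defect, tends to [0] with [a], which gives Plancherel's formula on L^1 /\ L^2.
   Fubini carries the formula to products, hence to the Heisenberg group, and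
   Riesz-Fischer extends the transform to L^2.

   For fixed [P] the short-time transform is the Fourier integral of
   [X |-> F f X * conj (F g (X P))], so Plancherel in [Q] followed by Tonelli and
   the invariance of the measure under [P |-> X P] gives
   [|V_g f| = |F f| |F g| = |f| |g|].  Polarization in [f], then in [g], yields the
   orthogonality relation; weak inversion is orthogonality for the pairs
   [(F g, F f)] and [(F h, Gamma)]. *)

Require Import Defs.
From HB Require Import structures.
From mathcomp Require Import all_boot all_order all_algebra.
From mathcomp Require Import all_classical all_reals all_analysis.
From mathcomp Require Import measurable_realfun complex.
From mathcomp Require Import ring lra.
Set Implicit Arguments.
Unset Strict Implicit.
Unset Printing Implicit Defensive.
Import Order.TTheory GRing.Theory Num.Theory.
Import numFieldNormedType.Exports.
Local Open Scope classical_set_scope.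
Local Open Scope ring_scope.

(** * Complex-valued functions *)

(** The squared modulus of a transform is a double integral whose phase is not integrable in the
    frequency, so Fubini cannot be applied to it directly. The weight [exp (- a |q|)] repairs this,
    and its own transform comes from explicit antiderivatives. The price is a kernel without first
    moment: a bound of the translates of a function by a multiple of [|u|] does not by itself make
    the defect vanish. It is combined with a bound by a multiple of [|f|^2], which is uniform in [a]
    and therefore also reduces the question from general functions to indicators of intervals.

    The second obstacle is that [fourier] picks a representative known only up to a null set, so it
    is not linear pointwise. Norms and polarization are therefore handled on the relation
    [is_fourier]. Likewise the short-time transform is studied as a form [ambiguity] in two
    arbitrary square-integrable functions, linear in one and conjugate-linear in the other; the
    transforms are substituted only at the end. *)

Section complex_functions.
Context {R : realType}.
Local Notation Re := (@complex.Re R).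
Local Notation Im := (@complex.Im R).
Local Notation C := R[i].
Implicit Types z w : C.

(** The modulus in [R[i]] is itself a complex number and hides a square root. A real polynomial in
    the two parts keeps integrands within reach of [ring] and [nra]. *)
Definition nsq z : R := Re z ^+ 2 + Im z ^+ 2.

Lemma complexP z w : Re z = Re w -> Im z = Im w -> z = w.
Proof. by case: z w => [a b] [c d] /= -> ->. Qed.

Lemma cReD z w : Re (z + w) = Re z + Re w. Proof. by case: z w => ? ? []. Qed.
Lemma cImD z w : Im (z + w) = Im z + Im w. Proof. by case: z w => ? ? []. Qed.
Lemma cReB z w : Re (z - w) = Re z - Re w. Proof. by case: z w => ? ? []. Qed.
Lemma cImB z w : Im (z - w) = Im z - Im w. Proof. by case: z w => ? ? []. Qed.
Lemma cReM z w : Re (z * w) = Re z * Re w - Im z * Im w.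
Proof. by case: z w => ? ? []. Qed.
Lemma cImM z w : Im (z * w) = Re z * Im w + Im z * Re w.
Proof. by case: z w => ? ? []. Qed.
Lemma cReJ z : Re z^*%C = Re z. Proof. by case: z. Qed.
Lemma cImJ z : Im z^*%C = - Im z. Proof. by case: z. Qed.

Lemma conjcD z w : (z + w)^*%C = z^*%C + w^*%C.
Proof. by apply: complexP; rewrite !(cReD, cImD, cReJ, cImJ)// opprD. Qed.

Lemma conjcM z w : (z * w)^*%C = z^*%C * w^*%C.
Proof. by apply: complexP; rewrite !(cReM, cImM, cReJ, cImJ); ring. Qed.

Definition ReImE := (cReB, cImB, cReD, cImD, cReM, cImM, cReJ, cImJ).

Lemma nsq_ge0 z : 0 <= nsq z.
Proof. by rewrite addr_ge0// sqr_ge0. Qed.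

Lemma nsqM z w : nsq (z * w) = nsq z * nsq w.
Proof. by rewrite /nsq !ReImE; ring. Qed.

Lemma nsqJ z : nsq z^*%C = nsq z.
Proof. by rewrite /nsq !ReImE sqrrN. Qed.

Lemma nsq_cis (x : R) : nsq (cis x) = 1.
Proof. by rewrite /nsq /= cos2Dsin2. Qed.

Lemma cisD (x y : R) : cis (x + y) = cis x * cis y.
Proof.
by apply: complexP; rewrite !ReImE /= ?cosD ?sinD; ring.
Qed.

Lemma cisN (x : R) : cis (- x) = (cis x)^*%C.
Proof. by rewrite /cis cosN sinN. Qed.

(** Parallelogram identity with the term [nsq (z - w)] dropped. *)
Lemma nsqD_le z w : nsq (z + w) <= 2 * nsq z + 2 * nsq w.
Proof.
rewrite /nsq !ReImE.
have := sqr_ge0 (Re z - Re w); have := sqr_ge0 (Im z - Im w); nra.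
Qed.

Lemma Re_normE z : Re `|z| = Num.sqrt (nsq z).
Proof. by rewrite normc_def. Qed.

Lemma Re_norm_ge0 z : 0 <= Re `|z|.
Proof. by rewrite Re_normE sqrtr_ge0. Qed.

Lemma sqr_Re_norm z : Re `|z| ^+ 2 = nsq z.
Proof. by rewrite Re_normE sqr_sqrtr// nsq_ge0. Qed.

Lemma Re_normD z w : Re `|z + w| <= Re `|z| + Re `|w|.
Proof. by have := ler_normD z w; rewrite lecE cReD => /andP[_]. Qed.

End complex_functions.

Section complex_measurable.
Context d (T : measurableType d) {R : realType}.
Local Notation Re := (@complex.Re R).
Local Notation Im := (@complex.Im R).
Implicit Types (f g : T -> R[i]).

Lemma cmeasurableD f g : cmeasurable f -> cmeasurable g ->
  cmeasurable (fun x => f x + g x).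
Proof.
move=> [f1 f2] [g1 g2]; split.
- rewrite (_ : _ \o _ = (Re \o f) \+ (Re \o g))%R; first exact: measurable_funD.
  by apply/funext => x /=; rewrite cReD.
- rewrite (_ : _ \o _ = (Im \o f) \+ (Im \o g))%R; first exact: measurable_funD.
  by apply/funext => x /=; rewrite cImD.
Qed.

Lemma cmeasurableM f g : cmeasurable f -> cmeasurable g ->
  cmeasurable (fun x => f x * g x).
Proof.
move=> [f1 f2] [g1 g2]; split.
- rewrite (_ : _ \o _ = ((Re \o f) \* (Re \o g)) \- ((Im \o f) \* (Im \o g)))%R.
    by apply: measurable_funB; exact: measurable_funM.
  by apply/funext => x /=; rewrite cReM.
- rewrite (_ : _ \o _ = ((Re \o f) \* (Im \o g)) \+ ((Im \o f) \* (Re \o g)))%R.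
    by apply: measurable_funD; exact: measurable_funM.
  by apply/funext => x /=; rewrite cImM.
Qed.

Lemma cmeasurableJ f : cmeasurable f -> cmeasurable (fun x => (f x)^*%C).
Proof.
move=> [f1 f2]; split.
- by rewrite (_ : _ \o _ = (Re \o f))//; apply/funext => x /=; rewrite cReJ.
- rewrite (_ : _ \o _ = \- (Im \o f))%R; first exact: measurable_funN.
  by apply/funext => x /=; rewrite cImJ.
Qed.

Lemma cmeasurable_cst (c : R[i]) : cmeasurable (fun _ : T => c).
Proof. by split; exact: measurable_cst. Qed.

Lemma cmeasurableB f g : cmeasurable f -> cmeasurable g ->
  cmeasurable (fun x => f x - g x).
Proof.
move=> mf mg; rewrite (_ : (fun _ => _) = (fun x => f x + (-1) * g x)).
  by apply: cmeasurableD => //; apply: cmeasurableM => //; exact: cmeasurable_cst.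
by apply/funext => x; rewrite mulN1r.
Qed.

Lemma cmeasurable_comp d' (S : measurableType d') (s : S -> T) f :
  measurable_fun setT s -> cmeasurable f -> cmeasurable (f \o s).
Proof.
move=> ms [f1 f2].
by split; [exact: (measurableT_comp f1 ms)|exact: (measurableT_comp f2 ms)].
Qed.

Lemma cmeasurable_cis (s : T -> R) : measurable_fun setT s ->
  cmeasurable (fun x => cis (s x)).
Proof.
move=> ms; split; (apply: measurableT_comp; last exact: ms); apply: continuous_measurable_fun.
- exact: continuous_cos.
- exact: continuous_sin.
Qed.

Lemma measurable_nsq f : cmeasurable f -> measurable_fun setT (fun x => nsq (f x)).
Proof. by move=> [f1 f2]; apply: measurable_funD; exact: measurable_funX. Qed.

Lemma measurable_Ensq f : cmeasurable f ->
  measurable_fun setT (fun x => (nsq (f x))%:E).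
Proof. by move=> mf; exact/measurable_EFinP/measurable_nsq. Qed.

Lemma measurable_Re_norm f : cmeasurable f ->
  measurable_fun setT (fun x => Re `|f x|).
Proof.
move=> mf; under eq_fun do rewrite Re_normE.
apply: measurableT_comp; last exact: measurable_nsq.
by apply: continuous_measurable_fun; exact: sqrt_continuous.
Qed.

End complex_measurable.

Section complex_integral.
Context d (T : measurableType d) {R : realType}.
Variable mu : {measure set T -> \bar R}.
Local Notation Re := (@complex.Re R).
Local Notation Im := (@complex.Im R).
Implicit Types (f g : T -> R[i]).

Lemma cintegrable_cmeasurable f : cintegrable mu f -> cmeasurable f.
Proof.
by move=> [/measurable_int f1 /measurable_int f2]; split; exact/measurable_EFinP.
Qed.

Lemma integrable_le (f g : T -> R) : measurable_fun setT f ->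
  (forall x, `|f x| <= g x) -> mu.-integrable setT (EFin \o g) ->
  mu.-integrable setT (EFin \o f).
Proof.
move=> mf fg; apply: le_integrable => //; first exact/measurable_EFinP.
by move=> x _ /=; rewrite lee_fin (le_trans (fg x))// ler_norm.
Qed.

Lemma cintegrable_le f (g : T -> R) : cmeasurable f ->
  (forall x, `|Re (f x)| <= g x) -> (forall x, `|Im (f x)| <= g x) ->
  mu.-integrable setT (EFin \o g) -> cintegrable mu f.
Proof.
by move=> [f1 f2] fg1 fg2 ig; split; apply: (integrable_le _ _ ig).
Qed.

Lemma cintegrableD f g : cintegrable mu f -> cintegrable mu g ->
  cintegrable mu (fun x => f x + g x).
Proof.
move=> [f1 f2] [g1 g2]; split.
- rewrite (_ : _ \o _ = (EFin \o (Re \o f)) \+ (EFin \o (Re \o g)))%E.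
    exact: integrableD.
  by apply/funext => x /=; rewrite cReD.
- rewrite (_ : _ \o _ = (EFin \o (Im \o f)) \+ (EFin \o (Im \o g)))%E.
    exact: integrableD.
  by apply/funext => x /=; rewrite cImD.
Qed.

Lemma cintegralD f g : cintegrable mu f -> cintegrable mu g ->
  cintegral mu (fun x => f x + g x) = cintegral mu f + cintegral mu g.
Proof.
move=> [f1 f2] [g1 g2]; apply: complexP; rewrite !ReImE /=.
- by under eq_Rintegral do rewrite cReD; rewrite RintegralD.
- by under eq_Rintegral do rewrite cImD; rewrite RintegralD.
Qed.

Lemma integrable_abs_ReIm f : cintegrable mu f ->
  mu.-integrable setT (EFin \o (fun x => `|Re (f x)| + `|Im (f x)|)).
Proof.
move=> [/integrable_norm f1 /integrable_norm f2].
by rewrite (_ : _ \o _ = ((EFin \o (fun x => `|Re (f x)|%R)) \+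
  (EFin \o (fun x => `|Im (f x)|%R)))%E)//; exact: integrableD.
Qed.

Lemma cintegrableM f g (M : R) : cintegrable mu f -> cmeasurable g ->
  (forall x, `|Re (g x)| <= M) -> (forall x, `|Im (g x)| <= M) ->
  cintegrable mu (fun x => f x * g x).
Proof.
move=> intf mg gM1 gM2.
apply: (@cintegrable_le _ (fun x => M * (`|Re (f x)| + `|Im (f x)|))).
- by apply: cmeasurableM => //; exact: cintegrable_cmeasurable intf.
- move=> x; rewrite cReM (le_trans (ler_normB _ _))// !normrM mulrDr.
  by rewrite ![M * _]mulrC lerD// ler_wpM2l.
- move=> x; rewrite cImM (le_trans (ler_normD _ _))// !normrM mulrDr.
  by rewrite ![M * _]mulrC lerD// ler_wpM2l.
- rewrite (_ : _ \o _ = (fun x => M%:E *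
    (EFin \o (fun x => `|Re (f x)| + `|Im (f x)|)%R) x)%E)//.
  by apply: integrableZl => //; exact: integrable_abs_ReIm.
Qed.

Lemma cintegrableZl f (c : R[i]) : cintegrable mu f ->
  cintegrable mu (fun x => c * f x).
Proof.
move=> intf; under eq_fun do rewrite mulrC.
apply: (@cintegrableM _ _ (`|Re c| + `|Im c|)) => //.
- exact: cmeasurable_cst.
- by move=> _; rewrite lerDl.
- by move=> _; rewrite lerDr.
Qed.

Lemma cintegralZl f (c : R[i]) : cintegrable mu f ->
  cintegral mu (fun x => c * f x) = c * cintegral mu f.
Proof.
move=> [f1 f2].
have h (k : R) (u : T -> R) : mu.-integrable setT (EFin \o u) ->
    mu.-integrable setT (EFin \o (fun x => k * u x)).
  by move=> iu; apply: (@integrableZl _ _ _ mu setT _ k (EFin \o u)).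
apply: complexP; rewrite !ReImE /=.
- under eq_Rintegral do rewrite cReM; rewrite RintegralB//; [|exact: h..].
  by rewrite !RintegralZl.
- under eq_Rintegral do rewrite cImM; rewrite RintegralD//; [|exact: h..].
  by rewrite !RintegralZl.
Qed.

Lemma cintegralJ f : cintegrable mu f ->
  cintegral mu (fun x => (f x)^*%C) = (cintegral mu f)^*%C.
Proof.
move=> [f1 f2]; apply: complexP; rewrite !ReImE /=.
- by under eq_Rintegral do rewrite cReJ.
- under eq_Rintegral do rewrite cImJ -mulN1r.
  by rewrite RintegralZl// mulN1r.
Qed.

End complex_integral.

(** * Square-integrable functions *)

Section square_integrable.
Context d (T : measurableType d) {R : realType}.
Variable mu : {measure set T -> \bar R}.
Local Notation Re := (@complex.Re R).
Local Notation Im := (@complex.Im R).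
Implicit Types (f g : T -> R[i]).

(** The square of [L2norm], kept in the extended reals: Tonelli and monotone comparison apply to it
    before finiteness is known, and no fractional power appears. *)
Definition N2 f : \bar R := (\int[mu]_x (nsq (f x))%:E)%E.

Lemma N2_ge0 f : (0 <= N2 f)%E.
Proof. by apply: integral_ge0 => x _; rewrite lee_fin nsq_ge0. Qed.

Lemma L2norm_ge0 f : (0 <= L2norm mu f)%E.
Proof. exact: Lnorm_ge0. Qed.

Lemma L2normE f : L2norm mu f = (N2 f `^ 2^-1)%E.
Proof.
rewrite /L2norm [in LHS]unlock; congr (_ `^ _)%E; apply: eq_integral => x _.
rewrite gee0_abs ?lee_fin ?Re_norm_ge0// poweR_EFin powR_mulrn ?Re_norm_ge0//.
by rewrite sqr_Re_norm.
Qed.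

Lemma L2norm_sqr f : (L2norm mu f `^ 2 = N2 f)%E.
Proof.
by rewrite L2normE -poweRrM mulVf ?pnatr_eq0// poweRe1// N2_ge0.
Qed.

Lemma L2norm_lty f : (L2norm mu f < +oo)%E = (N2 f < +oo)%E.
Proof.
apply/idP/idP; last by rewrite L2normE; exact: poweR_lty.
by rewrite -L2norm_sqr; exact: poweR_lty.
Qed.

Lemma L2P f : L2 mu f <-> cmeasurable f /\ (N2 f < +oo)%E.
Proof. by rewrite /L2 L2norm_lty. Qed.

Lemma integrable_nsq f : L2 mu f -> mu.-integrable setT (fun x => (nsq (f x))%:E).
Proof.
move=> /L2P[mf Nf]; apply/integrableP; split; first exact: measurable_Ensq.
by under eq_integral do rewrite gee0_abs ?lee_fin ?nsq_ge0//.
Qed.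

Lemma N2_fin_num f : L2 mu f -> N2 f \is a fin_num.
Proof. by move=> /L2P[_ Nf]; rewrite ge0_fin_numE// N2_ge0. Qed.

Lemma le_N2 f g : cmeasurable f -> cmeasurable g ->
  (forall x, nsq (f x) <= nsq (g x)) -> (N2 f <= N2 g)%E.
Proof.
move=> mf mg fg; apply: ge0_le_integral => //; try exact: measurable_Ensq.
- by move=> x _; rewrite lee_fin nsq_ge0.
- by move=> x _; rewrite lee_fin.
Qed.

Lemma N2D_le f g : cmeasurable f -> cmeasurable g ->
  (N2 (fun x => f x + g x)%R <= 2%:E * N2 f + 2%:E * N2 g)%E.
Proof.
move=> mf mg; rewrite /N2.
have n0 h x : (0 <= (nsq (h x : R[i]))%:E)%E by rewrite lee_fin nsq_ge0.
rewrite -!ge0_integralZl_EFin ?ler0n//; try exact: measurable_Ensq.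
have m2 h : cmeasurable h -> measurable_fun [set: T] (fun x => 2%:E * (nsq (h x : R[i]))%:E)%E.
  by move=> mh; apply: measurable_funeM; exact: measurable_Ensq.
rewrite -ge0_integralD//; try exact: m2; try by move=> x _; rewrite mule_ge0.
apply: ge0_le_integral => //.
- by apply: measurable_Ensq; exact: cmeasurableD.
- by apply: emeasurable_funD; exact: m2.
- by move=> x _; rewrite -!EFinM -EFinD lee_fin nsqD_le.
Qed.

Lemma L2D f g : L2 mu f -> L2 mu g -> L2 mu (fun x => f x + g x).
Proof.
move=> /L2P[mf Nf] /L2P[mg Ng]; apply/L2P; split; first exact: cmeasurableD.
rewrite (le_lt_trans (N2D_le mf mg))// lte_add_pinfty//.
  by rewrite lte_mul_pinfty// ?lee_fin// N2_fin_num//; exact/L2P.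
by rewrite lte_mul_pinfty// ?lee_fin// N2_fin_num//; exact/L2P.
Qed.

Lemma N2Zl (c : R[i]) f : cmeasurable f ->
  N2 (fun x => c * f x) = ((nsq c)%:E * N2 f)%E.
Proof.
move=> mf; rewrite /N2 -ge0_integralZl_EFin ?nsq_ge0//.
- by apply: eq_integral => x _; rewrite nsqM.
- by move=> x _; rewrite lee_fin nsq_ge0.
- exact: measurable_Ensq.
Qed.

Lemma L2Zl (c : R[i]) f : L2 mu f -> L2 mu (fun x => c * f x).
Proof.
move=> /L2P[mf Nf]; apply/L2P; split.
  by apply: cmeasurableM => //; exact: cmeasurable_cst.
by rewrite N2Zl// lte_mul_pinfty// ?lee_fin ?nsq_ge0.
Qed.

Lemma L2B f g : L2 mu f -> L2 mu g -> L2 mu (fun x => f x - g x).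
Proof.
move=> Lf Lg; rewrite (_ : (fun _ => _) = (fun x => f x + (-1) * g x)).
  by apply: L2D => //; exact: L2Zl.
by apply/funext => x; rewrite mulN1r.
Qed.

(** The pointwise triangle inequality, followed by Minkowski's inequality for the two moduli. *)
Lemma L2norm_triangle f g : cmeasurable f -> cmeasurable g ->
  (L2norm mu (fun x => f x + g x)%R <= L2norm mu f + L2norm mu g)%E.
Proof.
move=> mf mg.
have [nf ng] := (measurable_Re_norm mf, measurable_Re_norm mg).
apply: (@le_trans _ _ (Lnorm mu 2%:E
    (EFin \o ((fun x => Re `|f x|) \+ (fun x => Re `|g x|))%R)))%E; last first.
  by apply: eminkowski => //; rewrite lee_fin ler1n.
rewrite /L2norm [in leLHS]unlock [in leRHS]unlock.
have pw (a : R) : 0 <= a -> (`|a%:E| `^ 2 = (a ^+ 2)%:E)%E.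
  by move=> a0; rewrite gee0_abs ?lee_fin// poweR_EFin powR_mulrn.
apply: gt0_ler_poweR; first by rewrite invr_ge0.
- by rewrite in_itv/= leey andbT; apply: integral_ge0 => x _ /=; rewrite ?poweR_ge0.
- by rewrite in_itv/= leey andbT; apply: integral_ge0 => x _ /=; rewrite ?poweR_ge0.
have fg0 x : 0 <= Re `|f x| + Re `|g x| by rewrite addr_ge0// Re_norm_ge0.
under eq_integral do rewrite pw ?Re_norm_ge0//.
rewrite [leRHS](_ : _ = \int[mu]_x ((Re `|f x| + Re `|g x|) ^+ 2)%:E)%E; last first.
  by apply: eq_integral => x _; exact: (pw _ (fg0 x)).
apply: ge0_le_integral => //.
- by move=> x _; rewrite lee_fin sqr_ge0.
- by apply/measurable_EFinP/measurable_funX/measurable_Re_norm; exact: cmeasurableD.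
- by apply/measurable_EFinP/measurable_funX; exact: measurable_funD.
- move=> x _; rewrite lee_fin ler_sqr ?nnegrE ?Re_norm_ge0//; exact: Re_normD.
Qed.

(** Both parts of [z * w] are at most [nsq z + nsq w] in absolute value, by completing squares; the
    sum of the two squared moduli is then an integrable bound. *)
Lemma L2_cintegrable f g : L2 mu f -> L2 mu g ->
  cintegrable mu (fun x => f x * (g x)^*%C).
Proof.
move=> Lf Lg; have [mf mg] := (Lf.1, Lg.1).
have h (z w : R[i]) : `|Re (z * w)| <= nsq z + nsq w /\ `|Im (z * w)| <= nsq z + nsq w.
  rewrite !ReImE /nsq !ler_norml.
  case: z w => [a b] [e c] /=.
  by split; apply/andP; split;
    have := sqr_ge0 (a - e); have := sqr_ge0 (a + e); have := sqr_ge0 (b - c);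
    have := sqr_ge0 (b + c); have := sqr_ge0 (a - c); have := sqr_ge0 (a + c);
    have := sqr_ge0 (b - e); have := sqr_ge0 (b + e); nra.
apply: (@cintegrable_le _ _ _ _ _ (fun x => nsq (f x) + nsq (g x))).
- by apply: cmeasurableM => //; exact: cmeasurableJ.
- by move=> x; rewrite -(nsqJ (g x)); have [] := h (f x) (g x)^*%C.
- by move=> x; rewrite -(nsqJ (g x)); have [] := h (f x) (g x)^*%C.
- by rewrite (_ : _ \o _ = (fun x => (nsq (f x))%:E) \+ (fun x => (nsq (g x))%:E))%E//;
  apply: integrableD => //; exact: integrable_nsq.
Qed.

Lemma innerDl f g h : L2 mu f -> L2 mu g -> L2 mu h ->
  inner mu (fun x => f x + g x) h = inner mu f h + inner mu g h.
Proof.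
move=> Lf Lg Lh; rewrite /inner; under eq_fun do rewrite mulrDl.
by rewrite cintegralD//; exact: L2_cintegrable.
Qed.

Lemma innerZl c f g : L2 mu f -> L2 mu g ->
  inner mu (fun x => c * f x) g = c * inner mu f g.
Proof.
move=> Lf Lg; rewrite /inner; under eq_fun do rewrite -mulrA.
by rewrite cintegralZl//; exact: L2_cintegrable.
Qed.

Lemma innerJ f g : L2 mu f -> L2 mu g -> inner mu g f = (inner mu f g)^*%C.
Proof.
move=> Lf Lg; rewrite /inner -cintegralJ; last exact: L2_cintegrable.
by congr cintegral; apply/funext => x; apply: complexP; rewrite !ReImE; ring.
Qed.

Lemma innerDr f g h : L2 mu f -> L2 mu g -> L2 mu h ->
  inner mu f (fun x => g x + h x) = inner mu f g + inner mu f h.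
Proof.
move=> Lf Lg Lh; rewrite innerJ//; last exact: L2D.
by rewrite innerDl// conjcD -!innerJ.
Qed.

Lemma innerZr c f g : L2 mu f -> L2 mu g ->
  inner mu f (fun x => c * g x) = c^*%C * inner mu f g.
Proof.
move=> Lf Lg; rewrite innerJ//; last exact: L2Zl.
by rewrite innerZl// conjcM -innerJ.
Qed.

Lemma innerxx f : inner mu f f = (fine (N2 f))%:C%C.
Proof.
apply: complexP; rewrite /= /N2 /Rintegral.
- congr fine; apply: eq_integral => x _.
  by rewrite !ReImE; congr EFin; rewrite /nsq; ring.
- rewrite -[RHS]/(fine 0%E) -[in RHS](integral0 mu setT); congr fine.
  by apply: eq_integral => x _; rewrite !ReImE; congr EFin; ring.
Qed.

End square_integrable.

(* A sesquilinear form vanishing on the diagonal vanishes: compare its values at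
   [x + y] and at [x + i y]. *)
Lemma sesquilinear_eq0 (R : realType) (X : Type) (P : X -> Prop)
    (add : X -> X -> X) (muli : X -> X) (S : X -> X -> R[i]) :
  (forall x y, P x -> P y -> P (add x y)) ->
  (forall x, P x -> P (muli x)) ->
  (forall x y z, P x -> P y -> P z -> S (add x y) z = S x z + S y z) ->
  (forall x y z, P x -> P y -> P z -> S x (add y z) = S x y + S x z) ->
  (forall x y, P x -> P y -> S (muli x) y = 'i%C * S x y) ->
  (forall x y, P x -> P y -> S x (muli y) = - 'i%C * S x y) ->
  (forall x, P x -> S x x = 0) ->
  forall x y, P x -> P y -> S x y = 0.
Proof.
move=> Padd Pmuli SDl SDr SZl SZr S0 x y Px Py.
have e1 : S x y + S y x = 0.
  have := S0 _ (Padd _ _ Px Py).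
  have Pxy := Padd _ _ Px Py.
  by rewrite SDl// !SDr// !S0// add0r addr0.
have e2 : - 'i%C * S x y + 'i%C * S y x = 0.
  have Piy := Pmuli _ Py; have := S0 _ (Padd _ _ Px Piy).
  have Pxy := Padd _ _ Px Piy.
  by rewrite SDl// !SDr// !S0// add0r addr0 SZr// SZl.
have {e1}e1 : S y x = - S x y by apply/eqP; rewrite -addr_eq0 addrC e1.
move: e2; rewrite e1 mulrN -mulNr -mulrDl => /eqP.
rewrite mulf_eq0 => /orP[|/eqP//].
rewrite -opprD oppr_eq0 -mulr2n mulrn_eq0 /= => /eqP/(congr1 (@complex.Im R))/= /eqP.
by rewrite oner_eq0.
Qed.

(** * Null sets, integrals with a parameter, and Fubini *)

Section ae_integral.
Context d (T : measurableType d) {R : realType}.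
Variable mu : {measure set T -> \bar R}.

Lemma ae_eq_Rintegral (f g : T -> R) :
  measurable_fun setT f -> measurable_fun setT g ->
  {ae mu, forall x, f x = g x} -> \int[mu]_x f x = \int[mu]_x g x.
Proof.
move=> mf mg fg; congr fine; apply: ae_eq_integral => //.
- exact/measurable_EFinP.
- exact/measurable_EFinP.
- by apply: filterS fg => x fgx _; rewrite fgx.
Qed.

Lemma ae_eq_cintegral (f g : T -> R[i]) : cmeasurable f -> cmeasurable g ->
  {ae mu, forall x, f x = g x} -> cintegral mu f = cintegral mu g.
Proof.
move=> [f1 f2] [g1 g2] fg; apply: complexP => /=; apply: ae_eq_Rintegral => //.
- by apply: filterS fg => x ->.
- by apply: filterS fg => x ->.
Qed.

Lemma ae_eq_ge0_integral (f g : T -> \bar R) :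
  measurable_fun setT f -> measurable_fun setT g ->
  (forall x, 0 <= f x)%E -> (forall x, 0 <= g x)%E ->
  {ae mu, forall x, f x = g x} -> (\int[mu]_x f x = \int[mu]_x g x)%E.
Proof.
move=> mf mg f0 g0 fg; apply: ge0_ae_eq_integral => //.
by apply: filterS fg => x fgx _.
Qed.

End ae_integral.

Section parametric_integral.
Context d1 d2 (T1 : measurableType d1) (T2 : measurableType d2) {R : realType}.
Variable m2 : {sigma_finite_measure set T2 -> \bar R}.

(** Measurability holds even where the integral diverges: Tonelli gives it for the positive and the
    negative part, and [fine] is measurable on all extended reals. *)
Lemma measurable_Rintegral_param (f : T1 * T2 -> R) : measurable_fun setT f ->
  measurable_fun setT (fun x => \int[m2]_y f (x, y)).
Proof.
move=> mf; rewrite /Rintegral.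
apply: (@measurableT_comp _ _ _ _ _ _ fine).
  exact: fine_measurable.
have mEf : measurable_fun setT (EFin \o f) by exact/measurable_EFinP.
rewrite (_ : (fun _ => _) = (fubini_F m2 (EFin \o f)^\+ \- fubini_F m2 (EFin \o f)^\-)%E).
  apply: emeasurable_funB; apply: measurable_fun_fubini_tonelli_F => //.
  - exact: measurable_funepos.
  - exact: measurable_funeneg.
apply/funext => x; rewrite integralE /fubini_F.
by congr (_ - _)%E; apply: eq_integral => y _; rewrite ?funeposE ?funenegE.
Qed.

Lemma cmeasurable_cintegral_param (f : T1 * T2 -> R[i]) : cmeasurable f ->
  cmeasurable (fun x => cintegral m2 (fun y => f (x, y))).
Proof.
move=> [f1 f2]; split.
- exact: (measurable_Rintegral_param f1).
- exact: (measurable_Rintegral_param f2).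
Qed.

End parametric_integral.

Section fubini.
Context d1 d2 (T1 : measurableType d1) (T2 : measurableType d2) {R : realType}.
Variable m1 : {sigma_finite_measure set T1 -> \bar R}.
Variable m2 : {sigma_finite_measure set T2 -> \bar R}.
Local Notation m := (m1 \x m2)%E.

Lemma measurable_pairl (y : T2) : measurable_fun setT (fun x : T1 => (x, y)).
Proof. by apply: measurable_fun_pair => //; exact: measurable_cst. Qed.

Lemma measurable_pairr (x : T1) : measurable_fun setT (fun y : T2 => (x, y)).
Proof. by apply: measurable_fun_pair => //; exact: measurable_cst. Qed.

Section real.
Variable f : T1 * T2 -> R.
Hypothesis intf : m.-integrable setT (EFin \o f).
Let mf : measurable_fun setT f.
Proof. by apply/measurable_EFinP; exact: (measurable_int _ intf). Qed.

Let mF : measurable_fun setT (fun x => \int[m2]_y f (x, y)).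
Proof. exact: measurable_Rintegral_param. Qed.

Let mG : measurable_fun setT (fun y => \int[m1]_x f (x, y)).
Proof.
apply: (@measurable_Rintegral_param _ _ _ _ _ m1 (fun z => f (z.2, z.1))).
by apply: (measurableT_comp mf); exact: measurable_fun_pair.
Qed.

(** [Rintegral] passes through [fine], so iterated real integrals agree with the extended ones only
    where the inner integral is finite, which is almost everywhere. *)
Let ae_fin d (T : measurableType d) (mu : {measure set T -> \bar R}) (g : T -> \bar R) :
  mu.-integrable setT g -> {ae mu, forall x, (fine (g x))%:E = g x}.
Proof.
move=> ig; have := integrable_ae measurableT ig.
by apply: filterS => x gx; rewrite fineK// gx.
Qed.

Let ae_fin_integrable d (T : measurableType d) (mu : {measure set T -> \bar R})
  (g : T -> \bar R) : mu.-integrable setT g ->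
  mu.-integrable setT (fun x => (fine (g x))%:E).
Proof.
move=> ig; have mg := measurable_int _ ig.
apply/integrableP; split; first by apply/measurable_EFinP; exact: (measurableT_comp (fine_measurable measurableT)).
have [_] := integrableP _ _ _ ig; apply: le_lt_trans.
apply: ge0_le_integral => //.
- apply/measurableT_comp => //; apply/measurable_EFinP.
  exact: (measurableT_comp (fine_measurable measurableT)).
- exact/measurableT_comp.
- by move=> x _; case: (g x) => //=; rewrite leey.
Qed.

Let eq_fin_integral d (T : measurableType d) (mu : {measure set T -> \bar R})
  (g : T -> \bar R) : mu.-integrable setT g ->
  (\int[mu]_x (fine (g x))%:E = \int[mu]_x g x)%E.
Proof.
move=> ig; have mg := measurable_int _ ig.
apply: ae_eq_integral => //.
- apply/measurable_EFinP; exact: (measurableT_comp (fine_measurable measurableT)).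
- by apply: filterS (ae_fin ig) => x gx _.
Qed.

Let integrable_G : m2.-integrable setT (fubini_G m1 (EFin \o f)).
Proof.
have mEf : measurable_fun setT (EFin \o f) := measurable_int _ intf.
have mA : measurable_fun setT (fun z => `|(EFin \o f) z|)%E by exact: measurableT_comp.
apply/integrableP; split; first exact: (measurable_fubini_G intf).
apply: le_lt_trans ((integrable21ltyP _ _ mEf).1 intf).
apply: ge0_le_integral => //.
- by apply: measurableT_comp => //; exact: (measurable_fubini_G intf).
- exact: (measurable_fun_fubini_tonelli_G _ mA).
- move=> y _; apply: le_abse_integral => //.
  exact: (measurableT_comp mEf (measurable_pairl y)).
Qed.

Lemma integrable_RintegralG :
  m2.-integrable setT (EFin \o (fun y => \int[m1]_x f (x, y))).
Proof. exact: (ae_fin_integrable (integrable_G)). Qed.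

Lemma Rintegral_fubiniF :
  \int[m]_z f z = \int[m1]_x \int[m2]_y f (x, y).
Proof.
rewrite /Rintegral -(integral12_prod_meas1 intf); congr fine; symmetry.
exact: (eq_fin_integral (integrable_fubini_F intf)).
Qed.

Lemma Rintegral_fubiniG :
  \int[m]_z f z = \int[m2]_y \int[m1]_x f (x, y).
Proof.
rewrite /Rintegral -(integral21_prod_meas1 intf); congr fine; symmetry.
exact: (eq_fin_integral (integrable_G)).
Qed.

End real.

Section complex.
Variable f : T1 * T2 -> R[i].
Hypothesis intf : cintegrable m f.
Let f1 := intf.1.
Let f2 := intf.2.

Lemma cintegrable_cintegralG :
  cintegrable m2 (fun y => cintegral m1 (fun x => f (x, y))).
Proof. by split; [exact: (integrable_RintegralG f1)|exact: (integrable_RintegralG f2)]. Qed.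

Lemma cintegral_fubiniG :
  cintegral m f = cintegral m2 (fun y => cintegral m1 (fun x => f (x, y))).
Proof.
by apply: complexP => /=; [rewrite (Rintegral_fubiniG f1)|rewrite (Rintegral_fubiniG f2)].
Qed.

Lemma ae_cintegrableG : {ae m2, forall y, cintegrable m1 (fun x => f (x, y))}.
Proof.
move: (ae_integrable2 f1) (ae_integrable2 f2).
by apply: filterS2 => x h1 h2; split.
Qed.

End complex.

Section squares.
Variable f : T1 * T2 -> R[i].
Hypothesis mf : cmeasurable f.

Let mnf : measurable_fun setT (fun z => (nsq (f z))%:E).
Proof. exact: measurable_Ensq. Qed.

Let nf0 z : (0 <= (nsq (f z))%:E)%E. Proof. by rewrite lee_fin nsq_ge0. Qed.

Lemma cmeasurable_sectionF x : cmeasurable (fun y => f (x, y)).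
Proof. exact: (cmeasurable_comp (measurable_pairr x) mf). Qed.

Lemma cmeasurable_sectionG y : cmeasurable (fun x => f (x, y)).
Proof. exact: (cmeasurable_comp (measurable_pairl y) mf). Qed.

Lemma N2_tonelliF : N2 m f = (\int[m1]_x N2 m2 (fun y => f (x, y)))%E.
Proof. exact: fubini_tonelli1. Qed.

Lemma N2_tonelliG : N2 m f = (\int[m2]_y N2 m1 (fun x => f (x, y)))%E.
Proof. exact: fubini_tonelli2. Qed.

Lemma measurable_N2F : measurable_fun setT (fun x => N2 m2 (fun y => f (x, y))).
Proof. exact: (measurable_fun_fubini_tonelli_F _ mnf). Qed.

Lemma measurable_N2G : measurable_fun setT (fun y => N2 m1 (fun x => f (x, y))).
Proof. exact: (measurable_fun_fubini_tonelli_G _ mnf). Qed.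

Lemma ae_L2F : L2 m f -> {ae m1, forall x, L2 m2 (fun y => f (x, y))}.
Proof.
move=> /integrable_nsq /ae_integrable1; apply: filterS => x /integrableP[_ h].
apply/L2P; split; first exact: cmeasurable_sectionF.
by move: h; under eq_integral do rewrite gee0_abs ?lee_fin ?nsq_ge0//.
Qed.

Lemma ae_L2G : L2 m f -> {ae m2, forall y, L2 m1 (fun x => f (x, y))}.
Proof.
move=> /integrable_nsq /ae_integrable2; apply: filterS => y /integrableP[_ h].
apply/L2P; split; first exact: cmeasurable_sectionG.
by move: h; under eq_integral do rewrite gee0_abs ?lee_fin ?nsq_ge0//.
Qed.

End squares.

End fubini.

(** * Tensorization of Plancherel's formula *)

Section phase_transform.
Context d (T : measurableType d) {R : realType}.
Implicit Types (mu : {measure set T -> \bar R}) (phi : T -> T -> R).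

(* [phi q x] plays the role of the Euclidean inner product of [q] and [x]. *)
Definition phase_transform mu phi (h : T -> R[i]) : T -> R[i] :=
  fun q => cintegral mu (fun x => h x * cis (- (2 * pi * phi q x))).

(** Integrability makes the transform an absolutely convergent integral at each frequency. Joint
    measurability of [phi] makes the transform measurable, and it is part of the property so that it
    passes to products. *)
Definition plancherel mu phi :=
  measurable_fun setT (fun qx : T * T => phi qx.1 qx.2) /\
  forall h, cintegrable mu h -> L2 mu h ->
    N2 mu (phase_transform mu phi h) = N2 mu h.

Lemma cintegrable_cis mu (h : T -> R[i]) (s : T -> R) : measurable_fun setT s ->
  cintegrable mu h -> cintegrable mu (fun x => h x * cis (s x)).
Proof.
move=> ms ih; apply: (@cintegrableM _ _ _ _ _ _ 1) => //.
- exact: cmeasurable_cis.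
- by move=> x /=; rewrite ler_norml cos_geN1 cos_le1.
- by move=> x /=; rewrite ler_norml sin_geN1 sin_le1.
Qed.

End phase_transform.

Lemma measurable_uncurry_comp d1 d2 (T1 : measurableType d1)
    (T2 : measurableType d2) (R : realType) (phi : T2 -> T2 -> R) (a b : T1 -> T2) :
  measurable_fun setT (fun qx : T2 * T2 => phi qx.1 qx.2) ->
  measurable_fun setT a -> measurable_fun setT b ->
  measurable_fun setT (fun x => phi (a x) (b x)).
Proof.
move=> mphi ma mb.
exact: (measurableT_comp mphi (measurable_fun_pair ma mb)).
Qed.

Section phase_transform_measurable.
Context d (T : measurableType d) {R : realType}.
Variables (mu : {sigma_finite_measure set T -> \bar R}) (phi : T -> T -> R).
Hypothesis mphi : measurable_fun setT (fun qx : T * T => phi qx.1 qx.2).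

Lemma measurable_phase (q : T) :
  measurable_fun setT (fun x => - (2 * pi * phi q x)).
Proof.
apply: measurable_funN; apply: measurable_funM => //.
exact: (measurableT_comp mphi (measurable_pairr q)).
Qed.

Lemma cmeasurable_phase_transform (h : T -> R[i]) : cmeasurable h ->
  cmeasurable (phase_transform mu phi h).
Proof.
move=> mh.
apply: (@cmeasurable_cintegral_param _ _ _ _ _ mu
  (fun qx => h qx.2 * cis (- (2 * pi * phi qx.1 qx.2)))).
apply: cmeasurableM; first exact: (cmeasurable_comp measurable_snd mh).
by apply: cmeasurable_cis; apply: measurable_funN; apply: measurable_funM.
Qed.

Lemma cintegrable_phase (h : T -> R[i]) q : cintegrable mu h ->
  cintegrable mu (fun x => h x * cis (- (2 * pi * phi q x))).
Proof. by move=> ih; apply: cintegrable_cis => //; exact: measurable_phase. Qed.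

End phase_transform_measurable.

Section plancherel_product.
Context d1 d2 (T1 : measurableType d1) (T2 : measurableType d2) {R : realType}.
Variable m1 : {sigma_finite_measure set T1 -> \bar R}.
Variable m2 : {sigma_finite_measure set T2 -> \bar R}.
Local Notation m := (m1 \x m2)%E.
Variables (phi1 : T1 -> T1 -> R) (phi2 : T2 -> T2 -> R).
Hypothesis P1 : plancherel m1 phi1.
Hypothesis P2 : plancherel m2 phi2.
Let mphi1 := P1.1.
Let mphi2 := P2.1.
Let phi (q x : T1 * T2) : R := phi1 q.1 x.1 + phi2 q.2 x.2.

Let mphi : measurable_fun setT (fun qx : (T1 * T2) * (T1 * T2) => phi qx.1 qx.2).
Proof.
apply: measurable_funD.
- by apply: (measurable_uncurry_comp mphi1); apply: measurableT_comp.
- by apply: (measurable_uncurry_comp mphi2); apply: measurableT_comp.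
Qed.

Section transform.
Variable h : T1 * T2 -> R[i].
Hypothesis ih : cintegrable m h.
Hypothesis Lh : L2 m h.
Let mh : cmeasurable h := Lh.1.

(** Partial transform: the first variable is already a frequency, the second still a position. It
    preserves [N2] through the slices at fixed [z.2]; the remaining transform does so through the
    slices at fixed [z.1]. *)
Let G (z : T1 * T2) : R[i] := phase_transform m1 phi1 (fun x1 => h (x1, z.2)) z.1.

Let mG : cmeasurable G.
Proof.
apply: (@cmeasurable_cintegral_param _ _ _ _ _ m1
  (fun w : (T1 * T2) * T1 => h (w.2, w.1.2) * cis (- (2 * pi * phi1 w.1.1 w.2)))).
apply: cmeasurableM.
- apply: (cmeasurable_comp _ mh); apply: measurable_fun_pair => //.
  by apply: measurableT_comp.
- apply: cmeasurable_cis; apply: measurable_funN; apply: measurable_funM => //.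
  by apply: (measurable_uncurry_comp mphi1) => //; apply: measurableT_comp.
Qed.

(** Integrating out the first variable of this function gives [G (q1, _)], which is therefore
    integrable for every [q1]. Plancherel's formula in the second variable also asks for
    square-integrability, available for almost every [q1]. *)
Let kernel1 q1 : cintegrable m (fun x => h x * cis (- (2 * pi * phi1 q1 x.1))).
Proof.
apply: cintegrable_cis => //.
exact: (measurableT_comp (measurable_phase mphi1 q1) measurable_fst).
Qed.

Let ih_section := ae_cintegrableG ih.

Let phase_transformE q1 q2 :
  phase_transform m phi h (q1, q2) = phase_transform m2 phi2 (fun x2 => G (q1, x2)) q2.
Proof.
rewrite /phase_transform cintegral_fubiniG; last first.
  by apply: cintegrable_cis => //; exact: measurable_phase.
apply: ae_eq_cintegral.
- apply: (@cmeasurable_cintegral_param _ _ _ _ _ m1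
    (fun z => h (z.2, z.1) * cis (- (2 * pi * phi (q1, q2) (z.2, z.1))))).
  have ms : measurable_fun setT (fun z : T2 * T1 => (z.2, z.1)).
    exact: measurable_fun_pair.
  apply: cmeasurableM; first exact: (cmeasurable_comp ms mh).
  by apply: cmeasurable_cis; exact: (measurableT_comp (measurable_phase mphi (q1, q2)) ms).
- apply: cmeasurableM; first exact: (cmeasurable_comp (measurable_pairr q1) mG).
  by apply: cmeasurable_cis; exact: measurable_phase.
(* The phase in the second variable is constant for the inner integral and leaves it wherever that
   slice is integrable; the exceptional [x2] form a null set for the outer integral. *)
- apply: filterS ih_section => x2 ihx2.
  rewrite /G /phase_transform /= [RHS]mulrC -cintegralZl; last exact: cintegrable_phase.
  congr cintegral; apply/funext => x1.
  by rewrite /phi /= mulrDr opprD cisD mulrA [RHS]mulrC.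
Qed.

Let N2G : N2 m G = N2 m h.
Proof.
rewrite (N2_tonelliG m1 m2 mG) (N2_tonelliG m1 m2 mh); apply: ae_eq_ge0_integral.
- exact: measurable_N2G.
- exact: measurable_N2G.
- by move=> ?; exact: N2_ge0.
- by move=> ?; exact: N2_ge0.
- apply: filterS2 ih_section (ae_L2G Lh.1 Lh) => x2 i2 L2x.
  by have [_ /(_ _ i2 L2x)] := P1.
Qed.

Lemma plancherel_product_N2 : N2 m (phase_transform m phi h) = N2 m h.
Proof.
have LG : L2 m G by apply/L2P; split=> //; rewrite N2G; have [] := (L2P m h).1 Lh.
have mF : cmeasurable (phase_transform m phi h).
  rewrite (_ : phase_transform m phi h = (fun z : T1 * T2 =>
      phase_transform m2 phi2 (fun x2 => G (z.1, x2)) z.2)); last first.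
    by apply/funext => -[q1 q2]; exact: phase_transformE.
  apply: (@cmeasurable_cintegral_param _ _ _ _ _ m2
    (fun w : (T1 * T2) * T2 => G (w.1.1, w.2) * cis (- (2 * pi * phi2 w.1.2 w.2)))).
  apply: cmeasurableM.
  - apply: (cmeasurable_comp _ mG); apply: measurable_fun_pair => //.
    by apply: measurableT_comp.
  - apply: cmeasurable_cis; apply: measurable_funN; apply: measurable_funM => //.
    by apply: (measurable_uncurry_comp mphi2) => //; apply: measurableT_comp.
rewrite -N2G (N2_tonelliF m1 m2 mF) (N2_tonelliF m1 m2 mG).
have E q1 : N2 m2 (fun q2 => phase_transform m phi h (q1, q2)) =
    N2 m2 (phase_transform m2 phi2 (fun x2 => G (q1, x2))).
  by congr N2; apply/funext => q2; exact: phase_transformE.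
under eq_integral do rewrite E.
have mGs q1 : cmeasurable (fun x2 => G (q1, x2)) by exact: cmeasurable_sectionF.
apply: ae_eq_ge0_integral.
- by under eq_fun do rewrite -E; exact: measurable_N2F.
- exact: measurable_N2F.
- by move=> ?; exact: N2_ge0.
- by move=> ?; exact: N2_ge0.
- apply: filterS (ae_L2F mG LG) => q1 Lq1.
  have [_ /(_ _ _ Lq1)] := P2; apply.
  exact: (cintegrable_cintegralG (kernel1 q1)).
Qed.

End transform.

Lemma plancherel_product : plancherel (m1 \x m2)%E
  (fun q x => phi1 q.1 x.1 + phi2 q.2 x.2).
Proof. by split; [exact: mphi|exact: plancherel_product_N2]. Qed.

End plancherel_product.

(** * Transport along measure-preserving maps *)

Section preserves.
Context d d' (T : measurableType d) (T' : measurableType d') {R : realType}.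
Implicit Types (mu : {measure set T -> \bar R}) (nu : {measure set T' -> \bar R}).
Local Notation Re := (@complex.Re R).
Local Notation Im := (@complex.Im R).

(** Encoded by the change of variables for nonnegative functions rather than by measures of
    preimages: in this form it composes at once and combines with Tonelli in [preserves_skew]. *)
Definition preserves mu nu (f : T -> T') :=
  measurable_fun setT f /\
  forall g : T' -> \bar R, measurable_fun setT g -> (forall x, 0 <= g x)%E ->
    (\int[nu]_x g x = \int[mu]_x g (f x))%E.

Lemma preserves_pushforward mu nu f : measurable_fun setT f ->
  (forall A, measurable A -> nu A = mu (f @^-1` A)) -> preserves mu nu f.
Proof.
move=> mf nuE; split=> // g mg g0.
rewrite (eq_measure_integral (pushforward mu f)); last by move=> A mA _; exact: nuE.
by rewrite ge0_integral_pushforward// preimage_setT.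
Qed.

Section transfer.
Variables (mu : {measure set T -> \bar R}) (nu : {measure set T' -> \bar R}) (f : T -> T').
Hypothesis pf : preserves mu nu f.
Let mf := pf.1.

Lemma preserves_integral (g : T' -> \bar R) : measurable_fun setT g ->
  (\int[nu]_x g x = \int[mu]_x g (f x))%E.
Proof.
move=> mg; rewrite [LHS]integralE [RHS]integralE.
rewrite (pf.2 _ (measurable_funepos mg))// (pf.2 _ (measurable_funeneg mg))//.
by congr (_ - _)%E; apply: eq_integral => x _; rewrite ?funeposE ?funenegE.
Qed.

Lemma preserves_integrable (g : T' -> \bar R) : measurable_fun setT g ->
  nu.-integrable setT g <-> mu.-integrable setT (g \o f).
Proof.
move=> mg; have mgf : measurable_fun setT (g \o f) by exact: measurableT_comp.
have E := pf.2 _ (measurableT_comp (@abse_measurable R setT) mg) (fun x => abse_ge0 _).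
split=> /integrableP[_ h]; apply/integrableP; split=> //.
- by move: h; rewrite E.
- by rewrite E.
Qed.

Lemma preserves_cintegral (g : T' -> R[i]) : cmeasurable g ->
  cintegral nu g = cintegral mu (g \o f).
Proof.
move=> [g1 g2]; apply: complexP; rewrite /= /Rintegral.
- by congr fine; apply: (preserves_integral (g := EFin \o (Re \o g))); exact/measurable_EFinP.
- by congr fine; apply: (preserves_integral (g := EFin \o (Im \o g))); exact/measurable_EFinP.
Qed.

Lemma preserves_cintegrable (g : T' -> R[i]) : cmeasurable g ->
  cintegrable nu g <-> cintegrable mu (g \o f).
Proof.
move=> [/measurable_EFinP g1 /measurable_EFinP g2].
split=> -[h1 h2]; split.
- exact/(preserves_integrable g1).
- exact/(preserves_integrable g2).
- exact/(preserves_integrable g1).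
- exact/(preserves_integrable g2).
Qed.

Lemma preserves_N2 (g : T' -> R[i]) : cmeasurable g -> N2 nu g = N2 mu (g \o f).
Proof. by move=> mg; exact: (preserves_integral (measurable_Ensq mg)). Qed.

Lemma preserves_L2 (g : T' -> R[i]) : L2 nu g -> L2 mu (g \o f).
Proof.
move=> /L2P[mg Ng]; apply/L2P; split; first exact: cmeasurable_comp.
by rewrite -preserves_N2.
Qed.

End transfer.

Lemma plancherel_preserves (mu : {measure set T -> \bar R})
    (nu : {sigma_finite_measure set T' -> \bar R}) f phi :
  preserves mu nu f ->
  measurable_fun setT (fun qx : T' * T' => phi qx.1 qx.2) ->
  plancherel mu (fun q x => phi (f q) (f x)) -> plancherel nu phi.
Proof.
move=> pf mphi [_ P]; split=> // h ih Lh; have mh := Lh.1; have mf := pf.1.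
have mF := cmeasurable_phase_transform nu mphi mh.
rewrite (preserves_N2 pf mF) (preserves_N2 pf mh) -[RHS]P.
- congr N2; apply/funext => q; rewrite /phase_transform /=.
  rewrite (preserves_cintegral pf)//.
  by apply: cmeasurableM => //; apply: cmeasurable_cis; exact: measurable_phase.
- exact: ((preserves_cintegrable pf mh).1 ih).
- exact: (preserves_L2 pf Lh).
Qed.

End preserves.

Lemma preserves_comp d1 d2 d3 (T1 : measurableType d1) (T2 : measurableType d2)
    (T3 : measurableType d3) (R : realType) (m1 : {measure set T1 -> \bar R})
    (m2 : {measure set T2 -> \bar R}) (m3 : {measure set T3 -> \bar R}) f g :
  preserves m1 m2 f -> preserves m2 m3 g -> preserves m1 m3 (g \o f).
Proof.
move=> [mf pf] [mg pg]; split; first exact: measurableT_comp.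
move=> k mk k0; rewrite pg// pf//.
exact: measurableT_comp.
Qed.

(** By Tonelli, the inner integral at fixed [x] absorbs [g x], and the outer one absorbs [f]. The
    dependence of [g] on [x] is there for the Heisenberg product, which moves the central coordinate
    by an amount depending on the others. *)
Lemma preserves_skew d1 d1' d2 d2' (T1 : measurableType d1) (T1' : measurableType d1')
    (T2 : measurableType d2) (T2' : measurableType d2') (R : realType)
    (m1 : {sigma_finite_measure set T1 -> \bar R})
    (n1 : {sigma_finite_measure set T1' -> \bar R})
    (m2 : {sigma_finite_measure set T2 -> \bar R})
    (n2 : {sigma_finite_measure set T2' -> \bar R})
    (f : T1 -> T1') (g : T1 -> T2 -> T2') :
  preserves m1 n1 f -> measurable_fun setT (fun z => g z.1 z.2) ->
  (forall x, preserves m2 n2 (g x)) ->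
  preserves (m1 \x m2)%E (n1 \x n2)%E (fun z => (f z.1, g z.1 z.2)).
Proof.
move=> [mf pf] mg pg.
have mfg : measurable_fun setT (fun z : T1 * T2 => (f z.1, g z.1 z.2)).
  by apply: measurable_fun_pair => //; exact: measurableT_comp.
split=> // k mk k0; rewrite fubini_tonelli1// pf; last 2 first.
- exact: measurable_fun_fubini_tonelli_F.
- by move=> x; exact: integral_ge0.
rewrite fubini_tonelli1//; last exact: measurableT_comp.
apply: eq_integral => x _; rewrite /fubini_F (pg x).2//.
exact: (measurableT_comp mk (measurable_pairr (f x))).
Qed.

(** * Translations of the line and of tuples *)

Section lebesgue_shift.
Context {R : realType}.
Local Notation mu := (@lebesgue_measure R).
Local Notation RR := (measurableTypeR R).

Lemma measurable_shift (a : R) : measurable_fun [set: RR] (fun x : RR => (x : R) + a : RR).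
Proof. by apply: measurable_funD. Qed.

Lemma preserves_shift (a : R) : preserves mu mu (fun x : RR => (x : R) + a : RR).
Proof.
apply: preserves_pushforward; first exact: measurable_shift.
move=> A mA; rewrite -[RHS]/(pushforward mu (fun x : RR => (x : R) + a : RR) A).
(* Uniqueness of Lebesgue measure leaves only half-open intervals to check, and their preimages are
   again such intervals. *)
apply: lebesgue_measure_unique => //=; first exact: measurable_shift.
move=> _ _ [[b c]] _ <-; rewrite /pushforward.
rewrite (_ : _ @^-1` _ = `](b - a), (c - a)]%classic).
  rewrite !lebesgue_measure_itv /= !lte_fin ltrD2r; case: ifP => // _.
  by rewrite -!EFinD; congr EFin; ring.
by apply/seteqP; split=> x /=; rewrite !in_itv/= ltrBlDr -lerBrDr.
Qed.

Lemma preserves_opp : preserves mu mu (fun x : RR => - (x : R) : RR).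
Proof.
apply: preserves_pushforward; first exact: oppr_measurable.
by move=> A mA; rewrite -[LHS](lebesgue_measureN mA).
Qed.

End lebesgue_shift.

Section tuples.
Context {R : realType}.
Local Notation RR := (measurableTypeR R).
Local Notation mu := (@lebesgue_measure R).

Lemma preserves_tcons n : preserves (mu \x lebesgue_tuple n)%E (lebesgue_tuple n.+1)
  (@tcons R n).
Proof. by apply: preserves_pushforward => //; exact: measurable_tcons. Qed.

Lemma dot_tcons n (a b : RR) (x y : n.-tuple RR) :
  dot (tcons (a, x)) (tcons (b, y)) = (a : R) * (b : R) + dot x y.
Proof.
rewrite /dot big_ord_recl; congr (_ + _).
by apply: eq_bigr => i _; rewrite !tnthS.
Qed.

Lemma addt_tcons n (a b : RR) (x y : n.-tuple RR) :
  addt (tcons (a, x)) (tcons (b, y)) = tcons ((a : R) + (b : R) : RR, addt x y).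
Proof.
apply/eq_from_tnth => i; rewrite tnth_mktuple.
case: (unliftP ord0 i) => [j|] ->; last by [].
by rewrite !tnthS tnth_mktuple.
Qed.

Lemma measurable_dot n d (T : measurableType d) (f g : T -> n.-tuple RR) :
  measurable_fun setT f -> measurable_fun setT g ->
  measurable_fun setT (fun x => dot (f x) (g x)).
Proof.
move=> mf mg; apply: measurable_sum => i.
by apply: measurable_funM; apply: (measurableT_comp (measurable_tnth i)).
Qed.

Lemma measurable_addt n d (T : measurableType d) (f g : T -> n.-tuple RR) :
  measurable_fun setT f -> measurable_fun setT g ->
  measurable_fun setT (fun x => addt (f x) (g x)).
Proof.
move=> mf mg; apply/measurable_fun_tnthP => i.
rewrite (_ : _ \o _ = fun x => (tnth (f x) i : R) + (tnth (g x) i : R)).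
  by apply: measurable_funD; apply: (measurableT_comp (measurable_tnth i)).
by apply/funext => x /=; rewrite tnth_mktuple.
Qed.

Lemma addtC n (x y : n.-tuple RR) : addt x y = addt y x.
Proof. by apply/eq_from_tnth => i; rewrite !tnth_mktuple addrC. Qed.

Lemma preserves_addt n (a : n.-tuple RR) :
  preserves (lebesgue_tuple n) (lebesgue_tuple n) (addt ^~ a).
Proof.
have ma k (b : k.-tuple RR) : measurable_fun setT (addt ^~ b).
  by apply: measurable_addt => //; exact: measurable_cst.
elim: n a => [a|n IH a].
  split=> [|g mg g0]; first exact: ma.
  apply: eq_integral => x _.
  by rewrite [addt x a]tuple0 [x]tuple0.
split=> [|g mg g0]; first exact: ma.
have [b [c ->]] : exists b c, a = tcons (b, c).
  exists (thead a), [tuple of behead a]; rewrite [LHS](tuple_eta a).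
  by apply/val_inj.
rewrite (preserves_tcons n).2// (preserves_tcons n).2//; last first.
  exact: (measurableT_comp mg (ma _ _)).
have P : preserves (mu \x lebesgue_tuple n)%E (mu \x lebesgue_tuple n)%E
    (fun z : RR * n.-tuple RR => ((z.1 : R) + (b : R) : RR, addt z.2 c)).
  apply: (@preserves_skew _ _ _ _ _ _ _ _ _ _ _ _ _ (fun x : RR => (x : R) + (b : R) : RR)
    (fun _ x => addt x c)).
  - exact: preserves_shift.
  - exact: (measurableT_comp (ma _ c) measurable_snd).
  - by move=> _; exact: IH.
rewrite P.2//; last exact: (measurableT_comp mg (@measurable_tcons R n)).
by apply: eq_integral => -[x y] _; rewrite addt_tcons.
Qed.

Hypothesis plancherel1 : plancherel mu (fun q x : RR => (q : R) * (x : R)).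

Lemma plancherel_tuple n : plancherel (lebesgue_tuple n) (@dot R n).
Proof.
elim: n => [|n IH].
  (* In dimension zero the measure is a Dirac mass at the only point and the phase vanishes, so the
     transform is the identity. *)
  have d0 (q x : 0.-tuple RR) : dot q x = 0 by rewrite /dot big_ord0.
  split.
    rewrite (_ : (fun _ => _) = cst 0); first exact: measurable_cst.
    by apply/funext => x; rewrite d0.
  move=> h ih Lh; congr N2; apply/funext => q.
  rewrite /phase_transform.
  have -> : (fun x => h x * cis (- (2 * pi * dot q x))) = h.
    apply/funext => x; rewrite d0 mulr0 oppr0; apply: complexP;
    by rewrite !ReImE /= cos0 sin0 !mulr1 mulr0 ?subr0 ?add0r ?addr0.
  apply: complexP; rewrite /= /Rintegral integral_dirac//.
  - by rewrite diracT mul1e /=; congr (complex.Re (h _)); rewrite [q]tuple0.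
  - by have [/measurable_EFinP] := Lh.1.
  - by rewrite diracT mul1e /=; congr (complex.Im (h _)); rewrite [q]tuple0.
  - by have [_ /measurable_EFinP] := Lh.1.
apply: (plancherel_preserves (preserves_tcons n)).
  by apply: measurable_dot.
have := plancherel_product plancherel1 IH.
by congr plancherel; apply/funext => -[a x]; apply/funext => -[b y]; rewrite dot_tcons.
Qed.

End tuples.

(** * Invariance of the measure on the Heisenberg group *)

Section heisenberg_measure.
Context {R : realType} {n : nat}.
Local Notation RR := (measurableTypeR R).
Local Notation leb := (@lebesgue_measure R).
Local Notation tup := (n.-tuple RR).
Local Notation H := (heis R n).
Local Notation mu := (@lebesgue_heis R n).

(** A name to which a sigma-finite structure can be attached, so that the product can serve as a
    factor of the next product. *)
Definition lebesgue_tuple2 : set (tup * tup) -> \bar R :=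
  (lebesgue_tuple n \x lebesgue_tuple n)%E.
HB.instance Definition _ := Measure.on lebesgue_tuple2.

Let lebesgue_tuple2_sigma_finite : sigma_finite setT lebesgue_tuple2.
Proof. by apply: sigma_finite_product; exact: sigma_finiteT. Qed.

HB.instance Definition _ := Measure_isSigmaFinite.Build _ _ _ lebesgue_tuple2
  lebesgue_tuple2_sigma_finite.

(** The identity maps here and below carry statements between the named measures and the products
    that they abbreviate. *)
Lemma preserves_tuple2 : preserves (lebesgue_tuple n \x lebesgue_tuple n)%E
  lebesgue_tuple2 (@idfun (tup * tup)).
Proof. by apply: preserves_pushforward => [|A mA //]; exact: measurable_id. Qed.

Lemma preserves_tuple2_inv : preserves lebesgue_tuple2
  (lebesgue_tuple n \x lebesgue_tuple n)%E (@idfun (tup * tup)).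
Proof. by apply: preserves_pushforward => [|A mA //]; exact: measurable_id. Qed.

Lemma preserves_heis : preserves (lebesgue_tuple2 \x leb)%E mu
  (@idfun (tup * tup * RR)).
Proof. by apply: preserves_pushforward => [|A mA //]; exact: measurable_id. Qed.

Lemma preserves_heis_inv : preserves mu (lebesgue_tuple2 \x leb)%E
  (@idfun (tup * tup * RR)).
Proof. by apply: preserves_pushforward => [|A mA //]; exact: measurable_id. Qed.

Lemma measurable_hdot_comp d (T : measurableType d) (f g : T -> H) :
  measurable_fun setT f -> measurable_fun setT g ->
  measurable_fun setT (fun x => hdot (f x) (g x)).
Proof.
move=> mf mg.
rewrite (_ : (fun _ => _) = fun x => dot (f x).1.1 (g x).1.1 +
   dot (f x).1.2 (g x).1.2 + ((f x).2 : R) * ((g x).2 : R)); last first.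
  by apply/funext => x; case: (f x) (g x) => [[? ?] ?] [[? ?] ?].
have m11 (h : T -> H) : measurable_fun setT h ->
    measurable_fun setT (fun x => (h x).1.1).
  by move=> mh; do 2! apply: measurableT_comp => //.
have m12 (h : T -> H) : measurable_fun setT h ->
    measurable_fun setT (fun x => (h x).1.2).
  by move=> mh; do 2! apply: measurableT_comp => //.
apply: measurable_funD; first apply: measurable_funD.
- by apply: measurable_dot; exact: m11.
- by apply: measurable_dot; exact: m12.
- by apply: measurable_funM; exact: measurableT_comp.
Qed.

Lemma measurable_hmul_comp d (T : measurableType d) (f g : T -> H) :
  measurable_fun setT f -> measurable_fun setT g ->
  measurable_fun setT (fun x => hmul (f x) (g x)).
Proof.
move=> mf mg.
rewrite (_ : (fun _ => _) = fun x => (addt (f x).1.1 (g x).1.1,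
   addt (f x).1.2 (g x).1.2, ((f x).2 : R) + ((g x).2 : R) +
   2^-1 * (dot (f x).1.1 (g x).1.2 - dot (f x).1.2 (g x).1.1) : RR)); last first.
  by apply/funext => x; case: (f x) (g x) => [[? ?] ?] [[? ?] ?].
have m11 (h : T -> H) : measurable_fun setT h ->
    measurable_fun setT (fun x => (h x).1.1).
  by move=> mh; do 2! apply: measurableT_comp => //.
have m12 (h : T -> H) : measurable_fun setT h ->
    measurable_fun setT (fun x => (h x).1.2).
  by move=> mh; do 2! apply: measurableT_comp => //.
apply: measurable_fun_pair; first apply: measurable_fun_pair.
- by apply: measurable_addt; exact: m11.
- by apply: measurable_addt; exact: m12.
- apply: measurable_funD; first by apply: measurable_funD; exact: measurableT_comp.
  apply: measurable_funM => //; apply: measurable_funB.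
  + by apply: measurable_dot; [exact: m11|exact: m12].
  + by apply: measurable_dot; [exact: m12|exact: m11].
Qed.

Lemma preserves_addt2 (a b : tup) : preserves lebesgue_tuple2 lebesgue_tuple2
  (fun z => (addt z.1 a, addt z.2 b)).
Proof.
suff P : preserves (lebesgue_tuple n \x lebesgue_tuple n)%E
    (lebesgue_tuple n \x lebesgue_tuple n)%E
    (fun z : tup * tup => (addt z.1 a, addt z.2 b)).
  exact: (preserves_comp (preserves_comp preserves_tuple2_inv P) preserves_tuple2).
apply: (@preserves_skew _ _ _ _ _ _ _ _ _ _ _ _ _ (addt ^~ a) (fun _ x => addt x b)).
- exact: preserves_addt.
- by apply: measurable_addt.
- by move=> _; exact: preserves_addt.
Qed.

(** The common shape of left and right multiplication: a translation of the first two coordinates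
    and a shear of the central one. *)
Lemma preserves_heis_skew (a b : tup) (c : tup * tup -> R) :
  measurable_fun setT c ->
  preserves mu mu (fun X : H => (addt X.1.1 a, addt X.1.2 b, (X.2 : R) + c X.1 : RR)).
Proof.
move=> mc.
suff P : preserves (lebesgue_tuple2 \x leb)%E (lebesgue_tuple2 \x leb)%E
    (fun X : tup * tup * RR => (addt X.1.1 a, addt X.1.2 b, (X.2 : R) + c X.1 : RR)).
  exact: (preserves_comp (preserves_comp preserves_heis_inv P) preserves_heis).
apply: (@preserves_skew _ _ _ _ _ _ _ _ _ _ _ _ _
  (fun z : tup * tup => (addt z.1 a, addt z.2 b)) (fun z (t : RR) => (t : R) + c z : RR)).
- exact: preserves_addt2.
- by apply: measurable_funD => //; exact: measurableT_comp.
- by move=> z; exact: preserves_shift.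
Qed.

Lemma preserves_hmul_right (P : H) : preserves mu mu (fun X => hmul X P).
Proof.
case: P => [[a b] s].
have := @preserves_heis_skew a b (fun z => s + 2^-1 * (dot z.1 b - dot z.2 a)).
rewrite (_ : (fun X : H => _) = (fun X => hmul X (a, b, s))).
  apply; apply: measurable_funD => //; apply: measurable_funM => //.
  by apply: measurable_funB; apply: measurable_dot.
by apply/funext => -[[p q] t] /=; rewrite addrA.
Qed.

(** Both invariances serve. Right multiplication keeps a translated window square-integrable; left
    multiplication is what appears when [X] is fixed and the integration runs over the translation
    [P]. *)
Lemma preserves_hmul_left (X : H) : preserves mu mu (hmul X).
Proof.
case: X => [[a b] s].
have := @preserves_heis_skew a b (fun z => s + 2^-1 * (dot a z.2 - dot b z.1)).
rewrite (_ : (fun X : H => _) = hmul (a, b, s)).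
  apply; apply: measurable_funD => //; apply: measurable_funM => //.
  by apply: measurable_funB; apply: measurable_dot.
by apply/funext => -[[p q] t] /=; rewrite addrA (addtC a) (addtC b) (addrC t).
Qed.

Lemma plancherel_heis : plancherel leb (fun q x : RR => (q : R) * (x : R)) ->
  plancherel mu (@hdot R n).
Proof.
move=> P.
have P2 : plancherel lebesgue_tuple2 (fun q x : tup * tup => dot q.1 x.1 + dot q.2 x.2).
  apply: (plancherel_preserves preserves_tuple2).
    by apply: measurable_funD; apply: measurable_dot; exact: measurableT_comp.
  exact: (plancherel_product (plancherel_tuple P n) (plancherel_tuple P n)).
apply: (plancherel_preserves preserves_heis).
  by apply: measurable_hdot_comp.
have := plancherel_product P2 P.
by congr plancherel; apply/funext => -[[? ?] ?]; apply/funext => -[[? ?] ?].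
Qed.

End heisenberg_measure.

(** * Plancherel's formula on the line *)

Section half_line.
Context {R : realType}.
Local Notation mu := (@lebesgue_measure R).

(** Evenness reduces the integral to the positive half-line, where the fundamental theorem applies.
    Since [dF] has to agree with [f] only there, an antiderivative can be written without the
    absolute value of the variable. *)
Lemma integral_even_FTC (f F dF : R -> R) (l : R) :
  (forall x, 0 <= f x) -> continuous f -> (forall x, f (- x) = f x) ->
  (forall x, is_derive x (1 : R) F (dF x)) -> {in `]0, +oo[, dF =1 f} ->
  F x @[x --> +oo] --> l ->
  (\int[mu]_x (f x)%:E = (2 * (l - F 0))%:E)%E.
Proof.
move=> f0 cf fN dF1 dFf Fl.
rewrite ge0_symfun_integralT//; last by move=> x /=; rewrite fN.
rewrite -[X in (\int[_]_(_ in X) _)%E]set_itvcy.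
rewrite (@ge0_continuous_FTC2y _ f F 0 l) -?EFinB -?EFinM//.
- exact: continuous_subspaceT.
- apply: cvg_at_right_filter; apply: differentiable_continuous.
  by apply/derivable1_diffP; case: (dF1 0).
- by move=> x x0; rewrite derive1E; case: (dF1 x) => _ ->; exact: dFf.
Qed.

End half_line.

(** * The Abel weight and the Poisson kernel *)

Section poisson_kernel.
Context {R : realType}.
Local Notation mu := (@lebesgue_measure R).

(** The Cauchy density of scale [a / (2 * pi)]. The factors [2 * pi] come from the normalization of
    the phase. *)
Definition poisson (a u : R) : R := 2 * a / (a ^+ 2 + (2 * pi * u) ^+ 2).

Lemma poisson_denom_gt0 (a u : R) : 0 < a -> 0 < a ^+ 2 + (2 * pi * u) ^+ 2.
Proof. by move=> a0; rewrite ltr_pwDl ?exprn_gt0// sqr_ge0. Qed.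

Lemma poisson_ge0 (a u : R) : 0 < a -> 0 <= poisson a u.
Proof.
by move=> a0; rewrite divr_ge0 ?mulr_ge0 ?ltW// poisson_denom_gt0.
Qed.

Lemma poissonN (a u : R) : poisson a (- u) = poisson a u.
Proof. by rewrite /poisson mulrN sqrrN. Qed.

Lemma continuous_poisson (a : R) : 0 < a -> continuous (poisson a).
Proof.
move=> a0 u; apply: cvgM; first exact: cvg_cst.
apply: cvgV; first by rewrite gt_eqF// poisson_denom_gt0.
apply: cvgD; first exact: cvg_cst.
apply: (@cvg_comp _ _ _ (fun u => 2 * pi * u) (fun x => x ^+ 2)).
  by apply: cvgM; [exact: cvg_cst|exact: cvg_id].
exact: exprn_continuous.
Qed.

Lemma measurable_poisson (a : R) : 0 < a -> measurable_fun [set: measurableTypeR R] (poisson a).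
Proof. by move=> a0; apply: continuous_measurable_fun; exact: continuous_poisson. Qed.

Lemma integral_poisson (a : R) : 0 < a -> (\int[mu]_u (poisson a u)%:E = 1)%E.
Proof.
move=> a0; have pi0 := pi_gt0 R.
pose F u : R := pi^-1 * atan (2 * pi / a * u).
have -> : (1 = (2 * (2^-1 - F 0))%:E)%E.
  by rewrite /F mulr0 atan0 mulr0 subr0 divff.
apply: (@integral_even_FTC _ _ F (poisson a)).
- by move=> x; exact: poisson_ge0.
- exact: continuous_poisson.
- exact: poissonN.
- move=> x; apply: trigger_derive.
  rewrite /poisson /GRing.scale/= !(mulr1, mulr0, addr0, add0r).
  have := poisson_denom_gt0 x a0; move: (pi : R) pi0 => p p0 den.
  by field; rewrite !gt_eqF//; nra.
- by [].
- rewrite (_ : 2^-1 = pi^-1 * (pi / 2)); last by rewrite mulrA mulVf ?mul1r// gt_eqF.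
  apply: cvgM; first exact: cvg_cst.
  apply: (@cvg_comp _ _ _ (fun u => 2 * pi / a * u) atan); last exact: cvgy_atan.
  by apply: gt0_cvgMry; [rewrite divr_gt0// mulr_gt0|exact: cvg_id].
Qed.

(** The weight of Abel summation: at most 1, and increasing to 1 as [a] decreases to 0, which suits
    monotone convergence. *)
Definition abel (a q : R) : R := expR (- (a * `|q|)).

Lemma abel_ge0 (a q : R) : 0 <= abel a q. Proof. exact: expR_ge0. Qed.

Lemma continuous_abel (a : R) : continuous (abel a).
Proof.
move=> q; apply: (@continuous_comp _ _ _ (fun q => - (a * `|q|)) expR).
  by apply: cvgN; apply: cvgM; [exact: cvg_cst|exact: norm_continuous].
exact: continuous_expR.
Qed.

Lemma measurable_abel (a : R) : measurable_fun [set: measurableTypeR R] (abel a).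
Proof. by apply: continuous_measurable_fun; exact: continuous_abel. Qed.

(** Adding 1 to the cosine makes the integrand nonnegative, as the fundamental theorem on a
    half-line is used for such functions. The extra [abel a q] is subtracted once its integral is
    known, from the case [c = 0]. *)
Let abel1cos (a c q : R) : R := abel a q * (1 + cos (c * q)).

Let abel1cos_ge0 (a c q : R) : 0 <= abel1cos a c q.
Proof. by rewrite mulr_ge0 ?abel_ge0//; have := cos_geN1 (c * q); lra. Qed.

Let continuous_abel1cos (a c : R) : continuous (abel1cos a c).
Proof.
move=> q; apply: cvgM; first exact: continuous_abel.
apply: cvgD; first exact: cvg_cst.
apply: (@continuous_comp _ _ _ (fun q => c * q) cos); last exact: continuous_cos.
by apply: cvgM; [exact: cvg_cst|exact: cvg_id].
Qed.

Let integral_abel1cos (a c : R) : 0 < a ->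
  (\int[mu]_q (abel1cos a c q)%:E = (2 / a + 2 * a / (a ^+ 2 + c ^+ 2))%:E)%E.
Proof.
move=> a0; have den : 0 < a ^+ 2 + c ^+ 2 by rewrite ltr_pwDl ?exprn_gt0// sqr_ge0.
(* The real part of the antiderivative of [exp ((- a + i c) q)], plus the antiderivative of
   [exp (- a q)]. Both vanish at infinity. *)
pose F q : R := expR (- a * q) *
  ((c * sin (c * q) - a * cos (c * q)) / (a ^+ 2 + c ^+ 2) - a^-1).
have -> : 2 / a + 2 * a / (a ^+ 2 + c ^+ 2) = 2 * (0 - F 0).
  rewrite /F !mulr0 sin0 cos0 expR0; field.
  by rewrite !gt_eqF.
apply: (@integral_even_FTC _ _ F (fun q => expR (- a * q) * (1 + cos (c * q)))) => //.
- by move=> q; rewrite /abel1cos /abel normrN mulrN cosN.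
- move=> q; apply: trigger_derive.
  rewrite /GRing.scale/= !(mulr1, mulr0, addr0, add0r, subr0).
  move: (expR _) (sin _) (cos _) => e s k.
  by field; rewrite !gt_eqF.
- move=> q; rewrite in_itv/= andbT => q0.
  by rewrite /abel1cos /abel ger0_norm ?ltW// mulNr.
- have bnd (q : R) : `|F q| <= expR (- (a * q)) * ((`|c| + a) / (a ^+ 2 + c ^+ 2) + a^-1).
    rewrite /F normrM mulNr ger0_norm ?expR_ge0// ler_wpM2l ?expR_ge0//.
    have [ai0 di0] : 0 <= a^-1 /\ 0 <= (a ^+ 2 + c ^+ 2)^-1 by rewrite !invr_ge0 !ltW.
    rewrite (le_trans (ler_normB _ _))// (ger0_norm ai0) lerD2r normrM (ger0_norm di0).
    rewrite ler_wpM2r// (le_trans (ler_normB _ _))// !normrM lerD//.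
      by rewrite ler_piMr// ler_norml sin_geN1 sin_le1.
    by rewrite (gtr0_norm a0) ler_piMr ?(ltW a0)// ler_norml cos_geN1 cos_le1.
  apply/norm_cvg0P.
  apply: (@squeeze_cvgr _ _ _ _ (fun=> 0)
    (fun q => expR (- (a * q)) * ((`|c| + a) / (a ^+ 2 + c ^+ 2) + a^-1))).
  + by apply: nearW => q; rewrite normr_ge0 bnd.
  + exact: cvg_cst.
  + rewrite -[X in _ --> X](mul0r ((`|c| + a) / (a ^+ 2 + c ^+ 2) + a^-1)).
    apply: cvgMl.
    apply: (@cvg_comp _ _ _ (fun u => a * u) (fun x => expR (- x))); last exact: cvgr_expR.
    by apply: gt0_cvgMry => //; exact: cvg_id.
Qed.

Lemma integral_abel (a : R) : 0 < a -> (\int[mu]_q (abel a q)%:E = (2 / a)%:E)%E.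
Proof.
move=> a0; have := integral_abel1cos 0 a0.
have -> : (2 / a + 2 * a / (a ^+ 2 + 0 ^+ 2))%:E = (2%:E * (2 / a)%:E)%E.
  by rewrite -EFinM; congr EFin; field; rewrite gt_eqF.
under eq_integral do rewrite /abel1cos mul0r cos0 mulrC EFinM.
rewrite ge0_integralZl_EFin//; last 2 first.
- by move=> q _; rewrite lee_fin abel_ge0.
- by apply/measurable_EFinP; exact: measurable_abel.
move=> /(congr1 (fun x => (2^-1)%:E * x)%E).
have h2 : 2^-1 * (1 + 1) = 1 :> R by rewrite mulVf.
rewrite !muleA -!EFinM h2 mul1e => ->; congr EFin.
by rewrite mul1r.
Qed.

Lemma integrable_abel (a : R) : 0 < a -> mu.-integrable setT (EFin \o abel a).
Proof.
move=> a0; apply/integrableP; split.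
  by apply/measurable_EFinP; exact: measurable_abel.
under eq_integral do rewrite gee0_abs ?lee_fin ?abel_ge0//.
by rewrite integral_abel// ltry.
Qed.

Lemma integrable_poisson (a : R) : 0 < a -> mu.-integrable setT (EFin \o poisson a).
Proof.
move=> a0; apply/integrableP; split.
  by apply/measurable_EFinP; exact: measurable_poisson.
under eq_integral do rewrite gee0_abs ?lee_fin ?poisson_ge0//.
by rewrite integral_poisson// ltry.
Qed.

Lemma Rintegral_abel_cos (a u : R) : 0 < a ->
  \int[mu]_q (abel a q * cos (2 * pi * u * q)) = poisson a u.
Proof.
move=> a0; set c := 2 * pi * u.
have mac : measurable_fun [set: measurableTypeR R] (abel1cos a c).
  by apply: continuous_measurable_fun; exact: continuous_abel1cos.
have iac : mu.-integrable setT (EFin \o abel1cos a c).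
  apply/integrableP; split; first exact/measurable_EFinP.
  under eq_integral do rewrite gee0_abs ?lee_fin ?abel1cos_ge0//.
  by rewrite integral_abel1cos// ltry.
transitivity (\int[mu]_q (abel1cos a c q - abel a q)).
  by apply: eq_Rintegral => q _; rewrite /abel1cos; ring.
rewrite RintegralB//; last exact: integrable_abel.
rewrite /Rintegral integral_abel1cos// integral_abel//= /poisson -/c.
by rewrite addrC addKr.
Qed.

End poisson_kernel.

Section tensor.
Context d1 d2 (T1 : measurableType d1) (T2 : measurableType d2) {R : realType}.
Variable m1 : {sigma_finite_measure set T1 -> \bar R}.
Variable m2 : {sigma_finite_measure set T2 -> \bar R}.

(* An alias of the product measure carrying the sigma-finite structure that cannot
   be inferred for [m1 \x m2] itself. *)
Definition sigma_finite_prod : set (T1 * T2) -> \bar R := (m1 \x m2)%E.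
HB.instance Definition _ := Measure.on sigma_finite_prod.

Let sigma_finite_prod_sigma_finite : sigma_finite setT sigma_finite_prod.
Proof. by apply: sigma_finite_product; exact: sigma_finiteT. Qed.

HB.instance Definition _ := Measure_isSigmaFinite.Build _ _ _ sigma_finite_prod
  sigma_finite_prod_sigma_finite.

Variables (f : T1 -> R) (g : T2 -> R).
Hypothesis intf : m1.-integrable setT (EFin \o f).
Hypothesis intg : m2.-integrable setT (EFin \o g).

Let mf : measurable_fun setT f.
Proof. by apply/measurable_EFinP; exact: measurable_int intf. Qed.

Let mg : measurable_fun setT g.
Proof. by apply/measurable_EFinP; exact: measurable_int intg. Qed.

Lemma measurable_tensor : measurable_fun setT (fun z : T1 * T2 => f z.1 * g z.2).
Proof. by apply: measurable_funM; exact: measurableT_comp. Qed.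

Lemma integrable_tensor :
  (m1 \x m2)%E.-integrable setT (EFin \o (fun z => f z.1 * g z.2)).
Proof.
have [_ fy] := integrableP _ _ _ intf.
have [_ gy] := integrableP _ _ _ intg.
have maf : measurable_fun setT (fun x => `|(f x)%:E|)%E.
  by apply: measurableT_comp => //; exact/measurable_EFinP.
have mag : measurable_fun setT (fun x => `|(g x)%:E|)%E.
  by apply: measurableT_comp => //; exact/measurable_EFinP.
apply/integrable12ltyP; first by apply/measurable_EFinP; exact: measurable_tensor.
have E x : (\int[m2]_y `|(EFin \o (fun z : T1 * T2 => f z.1 * g z.2)%R) (x, y)| =
    `|(f x)%:E| * \int[m2]_y `|(g y)%:E|)%E.
  rewrite -ge0_integralZl//; apply: eq_integral => y _.
  by rewrite -abseM -EFinM.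
under eq_integral do rewrite E.
rewrite ge0_integralZr//; last by apply: integral_ge0.
apply: lte_mul_pinfty => //; first exact: integral_ge0.
by rewrite ge0_fin_numE// integral_ge0.
Qed.

Lemma Rintegral_tensor :
  \int[(m1 \x m2)%E]_z (f z.1 * g z.2) = \int[m1]_x f x * \int[m2]_y g y.
Proof.
rewrite (Rintegral_fubiniF integrable_tensor) /= -RintegralZr//.
by apply: eq_Rintegral => x _; rewrite RintegralZl.
Qed.

End tensor.

(** * The defect and its bounds *)

Section defect.
Context {R : realType}.
Local Notation mu := (@lebesgue_measure R).
Local Notation RR := (measurableTypeR R).
Implicit Types (f g w : RR -> R) (a : R).

Lemma preserves_subl (x : R) : preserves mu mu (fun y : RR => x - (y : R) : RR).
Proof.
have := preserves_comp (preserves_opp (R := R)) (preserves_shift x).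
by rewrite (_ : _ \o _ = (fun y : RR => x - (y : R) : RR))//; apply/funext => y /=; rewrite addrC.
Qed.

Lemma preserves_subr (x : R) : preserves mu mu (fun y : RR => (y : R) - x : RR).
Proof. exact: preserves_shift. Qed.

Lemma measurable_sub_prod : measurable_fun setT (fun z : RR * RR => (z.1 : R) - (z.2 : R)).
Proof. by apply: measurable_funB. Qed.

Lemma measurable_poisson_sub a : 0 < a ->
  measurable_fun setT (fun z : RR * RR => poisson a ((z.1 : R) - (z.2 : R))).
Proof.
by move=> a0; exact: (measurableT_comp (measurable_poisson a0) measurable_sub_prod).
Qed.

Lemma poisson_marginal1 a w : 0 < a -> measurable_fun setT w -> (forall x, 0 <= w x) ->
  (\int[mu \x mu]_z (w z.1 * poisson a ((z.1 : R) - (z.2 : R)))%:E = \int[mu]_x (w x)%:E)%E.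
Proof.
move=> a0 mw w0; have p0 u := poisson_ge0 u a0.
rewrite fubini_tonelli1; last 2 first.
- apply/measurable_EFinP; apply: measurable_funM; last exact: measurable_poisson_sub.
  exact: measurableT_comp.
- by move=> z; rewrite lee_fin mulr_ge0.
apply: eq_integral => x _; rewrite /fubini_F /=.
have mp : measurable_fun [set: RR] (EFin \o poisson a).
  by apply/measurable_EFinP; exact: measurable_poisson.
under eq_integral do rewrite EFinM.
rewrite ge0_integralZl_EFin//; last 2 first.
- by move=> u _; rewrite lee_fin.
- exact: (measurableT_comp mp (preserves_subl x).1).
transitivity ((w x)%:E * \int[mu]_u (EFin \o poisson a) u)%E.
  by rewrite ((preserves_subl x).2 _ mp).
by rewrite integral_poisson// mule1.
Qed.

Lemma poisson_marginal2 a w : 0 < a -> measurable_fun setT w -> (forall x, 0 <= w x) ->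
  (\int[mu \x mu]_z (w z.2 * poisson a ((z.1 : R) - (z.2 : R)))%:E = \int[mu]_x (w x)%:E)%E.
Proof.
move=> a0 mw w0; have p0 u := poisson_ge0 u a0.
rewrite fubini_tonelli2; last 2 first.
- apply/measurable_EFinP; apply: measurable_funM; last exact: measurable_poisson_sub.
  exact: measurableT_comp.
- by move=> z; rewrite lee_fin mulr_ge0.
apply: eq_integral => y _; rewrite /fubini_G /=.
have mp : measurable_fun [set: RR] (EFin \o poisson a).
  by apply/measurable_EFinP; exact: measurable_poisson.
under eq_integral do rewrite EFinM.
rewrite ge0_integralZl_EFin//; last 2 first.
- by move=> u _; rewrite lee_fin.
- exact: (measurableT_comp mp (preserves_subr y).1).
transitivity ((w y)%:E * \int[mu]_u (EFin \o poisson a) u)%E.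
  by rewrite ((preserves_subr y).2 _ mp).
by rewrite integral_poisson// mule1.
Qed.

Definition sqnorm f : \bar R := (\int[mu]_x (f x ^+ 2)%:E)%E.

(** The energy form of the Poisson kernel: formally, twice the gap between [sqnorm f] and the
    pairing of [f] with its Poisson average. As the integral of a nonnegative function it is defined
    before any finiteness is known. *)
Definition defect a f : \bar R :=
  (\int[mu \x mu]_z ((f z.1 - f z.2) ^+ 2 * poisson a ((z.1 : R) - (z.2 : R)))%:E)%E.

Lemma measurable_defect a f : 0 < a -> measurable_fun setT f ->
  measurable_fun setT
    (fun z : RR * RR => (f z.1 - f z.2) ^+ 2 * poisson a ((z.1 : R) - (z.2 : R))).
Proof.
move=> a0 mf; apply: measurable_funM; last exact: measurable_poisson_sub.
by apply: measurable_funX; apply: measurable_funB; exact: measurableT_comp.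
Qed.

Lemma defect_ge0 a f : 0 < a -> (0 <= defect a f)%E.
Proof.
by move=> a0; apply: integral_ge0 => z _; rewrite lee_fin mulr_ge0 ?sqr_ge0// poisson_ge0.
Qed.

Lemma sqnorm_ge0 f : (0 <= sqnorm f)%E.
Proof. by apply: integral_ge0 => x _; rewrite lee_fin sqr_ge0. Qed.

(** From [(s - t)^2 <= 2 s^2 + 2 t^2] and the unit mass of the kernel in each variable. The constant
    is independent of [a], which lets the vanishing of the defect pass to limits in square norm. *)
Lemma defect_le_sqnorm a f : 0 < a -> measurable_fun setT f ->
  (defect a f <= 4%:E * sqnorm f)%E.
Proof.
move=> a0 mf; have p0 u := poisson_ge0 u a0.
have m2 : measurable_fun setT (fun x => 2 * f x ^+ 2).
  by apply: measurable_funM => //; exact: measurable_funX.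
have f20 x : 0 <= 2 * f x ^+ 2 by rewrite mulr_ge0// sqr_ge0.
have -> : (4%:E * sqnorm f = \int[mu]_x (2 * f x ^+ 2)%:E + \int[mu]_x (2 * f x ^+ 2)%:E)%E.
  under eq_integral do rewrite EFinM.
  rewrite ge0_integralZl_EFin//; last 2 first.
  - by move=> x _; rewrite lee_fin sqr_ge0.
  - by apply/measurable_EFinP; exact: measurable_funX.
  rewrite -/(sqnorm f) -ge0_muleDl// -EFinD.
  by congr (_%:E * _)%E; ring.
rewrite -{1}(poisson_marginal1 a0 m2 f20) -(poisson_marginal2 a0 m2 f20).
have mM1 : measurable_fun setT
    (fun z : RR * RR => (2 * f z.1 ^+ 2 * poisson a ((z.1 : R) - (z.2 : R)))%:E).
  apply/measurable_EFinP; apply: measurable_funM; last exact: measurable_poisson_sub.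
  exact: (measurableT_comp m2).
have mM2 : measurable_fun setT
    (fun z : RR * RR => (2 * f z.2 ^+ 2 * poisson a ((z.1 : R) - (z.2 : R)))%:E).
  apply/measurable_EFinP; apply: measurable_funM; last exact: measurable_poisson_sub.
  exact: (measurableT_comp m2).
rewrite -ge0_integralD//; last 2 first.
- by move=> z _; rewrite lee_fin mulr_ge0.
- by move=> z _; rewrite lee_fin mulr_ge0.
apply: ge0_le_integral => //.
- by move=> z _; rewrite lee_fin mulr_ge0// sqr_ge0.
- by apply/measurable_EFinP; exact: measurable_defect.
- exact: emeasurable_funD.
- move=> z _; rewrite -EFinD lee_fin -mulrDl ler_wpM2r//.
  have := sqr_ge0 (f z.1 + f z.2); nra.
Qed.

Lemma defectD_le a f g : 0 < a -> measurable_fun setT f -> measurable_fun setT g ->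
  (defect a (fun x => f x + g x)%R <= 2%:E * defect a f + 2%:E * defect a g)%E.
Proof.
move=> a0 mf mg; have p0 u := poisson_ge0 u a0; rewrite /defect.
have h0 (k : RR -> R) (z : RR * RR) :
    0 <= (k z.1 - k z.2) ^+ 2 * poisson a ((z.1 : R) - (z.2 : R)).
  by rewrite mulr_ge0// sqr_ge0.
have mE (k : RR -> R) : measurable_fun setT k -> measurable_fun setT
    (fun z : RR * RR => ((k z.1 - k z.2) ^+ 2 * poisson a ((z.1 : R) - (z.2 : R)))%:E).
  by move=> mk; apply/measurable_EFinP; exact: measurable_defect.
rewrite -!ge0_integralZl_EFin//; try exact: mE; try by move=> z _; rewrite lee_fin.
rewrite -ge0_integralD//; last 4 first.
- by move=> z _; rewrite mule_ge0// lee_fin.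
- by apply: measurable_funeM; exact: mE.
- by move=> z _; rewrite mule_ge0// lee_fin.
- by apply: measurable_funeM; exact: mE.
apply: ge0_le_integral => //.
- by move=> z _; rewrite lee_fin (h0 (fun x => f x + g x)).
- by apply: (mE (fun x => f x + g x)); exact: measurable_funD.
- by apply: emeasurable_funD; apply: measurable_funeM; exact: mE.
- move=> z _; rewrite -!EFinM -EFinD lee_fin.
  have le2 : (f z.1 + g z.1 - (f z.2 + g z.2)) ^+ 2 <=
      2 * (f z.1 - f z.2) ^+ 2 + 2 * (g z.1 - g z.2) ^+ 2.
    by have := sqr_ge0 ((f z.1 - f z.2) - (g z.1 - g z.2)); nra.
  by rewrite (le_trans (ler_wpM2r (p0 _) le2))// mulrDl !mulrA.
Qed.

Lemma defectZ a c f : 0 < a -> measurable_fun setT f ->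
  (defect a (fun x => c * f x)%R = (c ^+ 2)%:E * defect a f)%E.
Proof.
move=> a0 mf; rewrite /defect -ge0_integralZl_EFin ?sqr_ge0//.
- by apply: eq_integral => z _; rewrite -EFinM; congr EFin; ring.
- by move=> z _; rewrite lee_fin mulr_ge0 ?sqr_ge0// poisson_ge0.
- by apply/measurable_EFinP; exact: measurable_defect.
Qed.

End defect.

(** * The defect tends to zero *)

Section vanishing_defect.
Context {R : realType}.
Local Notation mu := (@lebesgue_measure R).
Local Notation RR := (measurableTypeR R).
Implicit Types (f g : RR -> R).

(** The parameter runs through [1 / (k + 1)]: a sequence is what dominated convergence handles, and
    [real_plancherel] uses these same values. *)
Definition vanishing_defect f := measurable_fun setT f /\
  forall e : R, 0 < e -> \forall k \near \oo, (defect (k.+1%:R^-1) f <= e%:E)%E.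

Let invS_gt0 k : 0 < k.+1%:R^-1 :> R.
Proof. by rewrite invr_gt0. Qed.

Lemma vanishing_defectD f g : vanishing_defect f -> vanishing_defect g ->
  vanishing_defect (fun x => f x + g x).
Proof.
move=> [mf vf] [mg vg]; split; first exact: measurable_funD.
move=> e e0; have e4 : 0 < e / 4 by rewrite divr_gt0.
apply: filterS2 (vf _ e4) (vg _ e4) => k fk gk.
rewrite (le_trans (defectD_le (invS_gt0 k) mf mg))//.
have -> : e%:E = (2%:E * (e / 4)%:E + 2%:E * (e / 4)%:E)%E.
  by rewrite -!EFinM -EFinD; congr EFin; field.
by rewrite leeD// lee_pmul2l.
Qed.

Lemma vanishing_defectZ c f : vanishing_defect f ->
  vanishing_defect (fun x => c * f x).
Proof.
move=> [mf vf]; split; first exact: measurable_funM.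
move=> e e0.
(* One is added so that the division below is harmless when [c = 0]. *)
have c1 : 0 < c ^+ 2 + 1 by rewrite ltr_wpDl// sqr_ge0.
have e1 : 0 < e / (c ^+ 2 + 1) by rewrite divr_gt0.
apply: filterS (vf _ e1) => k fk; rewrite defectZ//.
rewrite (@le_trans _ _ ((c ^+ 2)%:E * (e / (c ^+ 2 + 1))%:E)%E)//.
  by rewrite lee_wpmul2l// lee_fin sqr_ge0.
rewrite -EFinM lee_fin mulrCA -[leRHS]mulr1 ler_wpM2l ?(ltW e0)//.
by rewrite ler_pdivrMr// mul1r lerDl.
Qed.

(** Split [f] as [g + (f - g)]: the defect of [g] is eventually small, and that of the remainder is
    small for all [a] at once by [defect_le_sqnorm]. *)
Lemma vanishing_defect_approx f : measurable_fun setT f ->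
  (forall e : R, 0 < e -> exists2 g, vanishing_defect g &
     (sqnorm (fun x => f x - g x)%R <= e%:E)%E) ->
  vanishing_defect f.
Proof.
move=> mf apf; split=> // e e0.
have e4 : 0 < e / 4 by rewrite divr_gt0.
(* The remainder is multiplied by 2 in [defectD_le] and by 4 in [defect_le_sqnorm]; its total share
   is [e / 2]. *)
have e16 : 0 < e / 16 by rewrite divr_gt0.
have [g [mg vg] fg] := apf _ e16.
have mfg : measurable_fun setT (fun x => f x - g x) by exact: measurable_funB.
apply: filterS (vg _ e4) => k gk.
have -> : f = (fun x => g x + (f x - g x)) by apply/funext => x; ring.
rewrite (le_trans (defectD_le (invS_gt0 k) mg mfg))//.
have -> : e%:E = (2%:E * (e / 4)%:E + 2%:E * (4%:E * (e / 16)%:E))%E.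
  by rewrite -!EFinM -EFinD; congr EFin; field.
rewrite leeD// lee_pmul2l//.
rewrite (le_trans (defect_le_sqnorm (invS_gt0 k) mfg))//.
by rewrite lee_pmul2l.
Qed.

Lemma vanishing_defect0 : vanishing_defect (fun=> 0).
Proof.
split; first exact: measurable_cst.
move=> e e0; apply: nearW => k; rewrite /defect.
rewrite integral0_eq ?lee_fin ?ltW// => z _.
by rewrite subrr expr0n mul0r.
Qed.

Lemma vanishing_defect_sum (n : nat) (F : 'I_n -> RR -> R) :
  (forall i, vanishing_defect (F i)) -> vanishing_defect (fun x => \sum_(i < n) F i x).
Proof.
elim: n F => [|n IH] F vF.
  by under eq_fun do rewrite big_ord0; exact: vanishing_defect0.
under eq_fun do rewrite big_ord_recr.
by apply: vanishing_defectD => //; exact: IH.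
Qed.

Definition displacement f (u : R) : \bar R :=
  (\int[mu]_x ((f x - f ((x : R) - u)) ^+ 2)%:E)%E.

Lemma measurable_displaced f : measurable_fun setT f ->
  measurable_fun setT (fun z : RR * RR => ((f z.1 - f ((z.1 : R) - (z.2 : R) : RR)) ^+ 2)%:E).
Proof.
move=> mf; apply/measurable_EFinP; apply: measurable_funX; apply: measurable_funB.
  exact: measurableT_comp.
exact: (measurableT_comp mf measurable_sub_prod).
Qed.

(** The substitution [y = x - u] and Tonelli leave the kernel depending on [u] alone, so the
    concentration of the kernel meets the continuity of translations in square norm. *)
Lemma defect_displacement a f : 0 < a -> measurable_fun setT f ->
  (defect a f = \int[mu]_u ((poisson a u)%:E * displacement f u))%E.
Proof.
move=> a0 mf; have p0 u := poisson_ge0 u a0.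
have md := measurable_displaced mf.
have mpd : measurable_fun setT (fun z : RR * RR => (poisson a z.2 *
    (f z.1 - f ((z.1 : R) - (z.2 : R) : RR)) ^+ 2)%:E).
  apply/measurable_EFinP; apply: measurable_funM; last exact/measurable_EFinP.
  exact: (measurableT_comp (measurable_poisson a0) measurable_snd).
have pd0 (z : RR * RR) : (0 <= (poisson a z.2 *
    (f z.1 - f ((z.1 : R) - (z.2 : R) : RR)) ^+ 2)%:E)%E.
  by rewrite lee_fin mulr_ge0// sqr_ge0.
rewrite /defect fubini_tonelli1; last 2 first.
- by apply/measurable_EFinP; exact: measurable_defect.
- by move=> z; rewrite lee_fin mulr_ge0// sqr_ge0.
transitivity (\int[mu]_x \int[mu]_u (poisson a u *
    (f x - f ((x : R) - (u : R) : RR)) ^+ 2)%:E)%E.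
  apply: eq_integral => x _; rewrite /fubini_F /=.
  rewrite ((preserves_subl x).2
    (fun y : RR => ((f x - f y) ^+ 2 * poisson a ((x : R) - (y : R)))%:E)).
  - by apply: eq_integral => u _; congr EFin; rewrite mulrC; congr (poisson a _ * _); ring.
  - apply/measurable_EFinP.
    exact: (measurableT_comp (measurable_defect a0 mf) (measurable_pairr x)).
  - by move=> y; rewrite lee_fin mulr_ge0// sqr_ge0.
rewrite -[LHS]/(\int[mu]_x fubini_F mu (fun z : RR * RR => (poisson a z.2 *
    (f z.1 - f ((z.1 : R) - (z.2 : R) : RR)) ^+ 2)%:E) x)%E.
rewrite -fubini_tonelli1// fubini_tonelli2//.
apply: eq_integral => u _; rewrite /fubini_G /=.
under eq_integral do rewrite EFinM.
rewrite ge0_integralZl_EFin//.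
- by move=> x _; rewrite lee_fin sqr_ge0.
- exact: (measurableT_comp md (measurable_pairl u)).
Qed.

Lemma displacement_le f u : measurable_fun setT f ->
  (displacement f u <= 4%:E * sqnorm f)%E.
Proof.
move=> mf.
have m2 : measurable_fun setT (fun x => (2 * f x ^+ 2)%:E).
  by apply/measurable_EFinP; apply: measurable_funM => //; exact: measurable_funX.
have -> : (4%:E * sqnorm f = \int[mu]_x (2 * f x ^+ 2)%:E +
    \int[mu]_x (2 * f ((x : R) - u : RR) ^+ 2)%:E)%E.
  rewrite -((preserves_subr u).2 _ m2); last by move=> x; rewrite lee_fin mulr_ge0// sqr_ge0.
  under eq_integral do rewrite EFinM.
  rewrite ge0_integralZl_EFin//; last 2 first.
  - by move=> x _; rewrite lee_fin sqr_ge0.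
  - by apply/measurable_EFinP; exact: measurable_funX.
  rewrite -/(sqnorm f) -ge0_muleDl// -EFinD.
  by congr (_%:E * _)%E; ring.
have m2u := measurableT_comp m2 (preserves_subr u).1.
rewrite -ge0_integralD//; last 2 first.
- by move=> x _; rewrite lee_fin mulr_ge0// sqr_ge0.
- by move=> x _; rewrite lee_fin mulr_ge0// sqr_ge0.
apply: ge0_le_integral => //.
- by move=> x _; rewrite lee_fin sqr_ge0.
- exact: (measurableT_comp (measurable_displaced mf) (measurable_pairl u)).
- exact: emeasurable_funD.
- move=> x _; rewrite -EFinD lee_fin.
  have := sqr_ge0 (f x + f ((x : R) - u)); nra.
Qed.

(** The indicator and its translate can differ only at points within [|u|] of an endpoint. Two
    intervals of length [2 * |u|] cover these points, whence the 4. *)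
Lemma displacement_itv (b c u : R) :
  (displacement (\1_`]b, c]) u <= (4 * `|u|)%:E)%E.
Proof.
pose J (s : R) : set RR := `[(s - `|u|), (s + `|u|)]%classic.
have muJ s : (mu : {measure set RR -> \bar R}) (J s) = (2 * `|u|)%:E.
  rewrite [LHS]lebesgue_measure_itv /= lte_fin.
  case: ltP => [_|h]; first by rewrite -EFinD; congr EFin; ring.
  have -> : `|u| = 0 by apply/eqP; rewrite eq_le normr_ge0 andbT; lra.
  by rewrite mulr0.
have mJ s : measurable (J s) by exact: measurable_itv.
have -> : ((4 * `|u|)%:E = \int[mu]_x (\1_(J b) x)%:E + \int[mu]_x (\1_(J c) x)%:E)%E.
  by rewrite !integral_indic// !setIT !muJ -EFinD; congr EFin; ring.
have mind (A : set RR) : measurable A -> measurable_fun setT (fun x => (\1_A x)%:E : \bar R).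
  by move=> mA; apply/measurable_EFinP; exact: measurable_indic.
rewrite -ge0_integralD//; try exact: mind; try by move=> x _; rewrite lee_fin.
apply: ge0_le_integral => //.
- by move=> x _; rewrite lee_fin sqr_ge0.
- apply: (measurableT_comp (measurable_displaced _) (measurable_pairl u)).
  exact: measurable_indic.
- by apply: emeasurable_funD; exact: mind.
- move=> x _; rewrite -EFinD lee_fin.
  have nb (A : set RR) (y : RR) : 0 <= (\1_A y : R) /\ (\1_A y : R) <= 1.
    by rewrite indicE; case: (_ \in _); rewrite /= ?lexx ?ler01.
  have [f0 f1] := nb `]b, c]%classic x.
  have [g0 g1] := nb `]b, c]%classic ((x : R) - u).
  have [b0 b1] := nb (J b) x; have [c0 c1] := nb (J c) x.
  have inJ s : `|x - s| <= `|u| -> \1_(J s) x = 1 :> R.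
    move=> h; have Jx : J s x by rewrite /J /= in_itv /= -ler_distl.
    by rewrite indicE mem_set.
  have [hb|hb] := leP `|x - b| `|u|.
    by rewrite (inJ _ hb); nra.
  have [hc|hc] := leP `|x - c| `|u|.
    by rewrite (inJ _ hc); nra.
  rewrite (_ : \1_`]b, c]%classic x = \1_`]b, c]%classic ((x : R) - u))//.
    by rewrite subrr expr0n addr_ge0.
  rewrite !indicE; congr (_%:R); congr nat_of_bool.
  rewrite !mem_setE !in_itv/=.
  (* When [x] is farther than [|u|] from [s], the points [x] and [x - u] lie on the same side of
     [s]. *)
  have e1 s : `|u| < `|x - s| -> (s < x) = (s < x - u) /\ (x <= s) = (x - u <= s).
    have u1 := ler_norm u; have := ler_norm (- u); rewrite normrN => u2.
    by case: (ger0P (x - s)) => h0 h; split; apply/idP/idP => h'; lra.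
  by rewrite (e1 _ hb).1 (e1 _ hc).2.
Qed.

End vanishing_defect.

Section vanishing_defect_L2.
Context {R : realType}.
Local Notation mu := (@lebesgue_measure R).
Local Notation RR := (measurableTypeR R).
Implicit Types (f g : RR -> R).

(** An integrable majorant independent of [a]. With [v = 2 pi |u|], clearing denominators leaves two
    terms: [a w <= a v <= a^2 + v^2], by [w <= 4 |u| <= v], and [a w v^2 <= 4 L (a^2 + v^2)], by
    [a <= 1] and [w <= 4 L]. The linear bound alone would not do, since [|u|] times the kernel is
    not integrable. *)
Lemma poisson_displacement_le (a u w L : R) : 0 < a -> a <= 1 -> 0 <= w ->
  w <= 4 * `|u| -> w <= 4 * L ->
  poisson a u * w <= (1 + 4 * L) * poisson 1 u.
Proof.
move=> a0 a1 w0 wu wL; have L0 : 0 <= 4 * L by exact: le_trans wL.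
have d1 := poisson_denom_gt0 u (@ltr01 R); have d2 := poisson_denom_gt0 u a0.
rewrite /poisson; move: d1 d2; have -> : (2 * pi * u) ^+ 2 = (2 * pi * `|u|) ^+ 2.
  by rewrite !exprMn real_normK ?num_real.
have wv : w <= 2 * pi * `|u|.
  rewrite (le_trans wu)// ler_wpM2r//; have := pi_ge2 R; lra.
move: (2 * pi * `|u|) wv => v wv; rewrite expr1n => d1 d2.
rewrite mulrAC ler_pdivrMr// [leRHS]mulrAC mulrA ler_pdivlMr//.
have aw : a * w <= a ^+ 2 + v ^+ 2.
  have : a * w <= a * v by rewrite ler_wpM2l// ltW.
  have := sqr_ge0 (a - v); nra.
have awv : a * w * v ^+ 2 <= 4 * L * (a ^+ 2 + v ^+ 2).
  rewrite (@le_trans _ _ (4 * L * v ^+ 2))// ?ler_wpM2l// ?lerDr ?sqr_ge0//.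
  by rewrite ler_wpM2r ?sqr_ge0//; nra.
nra.
Qed.

Lemma near_le_cvg0 (X : nat -> \bar R) (e : R) : X k @[k --> \oo] --> 0%E -> 0 < e ->
  \forall k \near \oo, (X k <= e%:E)%E.
Proof.
move=> X0 e0; have e0E : (0 < e%:E)%E by rewrite lte_fin.
have h : \forall k \near \oo, (X k < e%:E)%E by exact: (X0 _ (open_ereal_lt' e0E)).
by apply: filterS h => k /ltW.
Qed.

Lemma vanishing_defect_itv (b c : R) : vanishing_defect (\1_`]b, c] : RR -> R).
Proof.
set f : RR -> R := \1_`]b, c].
have mf : measurable_fun setT f by exact: measurable_indic.
split=> // e e0.
have sqf : sqnorm f = mu `]b, c]%classic.
  rewrite /sqnorm; under eq_integral do
    rewrite expr2 /f indicE -natrM mulnb andbb -indicE.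
  by rewrite integral_indic// setIT.
have sqfy : (sqnorm f < +oo)%E.
  rewrite sqf [ltLHS]lebesgue_measure_itv /=.
  by case: ifPn => // _; rewrite -EFinD ltry.
have sqfin : sqnorm f \is a fin_num by rewrite ge0_fin_numE// sqnorm_ge0.
pose L := fine (sqnorm f); have LE : sqnorm f = L%:E by rewrite fineK.
have pi0 : pi != 0 :> R by rewrite gt_eqF// pi_gt0.
have disp0 u : (0 <= displacement f u)%E.
  by apply: integral_ge0 => x _; rewrite lee_fin sqr_ge0.
have disp_fin u : displacement f u \is a fin_num.
  rewrite ge0_fin_numE// (le_lt_trans (displacement_le u mf))// LE -EFinM ltry//.
pose w u := fine (displacement f u); have wE u : displacement f u = (w u)%:E by rewrite fineK.
have w0 u : 0 <= w u by rewrite fine_ge0.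
have wu u : w u <= 4 * `|u| by rewrite -lee_fin -wE displacement_itv.
have wL u : w u <= 4 * L by rewrite -lee_fin -wE EFinM -LE displacement_le.
have mdisp : measurable_fun [set: RR] (displacement f).
  apply: (measurable_fun_fubini_tonelli_G _ (measurable_displaced mf)) => z.
  by rewrite lee_fin sqr_ge0.
pose a (k : nat) : R := k.+1%:R^-1.
have a0 k : 0 < a k by rewrite invr_gt0.
have a1 k : a k <= 1 by rewrite invf_le1// ler1n.
have p0 k u := poisson_ge0 u (a0 k).
have mF k : measurable_fun [set: RR] (fun u => ((poisson (a k) u)%:E * displacement f u)%E).
  apply: emeasurable_funM => //.
  by apply/measurable_EFinP; exact: measurable_poisson.
have [||||_ _] := @dominated_convergence _ _ _ mu setT measurableT
   (fun k u => ((poisson (a k) u)%:E * displacement f u)%E) (fun=> 0%E)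
   (fun u => ((1 + 4 * L) * poisson 1 u)%:E) mF.
- exact: measurable_cst.
- apply: aeW => u _.
  (* Dropping [a^2] from the denominator of the kernel and using [w u <= 4 |u|] gives a bound linear
     in [a k]. At [u = 0] both sides are zero. *)
  apply: (@squeeze_cvge _ _ _ _ (fun=> 0%E) _
    (fun k => (a k)%:E * (8 * `|u| / (2 * pi * u) ^+ 2)%:E)%E).
  + apply: nearW => k; rewrite mule_ge0 ?lee_fin//= wE -!EFinM lee_fin.
    rewrite (le_trans (ler_wpM2l (p0 k u) (wu u)))//.
    have [->|u0] := eqVneq u 0.
      by rewrite normr0 !mulr0 mul0r mulr0.
    have v0 : 0 < (2 * pi * u) ^+ 2.
      by rewrite exprn_even_gt0//= !mulf_neq0// pnatr_eq0.
    have d0 := poisson_denom_gt0 u (a0 k).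
    rewrite (@le_trans _ _ (2 * a k / (2 * pi * u) ^+ 2 * (4 * `|u|)))//.
      rewrite ler_wpM2r ?mulr_ge0// ler_wpM2l ?mulr_ge0 ?(ltW (a0 k))//.
      by rewrite lef_pV2 ?posrE// lerDr sqr_ge0.
    rewrite le_eqVlt; apply/orP; left; apply/eqP.
    by move: (pi : R) pi0 => q q0; field; rewrite u0 q0.
  + exact: cvg_cst.
  + rewrite -[X in _ --> X](mul0e (8 * `|u| / (2 * pi * u) ^+ 2)%:E).
    apply: cvgeZr => //.
    by apply: cvg_EFin; [exact: nearW|exact: cvg_harmonic].
- rewrite (_ : (fun _ => _) = (fun u => (1 + 4 * L)%:E * (EFin \o poisson 1) u)%E)//.
  by apply: integrableZl => //; exact: integrable_poisson.
- apply: aeW => u k _; rewrite gee0_abs ?mule_ge0 ?lee_fin// wE -EFinM lee_fin.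
  exact: poisson_displacement_le.
rewrite integral0 => /near_le_cvg0 /(_ e0).
by apply: filterS => k; rewrite -/(a k) defect_displacement.
Qed.

End vanishing_defect_L2.

Import HBNNSimple.

Section vanishing_defect_density.
Context {R : realType}.
Local Notation mu := (@lebesgue_measure R).
Local Notation RR := (measurableTypeR R).
Implicit Types (f : RR -> R).

(** Dominated convergence makes the [F n] approach [f] in square norm, so that one of them is close
    enough for [vanishing_defect_approx]. *)
Lemma vanishing_defect_dominated f (F : nat -> RR -> R) (G : RR -> R) :
  measurable_fun setT f -> (forall n, vanishing_defect (F n)) ->
  (forall x, F n x @[n --> \oo] --> f x) ->
  (forall n x, (f x - F n x) ^+ 2 <= G x) ->
  mu.-integrable setT (EFin \o G) -> vanishing_defect f.
Proof.
move=> mf vF Ff FG iG; apply: vanishing_defect_approx => // e e0.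
have [|||||_ _] := @dominated_convergence _ _ _ mu setT measurableT
   (fun n x => ((f x - F n x) ^+ 2)%:E) (fun=> 0%E) (EFin \o G).
- move=> n; apply/measurable_EFinP; apply: measurable_funX; apply: measurable_funB => //.
  exact: (vF n).1.
- exact: measurable_cst.
- apply: aeW => x _; apply: cvg_EFin; first exact: nearW.
  rewrite -[X in _ --> X](_ : (f x - f x) * (f x - f x) = 0); last by rewrite subrr mul0r.
  by apply: cvgM; apply: cvgB => //; exact: cvg_cst.
- exact: iG.
- by apply: aeW => x n _; rewrite gee0_abs ?lee_fin ?sqr_ge0//; exact: FG.
rewrite integral0 => /near_le_cvg0 /(_ e0) [n _ /(_ n (leqnn n))] /= h.
by exists (F n).
Qed.

Let box (M : R) : set RR := `](- M), M]%classic.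

Let integrable_box M : mu.-integrable setT (EFin \o (\1_(box M) : RR -> R)).
Proof. exact: integrable_indic_itv. Qed.

(** A Dynkin argument: half-open intervals are stable under intersection and generate the Borel
    sets, proper differences follow from linearity, and increasing unions from dominated
    convergence. The box supplies the integrable majorant and, being half-open, keeps intersections
    with intervals in the same family. *)
Lemma vanishing_defect_box M (A : set RR) : measurable A ->
  vanishing_defect (\1_(A `&` box M) : RR -> R).
Proof.
move=> mA; have mbox : measurable (box M) by exact: measurable_itv.
suff : measurable `<=` [set A : set RR | measurable A /\
    vanishing_defect (\1_(A `&` box M) : RR -> R)] by move=> /(_ _ mA) [].
apply: (@lambda_system_subset _ (@ocitv R) (@ocitvI R) setT); last by [].
- split=> //.
  + by split=> //; rewrite setTI; exact: vanishing_defect_itv.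
  + move=> X Y YX [mX vX] [mY vY]; split; first exact: measurableD.
    rewrite (_ : \1_((X `\` Y) `&` box M) =
        (fun x => \1_(X `&` box M) x + (-1) * \1_(Y `&` box M) x)); last first.
      apply/funext => x; rewrite !indicE in_setI classical_sets.in_setD !in_setI.
      case: (boolP (x \in Y)) => xY /=; last by rewrite andbT mulr0 addr0.
      have -> : x \in X by move: xY; rewrite !inE; exact: YX.
      by rewrite /= mulN1r subrr.
    by apply: vanishing_defectD => //; exact: vanishing_defectZ.
  + move=> F ndF HF; split; first by apply: bigcupT_measurable => i; exact: (HF i).1.
    apply: (@vanishing_defect_dominated _ (fun n => \1_(F n `&` box M)) (\1_(box M))) => //.
    * apply: measurable_indic; apply: measurableI => //.
      by apply: bigcupT_measurable => i; exact: (HF i).1.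
    * by move=> n; exact: (HF n).2.
    * move=> x; apply: cvg_near_cst.
      have [[i _ Fix]|nFx] := pselect ((\bigcup_i F i) x).
        exists i => // k /= ik; rewrite !indicE !in_setI.
        have -> : x \in F k by rewrite inE; move: x Fix; exact/subsetPset/ndF.
        by have -> : x \in \bigcup_i F i by rewrite inE; exists i.
      apply: nearW => k; rewrite !indicE !in_setI.
      have /negbTE -> : x \notin F k by rewrite notin_setE => Fkx; apply: nFx; exists k.
      by have /negbTE -> : x \notin \bigcup_i F i by rewrite notin_setE.
    * move=> n x; rewrite !indicE !in_setI.
      by case: (_ \in box M); case: (x \in F n); case: (x \in _);
        rewrite /= ?subrr ?subr0 ?sub0r ?sqrrN ?expr1n ?expr0n.
- move=> _ [[b c] _ <-]; split; first exact: measurable_itv.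
  have : ocitv (`]b, c] `&` box M) by apply: ocitvI; [exists (b, c)|exists (- M, M)].
  by move=> [[b' c'] _ /= <-]; exact: vanishing_defect_itv.
Qed.

Lemma vanishing_defect_ge0 f : measurable_fun setT f -> (forall x, 0 <= f x) ->
  (sqnorm f < +oo)%E -> vanishing_defect f.
Proof.
move=> mf f0 fy.
have mEf : measurable_fun setT (EFin \o f) by exact/measurable_EFinP.
pose g n := nnsfun_approx measurableT mEf n.
(* Simple functions cut off by growing boxes: each is a finite combination of indicators as in
   [vanishing_defect_box], and [0 <= F n <= f] makes [f^2] a majorant of the squared error. *)
pose F n x : R := g n x * \1_(box n%:R) x.
have g0 n x : 0 <= g n x by [].
have gf n x : g n x <= f x.
  rewrite -lee_fin /g nnsfun_approxE; apply: (le_approx _ (D := setT)) => //.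
  by move=> y _; rewrite lee_fin.
apply: (@vanishing_defect_dominated _ F (fun x => f x ^+ 2)) => //.
- move=> n.
  have -> : F n = (fun x => \sum_(i < size (finmap.enum_fset (fset_set (range (g n)))))
      (finmap.enum_fset (fset_set (range (g n))))`_i *
      \1_(g n @^-1` [set (finmap.enum_fset (fset_set (range (g n))))`_i] `&` box n%:R) x).
    apply/funext => x; rewrite /F fimfunEord mulr_suml; apply: eq_bigr => i _.
    by rewrite indicI /= mulrA.
  apply: vanishing_defect_sum => i; apply: vanishing_defectZ.
  exact: vanishing_defect_box.
- move=> x; rewrite -[X in _ --> X]mulr1; apply: cvgM.
    have := @cvg_nnsfun_approx _ _ _ _ measurableT _ mEf (fun x _ => _ (f0 x)) x I.
    by move=> /(_ (fun y h => h)) /fine_cvgP[].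
  apply: cvg_near_cst; near=> n; rewrite indicE mem_set//= /box /= in_itv/=.
  have xn : `|x| < n%:R by near: n; exact: nbhs_infty_gtr.
  by move: xn; rewrite ltr_norml => /andP[-> /ltW].
- move=> n x; rewrite ler_sqr ?nnegrE//; last first.
  + by rewrite /F indicE; case: (_ \in _); rewrite /= ?mulr1 ?mulr0 ?subr0// subr_ge0.
  + by rewrite gerBl /F mulr_ge0// indicE.
- apply/integrableP; split; first by apply/measurable_EFinP; exact: measurable_funX.
  by under eq_integral do rewrite gee0_abs ?lee_fin ?sqr_ge0//.
Unshelve. all: end_near. Qed.

Lemma vanishing_defect_L2 f : measurable_fun setT f -> (sqnorm f < +oo)%E ->
  vanishing_defect f.
Proof.
move=> mf fy.
pose p x := Num.max (f x) 0; pose n x := Num.max (- f x) 0.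
have mp : measurable_fun setT p by apply: measurable_maxr.
have mn : measurable_fun setT n by apply: measurable_maxr => //; exact: measurable_funN.
have mf2 : measurable_fun setT (fun x => (f x ^+ 2)%:E).
  by apply/measurable_EFinP; exact: measurable_funX.
have le_sq (h : RR -> R) : measurable_fun setT h -> (forall x, h x ^+ 2 <= f x ^+ 2) ->
    (sqnorm h < +oo)%E.
  move=> mh hf; apply: le_lt_trans fy; apply: ge0_le_integral => //.
  - by move=> x _; rewrite lee_fin sqr_ge0.
  - by apply/measurable_EFinP; exact: measurable_funX.
  - by move=> x _; rewrite lee_fin.
rewrite (_ : f = (fun x => p x + (-1) * n x)); last first.
  by apply/funext => x; rewrite /p /n; case: (leP (f x) 0); case: (leP (- f x) 0) => *; lra.
apply: vanishing_defectD; last apply: vanishing_defectZ; apply: vanishing_defect_ge0 => //.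
- by move=> x; rewrite le_max lexx orbT.
- by apply: le_sq => // x; rewrite /p; case: (leP (f x) 0) => // _; rewrite expr0n sqr_ge0.
- by move=> x; rewrite le_max lexx orbT.
- by apply: le_sq => // x; rewrite /n; case: (leP (- f x) 0) => // _;
    rewrite ?sqrrN// expr0n sqr_ge0.
Qed.

End vanishing_defect_density.

Lemma integrable_bounded_mul d (T : measurableType d) (R : realType)
    (mu : {measure set T -> \bar R}) (g h : T -> R) :
  mu.-integrable setT (EFin \o g) ->
  measurable_fun setT h -> (forall x, `|h x| <= 1) ->
  mu.-integrable setT (EFin \o (fun x => g x * h x)).
Proof.
move=> ig mh h1; apply: (@integrable_le _ _ _ _ _ (fun x => `|g x|)).
- by apply: measurable_funM => //; apply/measurable_EFinP; exact: measurable_int ig.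
- by move=> x; rewrite normrM ler_piMr.
- exact: integrable_norm.
Qed.

(** * Plancherel's formula for real functions *)

Section real_plancherel.
Context {R : realType}.
Local Notation mu := (@lebesgue_measure R).
Local Notation RR := (measurableTypeR R).
Local Notation M := (sigma_finite_prod mu mu).
Variable f : RR -> R.
Hypothesis intf : mu.-integrable setT (EFin \o f).
Hypothesis sqf : (sqnorm f < +oo)%E.

Let mf : measurable_fun setT f.
Proof. by apply/measurable_EFinP; exact: measurable_int intf. Qed.

(** For real [f], this and minus the next one are the real and imaginary parts of the Fourier
    transform. *)
Definition cos_transform (q : R) : R := \int[mu]_x (f x * cos (2 * pi * q * x)).
Definition sin_transform (q : R) : R := \int[mu]_x (f x * sin (2 * pi * q * x)).
Definition power_spectrum (q : R) : R := cos_transform q ^+ 2 + sin_transform q ^+ 2.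

Let measurable_lin (c : R) : measurable_fun [set: RR] (fun x : RR => c * (x : R)).
Proof. by apply: measurable_funM. Qed.

Let mcos (c : R) : measurable_fun [set: RR] (fun x : RR => cos (c * (x : R)) : R).
Proof.
apply: (@measurableT_comp _ _ _ _ _ _ (@cos R) _ (fun x : RR => c * (x : R))) => //.
by apply: continuous_measurable_fun; exact: continuous_cos.
Qed.

Let msin (c : R) : measurable_fun [set: RR] (fun x : RR => sin (c * (x : R)) : R).
Proof.
apply: (@measurableT_comp _ _ _ _ _ _ (@sin R) _ (fun x : RR => c * (x : R))) => //.
by apply: continuous_measurable_fun; exact: continuous_sin.
Qed.

Let le1 (x : R) : `|cos x| <= 1 /\ `|sin x| <= 1.
Proof. by rewrite !ler_norml cos_geN1 cos_le1 sin_geN1 sin_le1. Qed.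

Let icos q : mu.-integrable setT (EFin \o (fun x : RR => f x * cos (2 * pi * q * x))).
Proof.
by apply: integrable_bounded_mul => // x; have [] := le1 (2 * pi * q * (x : R)).
Qed.

Let isin q : mu.-integrable setT (EFin \o (fun x : RR => f x * sin (2 * pi * q * x))).
Proof.
by apply: integrable_bounded_mul => // x; have [] := le1 (2 * pi * q * (x : R)).
Qed.

(** The squares of the two integrals are integrals over the product, and their sum is collected by
    the addition formula for the cosine of a difference. *)
Lemma power_spectrumE q : power_spectrum q =
  \int[M]_z (f z.1 * f z.2 * cos (2 * pi * ((z.1 : R) - (z.2 : R)) * q)).
Proof.
rewrite /power_spectrum !expr2.
rewrite -(Rintegral_tensor (icos q) (icos q)) -(Rintegral_tensor (isin q) (isin q)).
rewrite -RintegralD//; [|exact: (integrable_tensor (icos q) (icos q))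
  |exact: (integrable_tensor (isin q) (isin q))].
apply: eq_Rintegral => z _.
rewrite mulrBr mulrBl cosB.
rewrite (_ : 2 * pi * z.1 * q = 2 * pi * q * z.1); last by rewrite mulrAC.
rewrite (_ : 2 * pi * z.2 * q = 2 * pi * q * z.2); last by rewrite mulrAC.
by ring.
Qed.

Section regularized.
Variable a : R.
Hypothesis a0 : 0 < a.

(** The integrand of the triple integral. The weight makes it integrable, with majorant
    [|f x f y| * abel a q], so Fubini applies: integrating in [q] first produces the Poisson kernel,
    integrating in [(x, y)] first the power spectrum. *)
Let k (w : (RR * RR) * RR) : R := f w.1.1 * f w.1.2 *
  (abel a w.2 * cos (2 * pi * ((w.1.1 : R) - (w.1.2 : R)) * (w.2 : R))).

Let ik : (M \x mu)%E.-integrable setT (EFin \o k).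
Proof.
have iff : M.-integrable setT (EFin \o (fun z => `|f z.1 * f z.2|)).
  exact: (integrable_norm (integrable_tensor intf intf)).
apply: (integrable_le _ _ (integrable_tensor iff (integrable_abel a0))).
- apply: measurable_funM.
    apply: (measurableT_comp (f := fun z : RR * RR => f z.1 * f z.2)) => //.
    by apply: measurable_funM; exact: measurableT_comp.
  apply: measurable_funM.
    by apply: (measurableT_comp (measurable_abel a)).
  apply: (@measurableT_comp _ _ _ _ _ _ (@cos R)).
    by apply: continuous_measurable_fun; exact: continuous_cos.
  apply: measurable_funM => //; apply: measurable_funM => //.
  exact: (measurableT_comp measurable_sub_prod).
- move=> w; rewrite /k normrM ler_wpM2l// normrM (ger0_norm (abel_ge0 _ _)).
  by rewrite ler_piMr ?abel_ge0//; have [] := le1 (2 * pi * ((w.1.1 : R) - (w.1.2 : R)) * (w.2 : R)).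
Qed.

Let iff : M.-integrable setT (EFin \o (fun z => f z.1 * f z.2)).
Proof. exact: (integrable_tensor intf intf). Qed.

Let mpoisson : measurable_fun setT (fun z : RR * RR => poisson a ((z.1 : R) - (z.2 : R))).
Proof. exact: measurable_poisson_sub. Qed.

Let kF z : \int[mu]_q k (z, q) = f z.1 * f z.2 * poisson a ((z.1 : R) - (z.2 : R)).
Proof.
rewrite /k /= RintegralZl//; first by rewrite Rintegral_abel_cos.
apply: integrable_bounded_mul => //; first exact: integrable_abel.
by move=> x; have [] := le1 (2 * pi * ((z.1 : R) - (z.2 : R)) * x).
Qed.

Let kG q : \int[M]_z k (z, q) = abel a q * power_spectrum q.
Proof.
rewrite power_spectrumE -RintegralZl//.
  by apply: eq_Rintegral => z _; rewrite /k /=; ring.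
apply: integrable_bounded_mul => //.
- apply: (@measurableT_comp _ _ _ _ _ _ (@cos R)).
    by apply: continuous_measurable_fun; exact: continuous_cos.
  apply: measurable_funM => //; apply: measurable_funM => //.
  exact: measurable_sub_prod.
- by move=> z; have [] := le1 (2 * pi * ((z.1 : R) - (z.2 : R)) * q).
Qed.

Lemma integrable_abel_spectrum :
  mu.-integrable setT (EFin \o (fun q : RR => abel a q * power_spectrum q)).
Proof.
apply: eq_integrable (integrable_RintegralG ik) => // q _ /=.
by rewrite kG.
Qed.

Lemma Rintegral_abel_spectrum : \int[mu]_q (abel a q * power_spectrum q) =
  \int[M]_z (f z.1 * f z.2 * poisson a ((z.1 : R) - (z.2 : R))).
Proof.
transitivity (\int[mu]_q \int[M]_z k (z, q)); first by apply: eq_Rintegral => q _.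
by rewrite -(Rintegral_fubiniG ik) (Rintegral_fubiniF ik); apply: eq_Rintegral => z _.
Qed.

Let p0 z : 0 <= poisson a z. Proof. exact: poisson_ge0. Qed.

Let sq_integrable (s : RR * RR -> RR) : measurable_fun setT s ->
  (\int[mu \x mu]_z (f (s z) ^+ 2 * poisson a ((z.1 : R) - (z.2 : R)))%:E = sqnorm f)%E ->
  M.-integrable setT (EFin \o (fun z => f (s z) ^+ 2 * poisson a ((z.1 : R) - (z.2 : R)))).
Proof.
move=> ms E; apply/integrableP; split.
  apply/measurable_EFinP; apply: measurable_funM => //.
  by apply: measurable_funX; exact: measurableT_comp.
rewrite [ltLHS](_ : _ = sqnorm f)// -E; apply: eq_integral => z _.
by rewrite gee0_abs// lee_fin mulr_ge0// sqr_ge0.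
Qed.

Let mf2 : measurable_fun setT (fun x => f x ^+ 2). Proof. exact: measurable_funX. Qed.
Let f20 x : 0 <= f x ^+ 2. Proof. exact: sqr_ge0. Qed.

(* Expand [(f x - f y)^2]; the kernel has unit mass in each variable. *)
Lemma spectrum_defect :
  (2%:E * \int[mu]_q (abel a q * power_spectrum q)%:E + defect a f = 2%:E * sqnorm f)%E.
Proof.
have i1 := sq_integrable measurable_fst (poisson_marginal1 a0 mf2 f20).
have i2 := sq_integrable measurable_snd (poisson_marginal2 a0 mf2 f20).
have mffp : measurable_fun setT
    (fun z : RR * RR => f z.1 * f z.2 * poisson a ((z.1 : R) - (z.2 : R))).
  by apply: measurable_funM => //; apply: measurable_funM; exact: measurableT_comp.
have i12 : M.-integrable setT (EFin \o
    (fun z => f z.1 * f z.2 * poisson a ((z.1 : R) - (z.2 : R)))).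
  apply: (integrable_le _ _ (integrableD measurableT i1 i2)) => // z /=.
  rewrite -mulrDl normrM (ger0_norm (p0 _)) ler_wpM2r// ler_norml.
  have := sqr_ge0 (f z.1 - f z.2); have := sqr_ge0 (f z.1 + f z.2).
  by move=> h1 h2; apply/andP; split; nra.
have i122 := @integrableZl _ _ _ M setT measurableT 2 _ i12.
have id : M.-integrable setT (EFin \o
    (fun z => (f z.1 - f z.2) ^+ 2 * poisson a ((z.1 : R) - (z.2 : R)))).
  apply: eq_integrable (integrableB measurableT (integrableD measurableT i1 i2) i122) => //.
  by move=> z _ /=; congr EFin; ring.
have fin_sq : (sqnorm f)%E = (\int[M]_z (f z.1 ^+ 2 * poisson a ((z.1 : R) - (z.2 : R))))%:E.
  rewrite /Rintegral fineK; last exact: integrable_fin_num.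
  exact: (esym (poisson_marginal1 a0 mf2 f20)).
have fin_sq' : (sqnorm f)%E = (\int[M]_z (f z.2 ^+ 2 * poisson a ((z.1 : R) - (z.2 : R))))%:E.
  rewrite /Rintegral fineK; last exact: integrable_fin_num.
  exact: (esym (poisson_marginal2 a0 mf2 f20)).
have -> : (2%:E * sqnorm f = sqnorm f + sqnorm f)%E by rewrite mule_natl mule2n.
rewrite {1}fin_sq fin_sq' -EFinD -RintegralD//.
have -> : defect a f = (\int[M]_z ((f z.1 - f z.2) ^+ 2 * poisson a ((z.1 : R) - (z.2 : R))))%:E.
  by rewrite /Rintegral fineK//; exact: integrable_fin_num.
have -> : (\int[mu]_q (abel a q * power_spectrum q)%:E =
    (\int[M]_z (f z.1 * f z.2 * poisson a ((z.1 : R) - (z.2 : R))))%:E)%E.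
  rewrite -Rintegral_abel_spectrum /Rintegral fineK//.
  exact: (integrable_fin_num measurableT integrable_abel_spectrum).
rewrite -EFinM -RintegralZl// -EFinD -RintegralD//.
by congr EFin; apply: eq_Rintegral => z _; ring.
Qed.

End regularized.

Lemma power_spectrum_ge0 q : 0 <= power_spectrum q.
Proof. by rewrite addr_ge0// sqr_ge0. Qed.

Lemma measurable_power_spectrum : measurable_fun [set: RR] power_spectrum.
Proof.
have mlin : measurable_fun setT (fun w : RR * RR => 2 * pi * (w.1 : R) * (w.2 : R)).
  by apply: measurable_funM => //; apply: measurable_funM.
apply: measurable_funD; apply: measurable_funX.
- apply: (@measurable_Rintegral_param _ _ _ _ _ mu
    (fun w : RR * RR => f w.2 * cos (2 * pi * (w.1 : R) * (w.2 : R)))).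
  apply: measurable_funM; first exact: measurableT_comp.
  apply: (@measurableT_comp _ _ _ _ _ _ (@cos R)) => //.
  by apply: continuous_measurable_fun; exact: continuous_cos.
- apply: (@measurable_Rintegral_param _ _ _ _ _ mu
    (fun w : RR * RR => f w.2 * sin (2 * pi * (w.1 : R) * (w.2 : R)))).
  apply: measurable_funM; first exact: measurableT_comp.
  apply: (@measurableT_comp _ _ _ _ _ _ (@sin R)) => //.
  by apply: continuous_measurable_fun; exact: continuous_sin.
Qed.

(** Upper bound: the defect is nonnegative, so each weighted integral is at most [sqnorm f], and
    monotone convergence removes the weight. Lower bound: the weight is at most 1, so [2 * sqnorm f]
    exceeds twice the unweighted integral by at most a defect, which becomes arbitrarily small. *)
Lemma real_plancherel : (\int[mu]_q (power_spectrum q)%:E = sqnorm f)%E.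
Proof.
pose a (k : nat) : R := k.+1%:R^-1.
have a0 k : 0 < a k by rewrite invr_gt0.
pose F k (q : RR) := (abel (a k) q * power_spectrum q)%:E.
have mF k : measurable_fun setT (F k).
  apply/measurable_EFinP; apply: measurable_funM; first exact: measurable_abel.
  exact: measurable_power_spectrum.
have F0 k q : (0 <= F k q)%E by rewrite lee_fin mulr_ge0 ?abel_ge0 ?power_spectrum_ge0.
have fin_sq : sqnorm f \is a fin_num by rewrite ge0_fin_numE// sqnorm_ge0.
apply/eqP; rewrite eq_le; apply/andP; split.
- have ndF (q : RR) : setT q -> {homo F ^~ q : n m / (n <= m)%N >-> (n <= m)%E}.
    move=> _ n m nm; rewrite lee_fin ler_wpM2r ?power_spectrum_ge0//.
    rewrite ler_expR lerN2 ler_wpM2r// lef_pV2 ?posrE//.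
    by rewrite ler_nat.
  have := @cvg_monotone_convergence _ _ _ mu setT measurableT F mF (fun k q _ => F0 k q) ndF.
  have -> : (fun q : RR => limn (F ^~ q)) = (fun q => (power_spectrum q)%:E).
    apply/funext => q; apply/cvg_lim => //; apply: cvg_EFin; first exact: nearW.
    rewrite -[X in _ --> X]mul1r; apply: cvgMl.
    rewrite -expR0; apply: (@cvg_comp _ _ _ (fun k => - (a k * `|q|)) (@expR R)
      _ (nbhs (0 : R))); last exact: continuous_expR.
    rewrite -oppr0; apply: cvgN; rewrite -(mul0r `|q|); apply: cvgMl.
    exact: cvg_harmonic.
  move=> h; have <- := cvg_lim (@ereal_hausdorff R) h.
  apply: lime_le; first by apply/cvg_ex; eexists; exact: h.
  apply: nearW => k.
  have := spectrum_defect (a0 k) => E.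
  rewrite -(@lee_pmul2l _ 2%:E)// -E leeDl// defect_ge0//.
- apply/lee_addgt0Pr => e e0.
  have e2 : 0 < 2 * e by rewrite mulr_gt0.
  have [_ /(_ _ e2) [n _ /(_ n (leqnn n)) /= h]] := vanishing_defect_L2 mf sqf.
  have I0 : (0 <= \int[mu]_q (power_spectrum q)%:E)%E.
    by apply: integral_ge0 => q _; rewrite lee_fin power_spectrum_ge0.
  rewrite -(@lee_pmul2l _ 2%:E)// [leRHS]ge0_muleDr ?lee_fin ?(ltW e0)//.
  rewrite -[leLHS](spectrum_defect (a0 n)); apply: leeD => //.
  rewrite lee_pmul2l//; apply: ge0_le_integral => //.
  + by move=> q _; exact: F0.
  + exact: mF.
  + by apply/measurable_EFinP; exact: measurable_power_spectrum.
  + move=> q _; rewrite lee_fin ler_piMl ?power_spectrum_ge0//.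
    by rewrite -expR0 ler_expR oppr_le0 mulr_ge0// ltW.
Qed.

End real_plancherel.

Section line_plancherel.
Context {R : realType}.
Local Notation mu := (@lebesgue_measure R).
Local Notation RR := (measurableTypeR R).
Local Notation Re := (@complex.Re R).
Local Notation Im := (@complex.Im R).

Lemma cos_transformN (f : RR -> R) q : cos_transform f (- q) = cos_transform f q.
Proof. by apply: eq_Rintegral => x _; rewrite mulrN mulNr cosN. Qed.

Lemma sin_transformN (f : RR -> R) q : mu.-integrable setT (EFin \o f) ->
  sin_transform f (- q) = - sin_transform f q.
Proof.
move=> intf; rewrite /sin_transform -[RHS]mulN1r -RintegralZl//.
  by apply: eq_Rintegral => x _; rewrite mulrN mulNr sinN; ring.
apply: integrable_bounded_mul => //.
- apply: (@measurableT_comp _ _ _ _ _ _ (@sin R)).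
    by apply: continuous_measurable_fun; exact: continuous_sin.
  by apply: measurable_funM.
- by move=> x; rewrite ler_norml sin_geN1 sin_le1.
Qed.

(* The cross terms between the real and imaginary parts are odd in the
   frequency, hence disappear once [q] and [-q] are averaged. *)
Lemma plancherel_line : plancherel mu (fun q x : RR => (q : R) * (x : R)).
Proof.
have mphi : measurable_fun setT (fun qx : RR * RR => (qx.1 : R) * (qx.2 : R)).
  by apply: measurable_funM.
split=> // h ih Lh; have [mf mg] := Lh.1.
set f := Re \o h; set g := Im \o h.
have [intf intg] : mu.-integrable setT (EFin \o f) /\ mu.-integrable setT (EFin \o g) := ih.
have [_ Nh] := (L2P mu h).1 Lh.
have mf2 : measurable_fun setT (fun x => (f x ^+ 2)%:E) by apply/measurable_EFinP/measurable_funX.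
have mg2 : measurable_fun setT (fun x => (g x ^+ 2)%:E) by apply/measurable_EFinP/measurable_funX.
have NE : N2 mu h = (sqnorm f + sqnorm g)%E.
  rewrite /sqnorm -ge0_integralD//.
  - by move=> x _; rewrite lee_fin sqr_ge0.
  - by move=> x _; rewrite lee_fin sqr_ge0.
have sqf : (sqnorm f < +oo)%E.
  by apply: le_lt_trans Nh; rewrite NE leeDl// sqnorm_ge0.
have sqg : (sqnorm g < +oo)%E.
  by apply: le_lt_trans Nh; rewrite NE leeDr// sqnorm_ge0.
set F := phase_transform _ _ h.
have mF : cmeasurable F by exact: cmeasurable_phase_transform.
have icos (k : RR -> R) (q : R) : mu.-integrable setT (EFin \o k) ->
    mu.-integrable setT (EFin \o (fun x : RR => k x * cos (2 * pi * q * (x : R)))).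
  move=> ik; apply: integrable_bounded_mul => //.
  - apply: (@measurableT_comp _ _ _ _ _ _ (@cos R)); last by apply: measurable_funM.
    by apply: continuous_measurable_fun; exact: continuous_cos.
  - by move=> x; rewrite ler_norml cos_geN1 cos_le1.
have isin (k : RR -> R) (q : R) : mu.-integrable setT (EFin \o k) ->
    mu.-integrable setT (EFin \o (fun x : RR => k x * sin (2 * pi * q * (x : R)))).
  move=> ik; apply: integrable_bounded_mul => //.
  - apply: (@measurableT_comp _ _ _ _ _ _ (@sin R)); last by apply: measurable_funM.
    by apply: continuous_measurable_fun; exact: continuous_sin.
  - by move=> x; rewrite ler_norml sin_geN1 sin_le1.
have FRe q : Re (F q) = cos_transform f q + sin_transform g q.
  rewrite /cos_transform /sin_transform -RintegralD//; [|exact: icos|exact: isin].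
  by apply: eq_Rintegral => x _; rewrite cReM /= cosN sinN mulrN opprK !mulrA.
have FIm q : Im (F q) = cos_transform g q - sin_transform f q.
  rewrite /cos_transform /sin_transform -RintegralB//; [|exact: icos|exact: isin].
  by apply: eq_Rintegral => x _; rewrite cImM /= cosN sinN mulrN addrC !mulrA.
have Fsym q : nsq (F q) + nsq (F (- q)) = 2 * (power_spectrum f q + power_spectrum g q).
  rewrite /nsq !FRe !FIm !cos_transformN !sin_transformN// /power_spectrum.
  by ring.
clearbody F.
have mnF := measurable_Ensq mF.
have NF : N2 mu F = (\int[mu]_q (nsq (F (- q)))%:E)%E.
  by apply: (preserves_opp.2 _ mnF) => x; rewrite lee_fin nsq_ge0.
have mK (k : RR -> R) : mu.-integrable setT (EFin \o k) -> measurable_fun [set: RR] (fun q => (power_spectrum k q)%:E).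
  by move=> ik; apply/measurable_EFinP; exact: (measurable_power_spectrum ik).
have K0 (k : RR -> R) q : (0 <= (power_spectrum k q)%:E)%E by rewrite lee_fin power_spectrum_ge0.
have nF0 q : (0 <= (nsq (F q))%:E)%E by rewrite lee_fin nsq_ge0.
have mnFN : measurable_fun [set: RR] (fun q : RR => (nsq (F (- (q : R))))%:E).
  exact: (measurableT_comp mnF (@oppr_measurable R setT)).
have E1 : (\int[mu]_q ((nsq (F q))%:E + (nsq (F (- q)))%:E) = 2%:E * N2 mu F)%E.
  rewrite (ge0_integralD mu measurableT (fun q _ => nF0 q) mnF (fun q _ => nF0 (- q)) mnFN).
  by rewrite -NF mule_natl mule2n.
have E2 : (\int[mu]_q ((power_spectrum f q)%:E + (power_spectrum g q)%:E) = N2 mu h)%E.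
  rewrite (ge0_integralD mu measurableT (fun q _ => K0 f q) (mK f intf)
    (fun q _ => K0 g q) (mK g intg)).
  by rewrite (real_plancherel intf sqf) (real_plancherel intg sqg) -NE.
have E : (2%:E * N2 mu F = 2%:E * N2 mu h)%E.
  rewrite -E1 -[in RHS]E2 -[RHS]ge0_integralZl_EFin//.
  - by apply: eq_integral => q _; rewrite -EFinD Fsym EFinM EFinD.
  - by move=> q _; rewrite adde_ge0.
  - by apply: emeasurable_funD; [exact: mK|exact: mK].
apply/eqP; rewrite eq_le; apply/andP; split.
- by rewrite -(@lee_pmul2l _ 2%:E)// E.
- by rewrite -(@lee_pmul2l _ 2%:E)// E.
Qed.

End line_plancherel.

(** * The Fourier transform on L^2 *)

Section riesz_fischer.
Context d (T : measurableType d) {R : realType}.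
Variable mu : {measure set T -> \bar R}.
Local Notation Re := (@complex.Re R).
Local Notation Im := (@complex.Im R).

(** Chosen so that [4 ^+ k * rate k] is [2^-(k + 1)], a series of sum 1. *)
Let rate (k : nat) : R := (2 * 8 ^+ k)^-1.

Let rate_gt0 k : 0 < rate k.
Proof. by rewrite invr_gt0 mulr_gt0// exprn_gt0. Qed.

Lemma limn_einf_le_cst (u : (\bar R)^nat) (c : \bar R) :
  (forall n, (u n <= c)%E) -> (limn_einf u <= c)%E.
Proof.
move=> uc; rewrite limn_einf_lim; apply: lime_le; first exact: is_cvg_einfs.
apply: nearW => n; apply: le_trans (uc n).
by apply: ereal_inf_lbound; exists n => /=.
Qed.

Lemma cvg_of_geometric_telescope (r : nat -> R) (s : R) :
  (forall k, `|r k.+1 - r k| <= s * 2^-1 ^+ k) -> cvgn r.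
Proof.
move=> rs; have s0 : 0 <= s.
  by have := rs 0%N; rewrite expr0 mulr1; apply: le_trans.
have cg : cvgn (series (geometric s 2^-1)).
  by apply: is_cvg_geometric_series; rewrite gtr0_norm// invf_lt1// ltr1n.
have cn : cvgn [normed series (telescope r)].
  apply: (series_le_cvg _ _ _ cg) => k //=.
  - by rewrite mulr_ge0// exprn_ge0.
  - exact: rs.
have /cvg_ex[l rl] := normed_cvg cn.
apply/cvg_ex; exists (r 0%N + l).
have rE : (fun n => r 0%N + series (telescope r) n) = r.
  by apply/funext => n; rewrite -eq_sum_telescope.
rewrite -[X in X n @[n --> \oo]]rE.
by apply: cvgD => //; exact: cvg_cst.
Qed.

(** The squared increments weighted by [4 ^+ k] sum to a function [G] of integral at most 1, hence
    finite almost everywhere. There the increments are at most [sqrt (G x) / 2 ^+ k], so the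
    sequence converges without passing to a subsequence. *)
Lemma riesz_fischer_real (r : nat -> T -> R) :
  (forall k, measurable_fun setT (r k)) ->
  (forall k m, (k <= m)%N -> (\int[mu]_x ((r m x - r k x) ^+ 2)%:E <= (rate k)%:E)%E) ->
  exists2 v : T -> R, measurable_fun setT v &
    forall k, (\int[mu]_x ((v x - r k x) ^+ 2)%:E <= (rate k)%:E)%E.
Proof.
move=> mr rr.
pose b k x := (4 ^+ k * (r k.+1 x - r k x) ^+ 2)%:E.
have mdiff k m : measurable_fun setT (fun x => ((r m x - r k x) ^+ 2)%:E).
  by apply/measurable_EFinP; apply: measurable_funX; exact: measurable_funB.
have b0 k x : (0 <= b k x)%E by rewrite lee_fin mulr_ge0// ?sqr_ge0// exprn_ge0.
have mb k : measurable_fun setT (b k).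
  apply/measurable_EFinP; apply: measurable_funM => //.
  by apply: measurable_funX; exact: measurable_funB.
pose G x := (\sum_(0 <= k <oo) b k x)%E.
have G0 x : (0 <= G x)%E by apply: nneseries_ge0.
have mG : measurable_fun setT G by apply: ge0_emeasurable_sum.
have intG : (\int[mu]_x G x <= 1)%E.
  rewrite /G integral_nneseries//.
  have half := @cvg_geometric_eseries_half R 1 0.
  rewrite (_ : 1%E = (1 / 2 ^+ 0)%:E); last by rewrite expr0 divr1.
  rewrite -(cvg_lim _ half)//; apply: lee_nneseries => k _; first by move=> _; exact: integral_ge0.
  rewrite /b; under eq_integral do rewrite EFinM.
  rewrite ge0_integralZl_EFin ?exprn_ge0//; last by move=> x _; rewrite lee_fin sqr_ge0.
  rewrite (@le_trans _ _ ((4 ^+ k)%:E * (rate k)%:E)%E)//.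
    by rewrite lee_wpmul2l// ?lee_fin ?exprn_ge0// rr.
  rewrite -EFinM lee_fin /rate natrX addn1 exprS.
  have -> : (8 : R) ^+ k = 4 ^+ k * 2 ^+ k by rewrite -exprMn -natrM.
  have n4 : 4 ^+ k != 0 :> R by rewrite expf_neq0.
  have n2 : 2 ^+ k != 0 :> R by rewrite expf_neq0.
  move: (4 ^+ k) (2 ^+ k) n4 n2 => p q p0 q0.
  by rewrite le_eqVlt; apply/orP; left; apply/eqP; field; rewrite p0 q0.
have iG : mu.-integrable setT G.
  apply/integrableP; split=> //.
  by under eq_integral do rewrite gee0_abs//; rewrite (le_lt_trans intG)// ltry.
have cvr : {ae mu, forall x, cvgn (r ^~ x)}.
  apply: filterS (integrable_ae measurableT iG) => x /(_ I) Gx.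
  apply: (@cvg_of_geometric_telescope _ (Num.sqrt (fine (G x)))) => k.
  have bG : 4 ^+ k * (r k.+1 x - r k x) ^+ 2 <= fine (G x).
    rewrite -lee_fin fineK//; apply: le_trans (nneseries_lim_ge k.+1 _) => //.
    by rewrite big_nat_recr//= leeDr// sume_ge0.
  rewrite -(@ler_pM2l _ (2 ^+ k)) ?exprn_gt0// mulrCA -exprMn divff// expr1n mulr1.
  rewrite -[leLHS]ger0_norm ?mulr_ge0 ?exprn_ge0// -sqrtr_sqr ler_sqrt ?fine_ge0//.
  rewrite exprMn real_normK ?num_real// -exprM mulnC exprM.
  by rewrite (_ : 2 ^+ 2 = 4 :> R)//; rewrite -natrX.
(* The upper limit is measurable on the whole space and equals the limit wherever there is one, so
   nothing has to be redefined on the null set of divergence. *)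
pose v x := fine (limn_esup (fun k => (r k x)%:E)).
have mv : measurable_fun setT v.
  apply: (measurableT_comp (fine_measurable measurableT)).
  by apply: measurable_fun_limn_esup => k; exact/measurable_EFinP.
have vr x : cvgn (r ^~ x) -> r k x @[k --> \oo] --> v x.
  move=> /cvg_ex[l rl]; rewrite /v.
  have rlE : (r k x)%:E @[k --> \oo] --> l%:E by apply: cvg_EFin => //; exact: nearW.
  by rewrite (cvg_limn_einf_sup rlE).2.
exists v => // k.
have mvk : measurable_fun setT (fun x => ((v x - r k x) ^+ 2)%:E).
  by apply/measurable_EFinP; apply: measurable_funX; exact: measurable_funB.
(* Fatou's lemma carries the rate to the limit; shifting by [k] keeps all indices [m + k] in the
   range of the hypothesis. *)
apply: (@le_trans _ _ (\int[mu]_x limn_einf (fun m => ((r (m + k)%N x - r k x) ^+ 2)%:E))%E).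
  apply: ae_ge0_le_integral => //.
  - by move=> x _; rewrite lee_fin sqr_ge0.
  - move=> x _; rewrite limn_einf_lim; apply: lime_ge; first exact: is_cvg_einfs.
    by apply: nearW => m; apply: le_ereal_inf_tmp => _ [j /= _ <-]; rewrite lee_fin sqr_ge0.
  - rewrite (_ : (fun x => _) = (fun x => - limn_esup
      (fun m => - ((r (m + k)%N x - r k x) ^+ 2)%:E))%E); last first.
      by apply/funext => x; rewrite -limn_einfN; congr limn_einf; apply/funext => m /=; rewrite opprK.
    apply: measurableT_comp => //; apply: measurable_fun_limn_esup => m.
    exact: measurableT_comp.
  - apply: filterS cvr => x /vr rv _.
    suff h : ((r (m + k)%N x - r k x) ^+ 2)%:E @[m --> \oo] --> ((v x - r k x) ^+ 2)%:E.
      by rewrite (cvg_limn_einf_sup h).1.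
    apply: cvg_EFin; first exact: nearW.
    have h : r (m + k)%N x - r k x @[m --> \oo] --> v x - r k x.
      apply: cvgB; last exact: cvg_cst.
      by rewrite (cvg_shiftn k (r ^~ x)).
    by rewrite expr2; apply: cvgM.
apply: (le_trans (fatou mu measurableT _ _)).
- by move=> m; exact: mdiff.
- by move=> m x _; rewrite lee_fin sqr_ge0.
by apply: limn_einf_le_cst => m; apply: rr; rewrite leq_addl.
Qed.

Lemma riesz_fischer (u : nat -> T -> R[i]) :
  (forall k, cmeasurable (u k)) ->
  (forall k m, (k <= m)%N -> (N2 mu (fun x => u m x - u k x)%R <= (rate k)%:E)%E) ->
  exists2 v : T -> R[i], cmeasurable v &
    forall k, (N2 mu (fun x => u k x - v x)%R <= (2 * rate k)%:E)%E.
Proof.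
move=> mu_ uu.
have [a ma av] : exists2 v : T -> R, measurable_fun setT v &
    forall k, (\int[mu]_x ((v x - Re (u k x)) ^+ 2)%:E <= (rate k)%:E)%E.
  apply: riesz_fischer_real => [k|k m km]; first exact: (mu_ k).1.
  apply: le_trans (uu _ _ km); apply: ge0_le_integral => //.
  - by move=> x _; rewrite lee_fin sqr_ge0.
  - apply/measurable_EFinP; apply: measurable_funX.
    by apply: measurable_funB; [exact: (mu_ m).1|exact: (mu_ k).1].
  - by apply: measurable_Ensq; exact: cmeasurableB.
  - by move=> x _; rewrite lee_fin /nsq !ReImE lerDl sqr_ge0.
have [b mb bv] : exists2 v : T -> R, measurable_fun setT v &
    forall k, (\int[mu]_x ((v x - Im (u k x)) ^+ 2)%:E <= (rate k)%:E)%E.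
  apply: riesz_fischer_real => [k|k m km]; first exact: (mu_ k).2.
  apply: le_trans (uu _ _ km); apply: ge0_le_integral => //.
  - by move=> x _; rewrite lee_fin sqr_ge0.
  - apply/measurable_EFinP; apply: measurable_funX.
    by apply: measurable_funB; [exact: (mu_ m).2|exact: (mu_ k).2].
  - by apply: measurable_Ensq; exact: cmeasurableB.
  - by move=> x _; rewrite lee_fin /nsq !ReImE lerDr sqr_ge0.
exists (fun x => a x +i* b x)%C => [|k]; first by split.
have -> : N2 mu (fun x => u k x - (a x +i* b x)%C) =
    (\int[mu]_x ((a x - Re (u k x)) ^+ 2)%:E + \int[mu]_x ((b x - Im (u k x)) ^+ 2)%:E)%E.
  rewrite -ge0_integralD//.
  - by apply: eq_integral => x _; rewrite -EFinD /nsq !ReImE /=; congr EFin; ring.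
  - by move=> x _; rewrite lee_fin sqr_ge0.
  - apply/measurable_EFinP; apply: measurable_funX; apply: measurable_funB => //.
    exact: (mu_ k).1.
  - by move=> x _; rewrite lee_fin sqr_ge0.
  - apply/measurable_EFinP; apply: measurable_funX; apply: measurable_funB => //.
    exact: (mu_ k).2.
by rewrite mulr_natl mulr2n EFinD leeD.
Qed.

End riesz_fischer.

(** * Convergence in norm and truncation *)

Section L2_convergence.
Context d (T : measurableType d) {R : realType}.
Variable mu : {measure set T -> \bar R}.
Implicit Types (f g : T -> R[i]).

Lemma L2norm_le f (e : R) : 0 <= e -> (N2 mu f <= (e ^+ 2)%:E)%E ->
  (L2norm mu f <= e%:E)%E.
Proof.
move=> e0 Nf; rewrite L2normE.
have -> : e%:E = ((e ^+ 2)%:E `^ 2^-1)%E.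
  rewrite poweR_EFin; congr EFin; rewrite -powR_mulrn// -powRrM mulfV ?pnatr_eq0//.
  by rewrite powRr1.
apply: gt0_ler_poweR => //.
- by rewrite in_itv/= leey andbT N2_ge0.
- by rewrite in_itv/= leey andbT lee_fin sqr_ge0.
Qed.

Lemma cvg0_near_le (X : nat -> \bar R) : (forall k, 0 <= X k)%E ->
  (forall e : R, 0 < e -> \forall k \near \oo, (X k <= e%:E)%E) ->
  X k @[k --> \oo] --> 0%E.
Proof.
move=> X0 Xe; apply/fine_cvgP; split.
  apply: filterS (Xe 1 ltr01) => k Xk.
  by rewrite ge0_fin_numE// (le_lt_trans Xk)// ltry.
apply/cvgr0Pnorm_le => e e0; apply: filterS (Xe _ e0) => k Xk /=.
have Xfin : X k \is a fin_num by rewrite ge0_fin_numE// (le_lt_trans Xk)// ltry.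
by rewrite ger0_norm ?fine_ge0// -lee_fin fineK.
Qed.

Lemma L2norm_eqN2 f g : N2 mu f = N2 mu g -> L2norm mu f = L2norm mu g.
Proof. by rewrite !L2normE => ->. Qed.

Lemma L2norm_distC f g :
  L2norm mu (fun x => f x - g x) = L2norm mu (fun x => g x - f x).
Proof.
apply: L2norm_eqN2; apply: eq_integral => x _; congr EFin.
by rewrite /nsq !ReImE; ring.
Qed.

Lemma L2norm_le_dist f g : cmeasurable f -> cmeasurable g ->
  (L2norm mu f <= L2norm mu (fun x => f x - g x)%R + L2norm mu g)%E.
Proof.
move=> mf mg; apply: le_trans (L2norm_triangle _ (cmeasurableB mf mg) mg).
by rewrite (_ : (fun x => f x - g x + g x) = f)//; apply/funext => x; rewrite subrK.
Qed.

Definition ctruncate f (A : set T) : T -> R[i] := fun x => f x * (\1_A x)%:C%C.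

Let nsq_indic (A : set T) x : nsq (\1_A x)%:C%C = \1_A x :> R.
Proof. by rewrite /nsq /= expr0n addr0 indicE; case: (_ \in _); rewrite ?expr1n ?expr0n. Qed.

Lemma cmeasurable_truncate f A : measurable A -> cmeasurable f ->
  cmeasurable (ctruncate f A).
Proof.
move=> mA mf; apply: cmeasurableM => //; split; first exact: measurable_indic.
exact: measurable_cst.
Qed.

Lemma L2_truncate f A : measurable A -> L2 mu f -> L2 mu (ctruncate f A).
Proof.
move=> mA Lf; have [mf Nf] := (L2P _ _).1 Lf; apply/L2P.
have mt := cmeasurable_truncate mA mf; split=> //.
apply: le_lt_trans Nf; apply: le_N2 => // x; rewrite nsqM nsq_indic.
by rewrite ler_piMr ?nsq_ge0// indicE; case: (_ \in _).
Qed.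

(** On a set of finite measure [|t| <= t^2 + 1] turns square-integrability into integrability. *)
Lemma cintegrable_truncate f A : measurable A -> (mu A < +oo)%E -> L2 mu f ->
  cintegrable mu (ctruncate f A).
Proof.
move=> mA Ay Lf; have [mf Nf] := (L2P _ _).1 Lf.
have b (a c : R) (k : bool) : `|a * k%:R| <= a ^+ 2 + c ^+ 2 + k%:R /\
    `|c * k%:R| <= a ^+ 2 + c ^+ 2 + k%:R.
  case: k; rewrite /= ?mulr1 ?mulr0 ?normr0 ?addr0 ?addr_ge0 ?sqr_ge0// !ler_norml.
  by split; apply/andP; split; have := sqr_ge0 (a - 1); have := sqr_ge0 (a + 1);
    have := sqr_ge0 (c - 1); have := sqr_ge0 (c + 1); nra.
apply: (@cintegrable_le _ _ _ _ _ (fun x => nsq (f x) + \1_A x)).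
- exact: cmeasurable_truncate.
- move=> x; rewrite /ctruncate !ReImE /= mulr0 subr0 indicE.
  by have [] := b (complex.Re (f x)) (complex.Im (f x)) (x \in A).
- move=> x; rewrite /ctruncate !ReImE /= mulr0 add0r indicE.
  by have [] := b (complex.Re (f x)) (complex.Im (f x)) (x \in A).
- rewrite (_ : _ \o _ = (fun x => (nsq (f x))%:E) \+ (EFin \o \1_A))%E//.
  apply: integrableD => //; first exact: integrable_nsq.
  apply/integrableP; split; first by apply/measurable_EFinP; exact: measurable_indic.
  under eq_integral do rewrite gee0_abs ?lee_fin//.
  by rewrite integral_indic// setIT.
Qed.

(** Pointwise the error vanishes from some index on, and it is dominated by the squared modulus of
    [f]. *)
Lemma near_N2_truncate f (F : nat -> set T) (e : R) :
  {homo F : m n / (m <= n)%N >-> (m <= n)%O} -> (forall i, measurable (F i)) ->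
  \bigcup_i F i = setT -> L2 mu f -> 0 < e ->
  \forall k \near \oo, (N2 mu (fun x => ctruncate f (F k) x - f x)%R <= e%:E)%E.
Proof.
move=> ndF mF FT Lf e0; have [mf Nf] := (L2P _ _).1 Lf.
have nsqE k x : nsq (ctruncate f (F k) x - f x) = nsq (f x) * (1 - \1_(F k) x).
  rewrite -[X in _ - X]mulr1 -mulrBr nsqM; congr (_ * _).
  rewrite /nsq !ReImE /= subrr expr0n addr0 indicE.
  by case: (_ \in _); rewrite ?subrr ?expr0n// sub0r subr0 sqrrN expr1n.
have [|||||_ _] := @dominated_convergence _ _ _ mu setT measurableT
   (fun k x => (nsq (ctruncate f (F k) x - f x))%:E) (fun=> 0%E) (fun x => (nsq (f x))%:E).
- move=> k; apply: measurable_Ensq; apply: cmeasurableB => //.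
  exact: cmeasurable_truncate.
- exact: measurable_cst.
- apply: aeW => x _; apply: cvg_near_cst.
  have [i _ Fix] : (\bigcup_i F i) x by rewrite FT.
  exists i => // k /= ik; rewrite nsqE indicE mem_set ?subrr ?mulr0//.
  by move: x Fix; apply/subsetPset; exact: ndF.
- exact: integrable_nsq.
- apply: aeW => x k _; rewrite gee0_abs lee_fin ?nsq_ge0// nsqE.
  rewrite ler_piMr ?nsq_ge0// indicE; case: (_ \in _); by rewrite ?subrr ?subr0.
by rewrite integral0 => /near_le_cvg0 /(_ e0).
Qed.

End L2_convergence.


(** * Extension of the Fourier integral by density *)

Section fourier_L2.
Context {R : realType} {n : nat}.
Local Notation H := (heis R n).
Local Notation mu := (@lebesgue_heis R n).
Implicit Types (f g h u v : H -> R[i]).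

Let pl : plancherel mu (@hdot R n) := plancherel_heis plancherel_line.

Lemma cmeasurable_fourier_integral h : cmeasurable h -> cmeasurable (fourier_integral h).
Proof. exact: (cmeasurable_phase_transform mu pl.1). Qed.

Lemma N2_fourier_integral h : cintegrable mu h -> L2 mu h ->
  N2 mu (fourier_integral h) = N2 mu h.
Proof. exact: pl.2. Qed.

Lemma L2_fourier_integral h : cintegrable mu h -> L2 mu h -> L2 mu (fourier_integral h).
Proof.
move=> ih Lh; apply/L2P; split; first exact: cmeasurable_fourier_integral Lh.1.
by rewrite N2_fourier_integral//; have [] := (L2P _ _).1 Lh.
Qed.

Let integrand h Q : cintegrable mu h ->
  cintegrable mu (fun X => h X * cis (- (2 * pi * hdot Q X))).
Proof. by move=> ih; exact: (cintegrable_phase pl.1). Qed.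

Lemma fourier_integralD f g : cintegrable mu f -> cintegrable mu g ->
  fourier_integral (fun x => f x + g x) = (fun Q => fourier_integral f Q + fourier_integral g Q).
Proof.
move=> intf intg; apply/funext => Q; rewrite /fourier_integral.
under eq_fun do rewrite mulrDl.
by rewrite cintegralD//; exact: integrand.
Qed.

Lemma fourier_integralZ c f : cintegrable mu f ->
  fourier_integral (fun x => c * f x) = (fun Q => c * fourier_integral f Q).
Proof.
move=> intf; apply/funext => Q; rewrite /fourier_integral.
under eq_fun do rewrite -mulrA.
by rewrite cintegralZl//; exact: integrand.
Qed.

Lemma fourier_integralB f g : cintegrable mu f -> cintegrable mu g ->
  fourier_integral (fun x => f x - g x) = (fun Q => fourier_integral f Q - fourier_integral g Q).
Proof.
move=> intf intg.
rewrite (_ : (fun x => f x - g x) = (fun x => f x + (-1) * g x)); last first.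
  by apply/funext => x; rewrite mulN1r.
rewrite fourier_integralD//; last exact: cintegrableZl.
by rewrite fourier_integralZ//; apply/funext => Q; rewrite mulN1r.
Qed.

(** Truncations to sets of finite measure are both integrable and square-integrable. By Plancherel's
    formula their transforms approach each other at the rate of the truncations, taken fast enough
    for [riesz_fischer]. *)
Lemma fourier_exists h : L2 mu h -> exists u, is_fourier h u.
Proof.
move=> Lh; have mh := Lh.1.
have [F [FT ndF Foo]] := (sigma_finiteP _ _).1 (sigma_finiteT mu).
have mF i : measurable (F i) := (Foo i).1.
pose rate k : R := (2 * 8 ^+ k)^-1.
have rate_gt0 k : 0 < rate k by rewrite invr_gt0 mulr_gt0// exprn_gt0.
(* With errors [rate m / 4] and [rate k / 4], the factor 2 in [N2D_le] gives at most [rate k]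
   between truncations [k <= m]. *)
have ex k : exists j, (N2 mu (fun x => ctruncate h (F j) x - h x)%R <= (rate k / 4)%:E)%E.
  have r4 : 0 < rate k / 4 by rewrite divr_gt0.
  have [j _ /(_ j (leqnn j)) hj] := near_N2_truncate ndF mF (esym FT) Lh r4.
  by exists j.
have [s sP] := choice ex.
pose hk k := ctruncate h (F (s k)).
have ihk k : cintegrable mu (hk k) by exact: cintegrable_truncate (Foo _).2 Lh.
have Lhk k : L2 mu (hk k) by exact: L2_truncate.
have mhk k : cmeasurable (hk k) := (Lhk k).1.
have rate_le k m : (k <= m)%N -> rate m <= rate k.
  move=> km; rewrite lef_pV2 ?posrE ?mulr_gt0 ?exprn_gt0// ler_pM2l//.
  by rewrite ler_weXn2l// ler1n.
have diff k m : (k <= m)%N ->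
    (N2 mu (fun x => fourier_integral (hk m) x - fourier_integral (hk k) x)%R <= (rate k)%:E)%E.
  move=> km; rewrite -fourier_integralB// N2_fourier_integral; last 2 first.
  - rewrite (_ : (fun x => hk m x - hk k x) = (fun x => hk m x + (-1) * hk k x)).
      exact: (cintegrableD (ihk m) (cintegrableZl (-1) (ihk k))).
    by apply/funext => x; rewrite mulN1r.
  - exact: (L2B (Lhk m) (Lhk k)).
  have -> : (fun x => hk m x - hk k x) = (fun x => (hk m x - h x) + (-1) * (hk k x - h x)).
    by apply/funext => x; ring.
  rewrite (le_trans (N2D_le _ _ _))//; first exact: cmeasurableB.
    by apply: cmeasurableM; [exact: cmeasurable_cst|exact: cmeasurableB].
  rewrite N2Zl; last exact: cmeasurableB.
  have -> : nsq (-1 : R[i]) = 1 by rewrite /nsq /= oppr0 expr0n addr0 sqrrN expr1n.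
  rewrite mul1e (@le_trans _ _ (2%:E * (rate m / 4)%:E + 2%:E * (rate k / 4)%:E)%E)//.
    by rewrite leeD// lee_pmul2l// sP.
  by rewrite -!EFinM -EFinD lee_fin; have := rate_le _ _ km; lra.
have [u mu_ uP] := riesz_fischer (fun k => cmeasurable_fourier_integral (mhk k)) diff.
have Nsmall (w : nat -> H -> R[i]) : (forall k, (N2 mu (w k) <= (2 * rate k)%:E)%E) ->
    L2norm mu (w k) @[k --> \oo] --> 0%E.
  move=> wP; apply: cvg0_near_le => [k|e e0]; first exact: L2norm_ge0.
  have h0 : (fun k => 8^-1 ^+ k : R) @ \oo --> (0 : R).
    by apply: cvg_expr; rewrite gtr0_norm// invf_lt1// ltr1n.
  have e2 : 0 < e ^+ 2 by rewrite exprn_gt0.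
  have h8 : \forall k \near \oo, `|8^-1 ^+ k : R| <= e ^+ 2 by exact: cvgr0_norm_le.
  apply: filterS h8 => k hk_le.
  apply: L2norm_le; first exact: ltW.
  apply: le_trans (wP k) _; rewrite lee_fin /rate invfM mulrA mulfV// mul1r.
  by rewrite -exprVn; apply: le_trans hk_le; exact: ler_norm.
exists u; split.
- apply/L2P; split=> //.
  have m0 := cmeasurable_fourier_integral (mhk 0%N).
  have L0 := L2_fourier_integral (ihk 0%N) (Lhk 0%N).
  have -> : u = (fun x => fourier_integral (hk 0%N) x +
      (-1) * (fourier_integral (hk 0%N) x - u x)) by apply/funext => x; ring.
  have LB : L2 mu (fun x => fourier_integral (hk 0%N) x - u x).
    apply/L2P; split; first exact: cmeasurableB.
    by apply: le_lt_trans (uP 0%N) _; rewrite ltry.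
  by have [] := (L2P _ _).1 (L2D L0 (L2Zl (-1) LB)).
- exists hk; split=> //.
  + apply: Nsmall => k; apply: le_trans (sP k) _; rewrite lee_fin.
    by have := rate_gt0 k; lra.
  + exact: Nsmall.
Qed.

Lemma fourierP h : L2 mu h -> is_fourier h (fourier h).
Proof. by move=> /fourier_exists[u hu]; exact: (xgetPex _ (ex_intro _ u hu)). Qed.

Lemma L2_fourier h : L2 mu h -> L2 mu (fourier h).
Proof. by move=> /fourierP []. Qed.

(** Stated for the relation because the representatives chosen by [fourier] for [f], [g] and [f + g]
    need not add up pointwise. *)
Lemma is_fourierD f g u v : L2 mu f -> L2 mu g -> is_fourier f u -> is_fourier g v ->
  is_fourier (fun x => f x + g x) (fun x => u x + v x).
Proof.
move=> Lf Lg [Lu [fk [fP f0 u0]]] [Lv [gk [gP g0 v0]]].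
have sum0 (a b : nat -> \bar R) (c : nat -> \bar R) :
    a k @[k --> \oo] --> 0%E -> b k @[k --> \oo] --> 0%E ->
    (forall k, 0 <= c k)%E -> (forall k, c k <= a k + b k)%E -> c k @[k --> \oo] --> 0%E.
  move=> a0 b0 c0 cab; apply: (@squeeze_cvge _ _ _ _ (fun=> 0%E) _ (fun k => a k + b k)%E).
  - by apply: nearW => k; rewrite c0 cab.
  - exact: cvg_cst.
  - by rewrite -[X in _ --> X]adde0; exact: cvgeD.
split; first exact: L2D.
exists (fun k x => fk k x + gk k x); split.
- move=> k; split; first exact: (cintegrableD (fP k).1 (gP k).1).
  exact: (L2D (fP k).2 (gP k).2).
- apply: (sum0 _ _ _ f0 g0) => k; first exact: L2norm_ge0.
  rewrite (_ : (_ \- _) = (fun x => (fk k x - f x) + (gk k x - g x))).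
    by apply: L2norm_triangle; apply: cmeasurableB => //;
      [exact: (fP k).2.1|exact: Lf.1|exact: (gP k).2.1|exact: Lg.1].
  by apply/funext => x /=; ring.
- apply: (sum0 _ _ _ u0 v0) => k; first exact: L2norm_ge0.
  rewrite fourier_integralD; [|exact: (fP k).1|exact: (gP k).1].
  rewrite (_ : (_ \- _) = (fun x => (fourier_integral (fk k) x - u x) +
      (fourier_integral (gk k) x - v x))).
    have mk := cmeasurable_fourier_integral (fP k).2.1.
    have mk' := cmeasurable_fourier_integral (gP k).2.1.
    by apply: L2norm_triangle; apply: cmeasurableB => //; [exact: Lu.1|exact: Lv.1].
  by apply/funext => x /=; ring.
Qed.

Let nsqi : nsq ('i%C : R[i]) = 1.
Proof. by rewrite /nsq /= expr0n add0r expr1n. Qed.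

Lemma is_fourierZi f u : L2 mu f -> is_fourier f u ->
  is_fourier (fun x => 'i%C * f x) (fun x => 'i%C * u x).
Proof.
move=> Lf [Lu [fk [fP f0 u0]]].
have scale (a b : H -> R[i]) :
    L2norm mu (fun x => 'i%C * a x - 'i%C * b x) = L2norm mu (a \- b).
  apply: L2norm_eqN2; apply: eq_integral => x _; congr EFin.
  by rewrite -mulrBr nsqM nsqi mul1r.
split; first exact: L2Zl.
exists (fun k x => 'i%C * fk k x); split.
- move=> k; split; first exact: (cintegrableZl _ (fP k).1).
  exact: (L2Zl _ (fP k).2).
- rewrite (_ : (fun k => _) = (fun k => L2norm mu (fk k \- f)))//.
  by apply/funext => k; exact: scale.
- rewrite (_ : (fun k => _) =
      (fun k => L2norm mu (fourier_integral (fk k) \- u)))//.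
  apply/funext => k; rewrite fourier_integralZ; last exact: (fP k).1.
  exact: scale.
Qed.

(** Both norms are limits of the same sequence, by Plancherel's formula for the approximants. Any
    [u] in the relation is allowed, so uniqueness of the transform is not called upon. *)
Lemma N2_is_fourier h u : L2 mu h -> is_fourier h u -> N2 mu u = N2 mu h.
Proof.
move=> Lh [Lu [hk [hP h0 u0]]].
have mF k := cmeasurable_fourier_integral (hP k).2.1.
have nF k : L2norm mu (fourier_integral (hk k)) = L2norm mu (hk k).
  by apply: L2norm_eqN2; have [i L] := hP k; exact: N2_fourier_integral.
have e2 (e : R) : 0 < e -> e%:E = ((e / 2)%:E + (e / 2)%:E)%E.
  by move=> _; rewrite -EFinD; congr EFin; field.
suff E : L2norm mu u = L2norm mu h by rewrite -!L2norm_sqr E.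
apply/eqP; rewrite eq_le; apply/andP; split; apply/lee_addgt0Pr => e e0;
  have e20 : 0 < e / 2 by rewrite divr_gt0.
- have [k hk_le uk_le] : exists2 k, (L2norm mu (hk k \- h)%R <= (e / 2)%:E)%E &
      (L2norm mu (fourier_integral (hk k) \- u)%R <= (e / 2)%:E)%E.
    have := filterI (near_le_cvg0 h0 e20) (near_le_cvg0 u0 e20).
    by move=> [k _ /(_ k (leqnn k)) []]; exists k.
  rewrite (le_trans (L2norm_le_dist _ Lu.1 (mF k)))// nF L2norm_distC.
  rewrite (le_trans (leeD2l _ (L2norm_le_dist _ (hP k).2.1 Lh.1)))//.
  by rewrite (e2 _ e0) addeA [leRHS]addeC leeD// leeD.
- have [k hk_le uk_le] : exists2 k, (L2norm mu (hk k \- h)%R <= (e / 2)%:E)%E &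
      (L2norm mu (fourier_integral (hk k) \- u)%R <= (e / 2)%:E)%E.
    have := filterI (near_le_cvg0 h0 e20) (near_le_cvg0 u0 e20).
    by move=> [k _ /(_ k (leqnn k)) []]; exists k.
  rewrite (le_trans (L2norm_le_dist _ Lh.1 (hP k).2.1))// L2norm_distC -nF.
  rewrite (le_trans (leeD2l _ (L2norm_le_dist _ (mF k) Lu.1)))//.
  by rewrite (e2 _ e0) addeA [leRHS]addeC leeD// leeD.
Qed.

(** Polarization on pairs formed by a function and one of its transforms: such pairs can be added
    and multiplied by [i], although [fourier] itself is not linear. The form is the difference of
    the two inner products. *)
Lemma inner_is_fourier f g u v : L2 mu f -> L2 mu g -> is_fourier f u -> is_fourier g v ->
  inner mu u v = inner mu f g.
Proof.
move=> Lf Lg Fu Gv.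
pose P (p : (H -> R[i]) * (H -> R[i])) := L2 mu p.1 /\ is_fourier p.1 p.2.
have PL p : P p -> L2 mu p.2 by move=> [_ []].
pose add (p q : (H -> R[i]) * (H -> R[i])) : (H -> R[i]) * (H -> R[i]) :=
  (fun x => p.1 x + q.1 x, fun x => p.2 x + q.2 x).
pose muli (p : (H -> R[i]) * (H -> R[i])) : (H -> R[i]) * (H -> R[i]) :=
  (fun x => 'i%C * p.1 x, fun x => 'i%C * p.2 x).
suff : inner mu (f, u).2 (g, v).2 - inner mu (f, u).1 (g, v).1 = 0.
  by move=> /= /eqP; rewrite subr_eq0 => /eqP.
apply: (@sesquilinear_eq0 R _ P add muli
  (fun p q => inner mu p.2 q.2 - inner mu p.1 q.1)) => //.
- by move=> x y [Lx Fx] [Ly Fy]; split; [exact: L2D|exact: is_fourierD].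
- by move=> x [Lx Fx]; split; [exact: L2Zl|exact: is_fourierZi].
- move=> x y z Px Py Pz; rewrite /add /= !innerDl//; try exact: PL;
    [|exact: Px.1|exact: Py.1|exact: Pz.1].
  by ring.
- move=> x y z Px Py Pz; rewrite /add /= !innerDr//; try exact: PL;
    [|exact: Px.1|exact: Py.1|exact: Pz.1].
  by ring.
- move=> x y Px Py; rewrite /muli /= !innerZl//; try exact: PL; [|exact: Px.1|exact: Py.1].
  by ring.
- move=> x y Px Py; rewrite /muli /= !innerZr//; try exact: PL; [|exact: Px.1|exact: Py.1].
  have -> : ('i%C : R[i])^*%C = - 'i%C by apply: complexP; rewrite !ReImE /= ?oppr0.
  by ring.
- by move=> x [Lx Fx]; rewrite !innerxx (N2_is_fourier Lx Fx) subrr.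
Qed.

Lemma inner_fourier f g : L2 mu f -> L2 mu g ->
  inner mu (fourier f) (fourier g) = inner mu f g.
Proof. by move=> Lf Lg; apply: inner_is_fourier => //; exact: fourierP. Qed.

Lemma N2_fourier f : L2 mu f -> N2 mu (fourier f) = N2 mu f.
Proof. by move=> Lf; apply: N2_is_fourier => //; exact: fourierP. Qed.

End fourier_L2.

(** * The short-time Fourier transform *)

Section ambiguity.
Context {R : realType} {n : nat}.
Local Notation H := (heis R n).
Local Notation mu := (@lebesgue_heis R n).
Local Notation mu2 := (@lebesgue_heis R n \x @lebesgue_heis R n)%E.
Implicit Types (f g phi psi gamma : H -> R[i]).

(* [stft g f] is [ambiguity (fourier g) (fourier f)]. *)
Definition ambiguity gamma phi : H * H -> R[i] := fun QP =>
  inner mu phi (modulation QP.1 (translation QP.2 gamma)).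

Let pl : plancherel mu (@hdot R n) := plancherel_heis plancherel_line.

Lemma L2_translation P gamma : L2 mu gamma -> L2 mu (translation P gamma).
Proof. by move=> Lg; exact: (preserves_L2 (preserves_hmul_right P) Lg). Qed.

Lemma L2_modulation Q gamma : L2 mu gamma -> L2 mu (modulation Q gamma).
Proof.
move=> /L2P[mg Ng]; apply/L2P; split.
  apply: cmeasurableM => //; apply: cmeasurable_cis; apply: measurable_funM => //.
  exact: (measurableT_comp pl.1 (measurable_pairr Q)).
rewrite (_ : N2 _ _ = N2 mu gamma)//; apply: eq_integral => x _.
by rewrite nsqM nsq_cis mul1r.
Qed.

Let L2_window Q P gamma : L2 mu gamma -> L2 mu (modulation Q (translation P gamma)).
Proof. by move=> Lg; exact/L2_modulation/L2_translation. Qed.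

(** As a product of two square-integrable functions it is integrable for every [P], hence has a
    Fourier integral; it is square-integrable only for almost every [P]. *)
Let product_slice gamma phi P : H -> R[i] :=
  fun X => phi X * (translation P gamma X)^*%C.

Let ambiguityE gamma phi Q P :
  ambiguity gamma phi (Q, P) = fourier_integral (product_slice gamma phi P) Q.
Proof.
congr cintegral; apply/funext => X.
by rewrite /modulation /product_slice /= conjcM -cisN mulrA mulrAC.
Qed.

Section measurability.
Variables gamma phi : H -> R[i].
Hypotheses (Lg : L2 mu gamma) (Lp : L2 mu phi).

Lemma cmeasurable_ambiguity : cmeasurable (ambiguity gamma phi).
Proof.
apply: (@cmeasurable_cintegral_param _ _ _ _ _ mu (fun w : (H * H) * H =>
  phi w.2 * (cis (2 * pi * hdot w.1.1 w.2) * gamma (hmul w.2 w.1.2))^*%C)).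
apply: cmeasurableM; first exact: (cmeasurable_comp measurable_snd Lp.1).
apply: cmeasurableJ; apply: cmeasurableM.
- apply: cmeasurable_cis; apply: measurable_funM => //.
  by apply: measurable_hdot_comp => //; exact: measurableT_comp.
- apply: (cmeasurable_comp _ Lg.1).
  by apply: measurable_hmul_comp => //; exact: measurableT_comp.
Qed.

Let slices (z : H * H) : R[i] := product_slice gamma phi z.2 z.1.

Let mslices : cmeasurable slices.
Proof.
apply: cmeasurableM; first exact: (cmeasurable_comp measurable_fst Lp.1).
by apply: cmeasurableJ; apply: (cmeasurable_comp _ Lg.1); exact: measurable_hmul_comp.
Qed.

(** With [X] fixed, left invariance makes the integral over [P] equal to [N2 mu gamma] whatever [X]
    is, and the two factors separate. *)
Let N2_slices : N2 mu2 slices = (N2 mu phi * N2 mu gamma)%E.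
Proof.
rewrite (N2_tonelliF mu mu mslices).
have mgJ := cmeasurableJ Lg.1.
have E X : N2 mu (fun P => slices (X, P)) = ((nsq (phi X))%:E * N2 mu gamma)%E.
  have NJ : N2 mu gamma = N2 mu (fun P => (gamma P)^*%C).
    by apply: eq_integral => P _; rewrite nsqJ.
  rewrite NJ (preserves_N2 (preserves_hmul_left X) mgJ) -N2Zl//.
  exact: (cmeasurable_comp (preserves_hmul_left X).1 mgJ).
under eq_integral do rewrite E.
rewrite -(fineK (N2_fin_num Lg)) ge0_integralZr//.
- exact: measurable_Ensq Lp.1.
- by move=> x _; rewrite lee_fin nsq_ge0.
- by rewrite lee_fin fine_ge0// N2_ge0.
Qed.

Let L2_slices : L2 mu2 slices.
Proof.
apply/L2P; split=> //; rewrite N2_slices.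
by rewrite -(fineK (N2_fin_num Lg)) -(fineK (N2_fin_num Lp)) -EFinM ltry.
Qed.

(** For almost every [P], Plancherel's formula in [Q] identifies the square norms of the two slices;
    Tonelli reassembles them. *)
Lemma N2_ambiguity : N2 mu2 (ambiguity gamma phi) = (N2 mu phi * N2 mu gamma)%E.
Proof.
have mA := cmeasurable_ambiguity.
rewrite -N2_slices (N2_tonelliG mu mu mA) (N2_tonelliG mu mu mslices).
apply: ae_eq_ge0_integral.
- exact: (measurable_N2G mu mA).
- exact: (measurable_N2G mu mslices).
- by move=> P; exact: N2_ge0.
- by move=> P; exact: N2_ge0.
- apply: filterS (ae_L2G mslices L2_slices) => P LP.
  rewrite -(N2_fourier_integral _ LP).
    by congr N2; apply/funext => Q; exact: ambiguityE.
  exact: (L2_cintegrable Lp (L2_translation P Lg)).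
Qed.

Lemma L2_ambiguity : L2 mu2 (ambiguity gamma phi).
Proof.
apply/L2P; split; first exact: cmeasurable_ambiguity.
by rewrite N2_ambiguity -(fineK (N2_fin_num Lg)) -(fineK (N2_fin_num Lp)) -EFinM ltry.
Qed.

End measurability.

Let conji : ('i%C : R[i])^*%C = - 'i%C.
Proof. by apply: complexP; rewrite !ReImE /= ?oppr0. Qed.

Let conjii : ('i%C : R[i])^*%C^*%C = 'i%C.
Proof. by apply: complexP; rewrite !ReImE /= ?opprK. Qed.

Section linearity.
Variables gamma gamma' phi phi' : H -> R[i].
Hypotheses (Lg : L2 mu gamma) (Lg' : L2 mu gamma') (Lp : L2 mu phi) (Lp' : L2 mu phi').

Lemma ambiguityDr : ambiguity gamma (fun x => phi x + phi' x) =
  (fun z => ambiguity gamma phi z + ambiguity gamma phi' z).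
Proof. by apply/funext => -[Q P]; rewrite /ambiguity innerDl//; exact: L2_window. Qed.

Lemma ambiguityZr c : ambiguity gamma (fun x => c * phi x) =
  (fun z => c * ambiguity gamma phi z).
Proof. by apply/funext => -[Q P]; rewrite /ambiguity innerZl//; exact: L2_window. Qed.

Lemma ambiguityDl : ambiguity (fun x => gamma x + gamma' x) phi =
  (fun z => ambiguity gamma phi z + ambiguity gamma' phi z).
Proof.
apply/funext => -[Q P]; rewrite /ambiguity -innerDr//; [|exact: L2_window..].
by congr inner; apply/funext => X; rewrite /modulation /translation mulrDr.
Qed.

Lemma ambiguityZl c : ambiguity (fun x => c * gamma x) phi =
  (fun z => c^*%C * ambiguity gamma phi z).
Proof.
apply/funext => -[Q P]; rewrite /ambiguity -innerZr//; [|exact: L2_window..].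
by congr inner; apply/funext => X; rewrite /modulation /translation mulrCA.
Qed.

End linearity.

Let form_eq0 (F : (H -> R[i]) -> (H -> R[i]) -> R[i]) :=
  @sesquilinear_eq0 R _ (L2 mu) (fun f g x => f x + g x) (fun f x => 'i%C * f x) F
    (@L2D _ _ _ mu) (L2Zl 'i%C).

Let subMD (a b c d e : R[i]) : a + b - (c + d) * e = (a - c * e) + (b - d * e).
Proof. by ring. Qed.

Let subMZ (u a c e : R[i]) : u * a - u * c * e = u * (a - c * e).
Proof. by ring. Qed.

(** First polarization, with a common window: the diagonal case is [N2_ambiguity]. *)
Let inner_ambiguity_window gamma phi1 phi2 : L2 mu gamma -> L2 mu phi1 -> L2 mu phi2 ->
  inner mu2 (ambiguity gamma phi1) (ambiguity gamma phi2) =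
  inner mu phi1 phi2 * inner mu gamma gamma.
Proof.
move=> Lg Lp1 Lp2; apply/eqP; rewrite -subr_eq0; apply/eqP.
pose F f g := inner mu2 (ambiguity gamma f) (ambiguity gamma g) -
  inner mu f g * inner mu gamma gamma.
have LA f : L2 mu f -> L2 mu2 (ambiguity gamma f) by exact: L2_ambiguity.
apply: (@form_eq0 F _ _ _ _ _ _ _ Lp1 Lp2) => /=; rewrite /F.
- move=> f g h Lf Lg' Lh; rewrite (ambiguityDr Lg Lf Lg').
  rewrite (innerDl (LA _ Lf) (LA _ Lg') (LA _ Lh)) (innerDl Lf Lg' Lh).
  exact: subMD.
- move=> f g h Lf Lg' Lh; rewrite (ambiguityDr Lg Lg' Lh).
  rewrite (innerDr (LA _ Lf) (LA _ Lg') (LA _ Lh)) (innerDr Lf Lg' Lh).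
  exact: subMD.
- move=> f g Lf Lg'; rewrite (ambiguityZr Lg Lf).
  rewrite (innerZl _ (LA _ Lf) (LA _ Lg')) (innerZl _ Lf Lg').
  exact: subMZ.
- move=> f g Lf Lg'; rewrite (ambiguityZr Lg Lg').
  rewrite (innerZr _ (LA _ Lf) (LA _ Lg')) (innerZr _ Lf Lg') conji.
  exact: subMZ.
- move=> f Lf; rewrite !innerxx (N2_ambiguity Lg Lf) fineM ?N2_fin_num//.
  by rewrite rmorphM subrr.
Qed.

Lemma inner_ambiguity gamma1 gamma2 phi1 phi2 :
  L2 mu gamma1 -> L2 mu gamma2 -> L2 mu phi1 -> L2 mu phi2 ->
  inner mu2 (ambiguity gamma1 phi1) (ambiguity gamma2 phi2) =
  inner mu phi1 phi2 * inner mu gamma2 gamma1.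
Proof.
move=> Lg1 Lg2 Lp1 Lp2; rewrite mulrC; apply/eqP; rewrite -subr_eq0; apply/eqP.
(* The form is conjugate-linear in the window, so the two windows are exchanged to make [F] linear
   in [f] and conjugate-linear in [g]. Its diagonal is the case of a common window. *)
pose F f g := inner mu2 (ambiguity g phi1) (ambiguity f phi2) -
  inner mu f g * inner mu phi1 phi2.
have LA f : L2 mu f -> L2 mu2 (ambiguity f phi1) by move=> Lf; exact: L2_ambiguity.
have LA' f : L2 mu f -> L2 mu2 (ambiguity f phi2) by move=> Lf; exact: L2_ambiguity.
apply: (@form_eq0 F _ _ _ _ _ _ _ Lg2 Lg1) => /=; rewrite /F.
- move=> f g h Lf Lg Lh; rewrite (ambiguityDl Lf Lg Lp2).
  rewrite (innerDr (LA _ Lh) (LA' _ Lf) (LA' _ Lg)) (innerDl Lf Lg Lh).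
  exact: subMD.
- move=> f g h Lf Lg Lh; rewrite (ambiguityDl Lg Lh Lp1).
  rewrite (innerDl (LA _ Lg) (LA _ Lh) (LA' _ Lf)) (innerDr Lf Lg Lh).
  exact: subMD.
- move=> f g Lf Lg; rewrite (ambiguityZl Lf Lp2).
  rewrite (innerZr _ (LA _ Lg) (LA' _ Lf)) (innerZl _ Lf Lg) conjii.
  exact: subMZ.
- move=> f g Lf Lg; rewrite (ambiguityZl Lg Lp1).
  rewrite (innerZl _ (LA _ Lg) (LA' _ Lf)) (innerZr _ Lf Lg) conji.
  exact: subMZ.
- by move=> f Lf; rewrite inner_ambiguity_window// mulrC subrr.
Qed.

(** Conjugate symmetry turns the second factor into the conjugate of [ambiguity eta psi]. A product
    of two square-integrable functions is jointly integrable, which justifies the iterated integral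
    with [Q] inside. *)
Lemma ambiguity_inversion gamma eta phi psi :
  L2 mu gamma -> L2 mu eta -> L2 mu phi -> L2 mu psi ->
  let F QP := ambiguity gamma phi QP * inner mu (modulation QP.1 (translation QP.2 eta)) psi in
  cintegrable mu2 F /\
  cintegral mu (fun P => cintegral mu (fun Q => F (Q, P))) =
    inner mu phi psi * inner mu eta gamma.
Proof.
move=> Lg Le Lp Ls F.
have LA := L2_ambiguity Lg Lp; have LB := L2_ambiguity Le Ls.
have FE : F = (fun QP => ambiguity gamma phi QP * (ambiguity eta psi QP)^*%C).
  apply/funext => QP; congr (_ * _).
  exact: (innerJ Ls (L2_window QP.1 QP.2 Le)).
have iF : cintegrable mu2 F by rewrite FE; exact: (L2_cintegrable LA LB).
split; first exact: iF.
rewrite -(cintegral_fubiniG iF) FE.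
exact: (inner_ambiguity Lg Le Lp Ls).
Qed.

End ambiguity.

Theorem proposition2p3 (R : realType) (n : nat) (hn : (1 <= n)%N) :
  let mu := @lebesgue_heis R n in
  let mu2 := (@lebesgue_heis R n \x @lebesgue_heis R n)%E in
  (* orthogonality relation *)
  (forall f1 f2 g1 g2 : heis R n -> R[i],
     L2 mu f1 -> L2 mu f2 -> L2 mu g1 -> L2 mu g2 ->
     [/\ L2 mu2 (stft g1 f1), L2 mu2 (stft g2 f2) &
         inner mu2 (stft g1 f1) (stft g2 f2) = inner mu f1 f2 * inner mu g2 g1])
  /\
  (* Plancherel formula *)
  (forall f g : heis R n -> R[i], L2 mu f -> L2 mu g ->
     L2norm mu2 (stft g f) = (L2norm mu f * L2norm mu g)%E)
  /\
  (* inversion formula, in the weak sense *)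
  (forall g h : heis R n -> R[i], L2 mu g -> L2 mu h -> inner mu h g != 0 ->
   forall f : heis R n -> R[i], L2 mu f ->
   forall Gamma : heis R n -> R[i], L2 mu Gamma ->
     let F (Q P : heis R n) : R[i] :=
       stft g f (Q, P) *
       inner mu (modulation Q (translation P (fourier h))) Gamma in
     cintegrable mu2 (fun QP => F QP.1 QP.2) /\
     inner mu (fourier f) Gamma =
       (inner mu h g)^-1 *
       cintegral mu (fun P => cintegral mu (fun Q => F Q P))).
Proof.
move=> mu mu2; split=> [f1 f2 g1 g2 Lf1 Lf2 Lg1 Lg2|].
  have [Ff1 Ff2] := (L2_fourier Lf1, L2_fourier Lf2).
  have [Fg1 Fg2] := (L2_fourier Lg1, L2_fourier Lg2).
  split; [exact: L2_ambiguity|exact: L2_ambiguity|].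
  by rewrite [LHS]inner_ambiguity// !inner_fourier.
split=> [f g Lf Lg|g h Lg Lh hg f Lf Gamma LGamma F].
  have [Ff Fg] := (L2_fourier Lf, L2_fourier Lg).
  rewrite !L2normE (_ : N2 mu2 (stft g f) = N2 mu2 (ambiguity (fourier g) (fourier f)))//.
  by rewrite N2_ambiguity// !N2_fourier// poweRM ?N2_ge0.
have [Ff Fg Fh] := And3 (L2_fourier Lf) (L2_fourier Lg) (L2_fourier Lh).
have [iF FE] := ambiguity_inversion Fg Fh Ff LGamma.
split; first exact: iF.
(* The constant produced is the inner product of the transforms of [h] and [g]; unitarity makes it
   [inner mu h g], which is nonzero and cancels. *)
rewrite [X in _ = _ * X]FE (inner_fourier Lh Lg).
by rewrite mulrC mulfK.
Qed.
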